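(* For $\alpha\in(0,2)\setminus\{1\}$ define $$\beta=\begin{cases}\frac\alpha2,&\alpha\in(0,1),\\ 1-\frac\alpha2,&\alpha\in(1,\frac32],\\ \frac12-\frac\alpha6,&\alpha\in(\frac32,2).\end{cases}$$ Let $\omega(n)=|n|^\alpha$. For any $g\in BV(\mathbb T)$ and for each $t\neq0$, the linear fractional Schrödinger evolution satisfies $e^{it(-\Delta)^{\frac\alpha2}}g\in C^\beta_x$; in particular, $D_t(\omega,g)\le 2-\beta$. If in addition $g\notin H^{\frac12+}(\mathbb T)$, then for each $t\ne0$, $D_t(\omega,g)\ge 1+\beta$.
   Context: $\mathbb T=\mathbb R/(2\pi\mathbb Z)$; $BV(\mathbb T)$ is the set of functions of bounded variation on $\mathbb T$; $H^{\frac12+}(\mathbb T)=\bigcup_{s>1/2}H^s(\mathbb T)$. $e^{it(-\Delta)^{\alpha/2}}g=e^{itL_\omega}g=\sum_{n\in\mathbb Z}\widehat g(n)e^{it|n|^\alpha+inx}$. $C^\beta_x$ is the Hölder space of exponent $\beta$ in $x$. $D_t(\omega,g)$ is the maximum of the fractal dimensions of the graphs of the real and imaginary parts of $e^{itL_\omega}g$ as functions of $x$. The fractal (upper box-counting) dimension of a bounded set $E$ is $\limsup_{\epsilon\to0}\frac{\log\mathcal N(E,\epsilon)}{\log(1/\epsilon)}$, with $\mathcal N(E,\epsilon)$ the minimum number of $\epsilon$-balls needed to cover $E$. *)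

(* Defs.v *)
From HB Require Import structures.
From mathcomp Require Import all_boot all_order all_algebra.
From mathcomp Require Import all_classical all_reals all_analysis.
From mathcomp Require Import complex.

Set Implicit Arguments.
Unset Strict Implicit.
Unset Printing Implicit Defensive.

Import Order.TTheory GRing.Theory Num.Theory.
Import numFieldNormedType.Exports.
Import ComplexField.Normc.

Local Open Scope classical_set_scope.
Local Open Scope ring_scope.
Local Open Scope complex_scope.

(* Functions on the torus R / 2 pi Z are 2 pi-periodic functions on R, and
   complex-valued functions are handled through their real and imaginary
   parts; [normc] is the R-valued modulus on R[i]. *)

Section Torus.
Context {R : realType}.
Implicit Types (f : R -> R) (g u : R -> R[i]) (E : set (R * R)).

Notation mu := (@lebesgue_measure R).

Definition expi (x : R) : R[i] := cos x +i* sin x.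

Definition on_torus g := periodic g (pi *+ 2).

(* For a periodic function the variation over the closed period [0, 2 pi] is
   the variation over the torus. *)
Definition BV_torus g :=
  [/\ on_torus g, bounded_variation 0 (pi *+ 2) (fun x => complex.Re (g x))
    & bounded_variation 0 (pi *+ 2) (fun x => complex.Im (g x))].

Definition L2norm2 g : \bar R :=
  (\int[mu]_(x in `[0%R, (pi *+ 2)%R]) ((normc (g x) ^+ 2)%:E))%E.

Definition L2_torus g :=
  [/\ on_torus g, measurable_fun setT (fun x => complex.Re (g x)),
      measurable_fun setT (fun x => complex.Im (g x)) & (L2norm2 g < +oo)%E].

Definition torus_mean g : R[i] :=
  ((\int[mu]_(x in `[0, pi *+ 2]) complex.Re (g x)) / (pi *+ 2))
  +i* ((\int[mu]_(x in `[0, pi *+ 2]) complex.Im (g x)) / (pi *+ 2)).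

Definition fourier_coef g (n : int) : R[i] :=
  torus_mean (fun x => g x * expi (- (n%:~R * x))).

Definition sobolev (s : R) g :=
  L2_torus g /\
  (\esum_(n in [set: int])
     (((1 + n%:~R ^+ 2) `^ s * normc (fourier_coef g n) ^+ 2)%:E) < +oo)%E.

Definition sobolev_half_plus g := exists2 s : R, 2^-1 < s & sobolev s g.

Definition evolution_partial_sum (omega : int -> R) g (t : R) (N : nat) (x : R)
    : R[i] :=
  \sum_(k < N.*2.+1) let n := k%:Z - N%:Z in
     fourier_coef g n * expi (t * omega n + n%:~R * x).

(* u represents the L^2 class e^{i t L_omega} g, the L^2 sum of the series
   with terms fourier_coef g n * e^{i t omega(n) + i n x}, n in Z. *)
Definition is_evolution (omega : int -> R) g (t : R) u :=
  L2_torus u /\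
  (fun N => L2norm2 (fun x => u x - evolution_partial_sum omega g t N x)) @ \oo
    --> 0%E.

Definition hoelder_torus (b : R) u :=
  on_torus u /\
  exists C : R, forall x y, normc (u x - u y) <= C * `|x - y| `^ b.

Definition continuous_torus u :=
  [/\ on_torus u, continuous (fun x => complex.Re (u x))
    & continuous (fun x => complex.Im (u x))].

(* [ball] on R * R is taken for the maximum norm, hence this definition. *)
Definition disk (c : R * R) (e : R) : set (R * R) :=
  [set z | Num.sqrt ((z.1 - c.1) ^+ 2 + (z.2 - c.2) ^+ 2) < e].

(* The infimum is a minimum, and is +oo when no finite cover exists. *)
Definition covering_number E (e : R) : \bar R :=
  ereal_inf [set k%:R%:E | k in
    [set k : nat | exists c : 'I_k -> R * R, E `<=` \bigcup_i disk (c i) e]].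

Definition fractal_dim E : \bar R :=
  limf_esup (fun e : R => (lne (covering_number E e) * ((ln e^-1)^-1)%:E)%E)
    0^'+.

Definition torus_graph f : set (R * R) :=
  [set (x, f x) | x in `[0, pi *+ 2]].

Definition graph_dim u : \bar R :=
  Order.max (fractal_dim (torus_graph (fun x => complex.Re (u x))))
            (fractal_dim (torus_graph (fun x => complex.Im (u x)))).

(* D_t(omega, g) = d. The graph of the L^2 class e^{i t L_omega} g is that of
   its continuous representative, which is unique when it exists. *)
Definition is_evolution_dim (omega : int -> R) g (t : R) (d : \bar R) :=
  exists u, [/\ is_evolution omega g t u, continuous_torus u & d = graph_dim u].

Definition frac_omega (alpha : R) (n : int) : R := `|n%:~R| `^ alpha.

Definition frac_beta (alpha : R) : R :=
  if alpha < 1 then alpha / 2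
  else if alpha <= 3 / 2 then 1 - alpha / 2
  else 1 / 2 - alpha / 6.

End Torus.

(* Main.v *)
(* Since g has bounded variation, the part of the evolution with frequencies of
   size N is an integral against dg of a trigonometric sum with coefficients
   e^{it n^alpha} / (in). Van der Corput's second derivative test (third
   derivative test for alpha > 3/2) bounds it by N^{-beta} uniformly, and summing
   dyadic blocks gives Hoelder continuity, hence the upper bound of the dimension.

   For the lower bound, suppose that the real and imaginary parts of u have graphs
   of dimension < M < 1 + beta. Counting the disks of radius h above each column of
   width h bounds the L^1 norm of u(. + h) - u by h^{2-M}, and the Hoelder bound
   makes its squared L^2 norm O(h^{2+beta-M}) with 2 + beta - M > 1. By Parseval the
   Fourier coefficients of u, which have the moduli of those of g, then put g in
   H^s for some s > 1/2. *)
Require Import Defs.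
From HB Require Import structures.
From mathcomp Require Import all_boot all_order all_algebra.
From mathcomp Require Import all_classical all_reals all_analysis.
From mathcomp Require Import measurable_realfun complex ring lra zify.

Set Implicit Arguments.
Unset Strict Implicit.
Unset Printing Implicit Defensive.

Import Order.TTheory GRing.Theory Num.Theory.
Import numFieldNormedType.Exports.
Import ComplexField.Normc.

Local Open Scope classical_set_scope.
Local Open Scope ring_scope.
Local Open Scope complex_scope.

(** * Exponential sums *)

(** The cases of beta come from one exponential sum, over n of size N with phase t n^alpha + n x.
    Its second differences have size N^(alpha-2) and give N^(alpha/2) + N^(1-alpha/2); its third
    differences have size N^(alpha-3) and give N^(1/2+alpha/6), which beats N^(alpha/2) exactly
    beyond alpha = 3/2. At alpha = 1 second differences vanish. Pairing with dg evaluates the sum at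
    x - y for all y, so the bounds must be uniform in x; they are, because x enters the phase
    linearly and disappears from second differences.

    The dimension is stated for an arbitrary continuous representative, whereas the Hoelder bound is
    obtained for the uniform limit of the partial sums; the two have to be identified before either
    estimate applies.

    In the lower bound Parseval is used in finite form, on equispaced points and for partial sums,
    so that increments of u enter at finitely many points only and can be compared with disk counts
    directly. *)

Section ComplexModulus.
Context {R : realType}.
Implicit Types (z w : R[i]) (x y : R).

Lemma normc_ge0 z : 0 <= normc z.
Proof. by case: z => a b; exact: sqrtr_ge0. Qed.

Lemma normcD z w : normc (z + w) <= normc z + normc w.
Proof. exact: le_normcD. Qed.

Lemma normc_sum (I : Type) (r : seq I) (P : pred I) (F : I -> R[i]) :
  normc (\sum_(i <- r | P i) F i) <= \sum_(i <- r | P i) normc (F i).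
Proof.
elim/big_ind2 : _ => //; first by rewrite normc0.
move=> z x w y zx wy; exact: le_trans (normcD x y) (lerD zx wy).
Qed.

Lemma normcBC z w : normc (z - w) = normc (w - z).
Proof. by rewrite -[z - w]opprB; exact: normcN. Qed.

Lemma normc_triangle (v z w : R[i]) : normc (z - w) <= normc (z - v) + normc (v - w).
Proof. by rewrite -[z - w](subrKA v); exact: normcD. Qed.

Lemma sqr_normcE z : normc z ^+ 2 = complex.Re z ^+ 2 + complex.Im z ^+ 2.
Proof. by case: z => a b /=; rewrite sqr_sqrtr// addr_ge0// sqr_ge0. Qed.

Lemma normc_Re z : `|complex.Re z| <= normc z.
Proof.
by rewrite -(@ler_pXn2r _ 2)// ?nnegrE ?normc_ge0// sqr_normcE real_normK ?num_real//
  lerDl sqr_ge0.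
Qed.

Lemma normc_Im z : `|complex.Im z| <= normc z.
Proof.
by rewrite -(@ler_pXn2r _ 2)// ?nnegrE ?normc_ge0// sqr_normcE real_normK ?num_real//
  lerDr sqr_ge0.
Qed.

Lemma normc_le_ReIm z : normc z <= `|complex.Re z| + `|complex.Im z|.
Proof.
rewrite -(@ler_pXn2r _ 2)// ?nnegrE ?normc_ge0 ?addr_ge0//.
by rewrite sqr_normcE sqrrD !real_normK ?num_real// addrAC lerDl mulrn_wge0// mulr_ge0.
Qed.

Lemma normc_real x : normc x%:C = `|x|.
Proof. by rewrite /= expr0n addr0 sqrtr_sqr. Qed.

Lemma normcJ z : normc z^*%C = normc z.
Proof. by case: z => a b /=; rewrite sqrrN. Qed.

Lemma conjcM z w : (z * w)^*%C = z^*%C * w^*%C.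
Proof. exact: rmorphM. Qed.

Lemma normc_sqrJ z : z * z^*%C = (normc z ^+ 2)%:C.
Proof.
rewrite sqr_normcE; case: z => a b; rewrite /GRing.mul/=/mulc; congr (_ +i* _).
  by rewrite mulrN opprK !expr2.
by rewrite mulrN mulrC addNr.
Qed.

Lemma Re_sum (I : Type) (r : seq I) (P : pred I) (F : I -> R[i]) :
  complex.Re (\sum_(i <- r | P i) F i) = \sum_(i <- r | P i) complex.Re (F i).
Proof. exact: raddf_sum. Qed.

Lemma Im_sum (I : Type) (r : seq I) (P : pred I) (F : I -> R[i]) :
  complex.Im (\sum_(i <- r | P i) F i) = \sum_(i <- r | P i) complex.Im (F i).
Proof. exact: raddf_sum. Qed.

Lemma normc_expi x : normc (expi x) = 1.
Proof. by rewrite /= cos2Dsin2 sqrtr1. Qed.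

Lemma expiD x y : expi (x + y) = expi x * expi y.
Proof.
by rewrite /expi cosD sinD /GRing.mul /=; congr (_ +i* _); rewrite addrC.
Qed.

Lemma expi0 : expi (0 : R) = 1.
Proof. by rewrite /expi cos0 sin0. Qed.

Lemma expiJ x : (expi x)^*%C = expi (- x).
Proof. by rewrite /expi cosN sinN. Qed.

Lemma expi_period x n : expi (x + pi *+ 2 * n%:R) = expi x.
Proof.
elim: n => [|n IH]; first by rewrite mulr0 addr0.
rewrite -natr1 mulrDr mulr1 addrA expiD IH.
by rewrite {2}/expi cos2pi sin2pi mulr1.
Qed.

Lemma expi_periodz x (m : int) : expi (x + pi *+ 2 * m%:~R) = expi x.
Proof.
case: m => n; first exact: expi_period.
by rewrite NegzE mulrNz mulrN -[in RHS](subrK (pi *+ 2 * n.+1%:R) x) expi_period.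
Qed.

Lemma expiX x n : expi x ^+ n = expi (x * n%:R).
Proof.
elim: n => [|n IH]; first by rewrite mulr0 expi0.
by rewrite exprS IH -expiD -natr1 mulrDr mulr1 addrC.
Qed.

Lemma normc_expiB x : normc (expi x - 1) = 2 * `|sin (x / 2)|.
Proof.
apply/eqP; rewrite -(@eqrXn2 _ 2)// ?normc_ge0 ?mulr_ge0//; apply/eqP.
rewrite sqr_normcE exprMn real_normK ?num_real//=.
have -> : cos x = 1 - sin (x / 2) ^+ 2 *+ 2.
  by rewrite -{1}[x](@divfK _ 2)// mulr_natr cos_mulr2n cos2sin2; ring.
have -> : sin x = sin (x / 2) * cos (x / 2) *+ 2.
  rewrite -{1}[x](@divfK _ 2)// mulr_natr sin_mulr2n. by rewrite mulrC.
rewrite subr0 -mulr_natr -[_ *+ 2 in X in _ + X]mulr_natr !exprMn (cos2sin2 (x/2));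
  ring.
Qed.

End ComplexModulus.

Section RealTrigonometry.
Context {R : realType}.
Implicit Types x y : R.

Lemma ler_sin_id x : 0 <= x -> sin x <= x.
Proof.
move=> x0.
have [|c _] := @MVT_segment R (@sin R) (@cos R) 0 x x0 (fun y _ => is_derive_sin y).
  by apply: continuous_subspaceT; exact: continuous_sin.
rewrite sin0 !subr0 => ->; rewrite ler_piMl//; exact: cos_le1.
Qed.

Lemma normr_sin x : `|sin x| <= `|x|.
Proof.
wlog x0 : x / 0 <= x => [H|].
  have [/H//|x0] := leP 0 x.
  by rewrite -normrN -sinN -[`|x|]normrN; apply: H; rewrite oppr_ge0 ltW.
have [xp|xp] := leP x pi.
  by rewrite !ger0_norm// ?ler_sin_id// sin_ge0_pi// x0.
rewrite (ger0_norm x0); apply: le_trans (ltW xp).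
by rewrite (le_trans _ (pi_ge2 R))// (le_trans (sin_max x))// ler1n.
Qed.

Lemma normc_expiB_le x : normc (expi x - 1) <= `|x|.
Proof.
rewrite normc_expiB (le_trans (ler_wpM2l _ (normr_sin _)))//.
by rewrite normrM normfV (@ger0_norm _ 2)// mulrC divfK.
Qed.

(** sin y - y cos y has derivative y sin y >= 0. Dividing by x sin x bounds the cotangent by 1/x. *)
Lemma ler_xcos_sin x : 0 <= x <= pi -> x * cos x <= sin x.
Proof.
move=> /andP[x0 xpi].
have D (y : R) : y \in `]0, x[ -> is_derive y 1 (fun y =>
  sin y - y * cos y) (y * sin y).
  by move=> _; apply: is_derive_eq; rewrite /GRing.scale/=; ring.
have [|c cx] := MVT_segment x0 D.
  apply: continuous_subspaceT => y.
  apply: cvgB; first exact: continuous_sin.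
  apply: cvgM; [exact: cvg_id | exact: continuous_cos].
rewrite sin0 mul0r !subr0 => E; rewrite -subr_ge0 E !mulr_ge0//.
  by move: cx; rewrite in_itv/= => /andP[].
apply: sin_ge0_pi; move: cx; rewrite in_itv/= => /andP[-> cx]/=.
exact: le_trans cx xpi.
Qed.

End RealTrigonometry.

(** * The Kusmin-Landau inequality and the second derivative test *)

Section ExponentialSums.
Context {R : realType}.
Implicit Types (z w : nat -> R[i]) (d : nat -> R).

Lemma abel_sum z w L :
  \sum_(i < L.+1) w i * z i =
  w L * (\sum_(i < L.+1) z i) -
  \sum_(i < L) (w i.+1 - w i) * (\sum_(j < i.+1) z j).
Proof.
elim: L => [|L IH]; first by rewrite big_ord0 subr0 !big_ord_recr !big_ord0/= !add0r.
rewrite big_ord_recr/= IH [X in _ = w L.+1 * X - _]big_ord_recr/=.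
rewrite [X in _ = _ - X]big_ord_recr/=.
ring.
Qed.

(** Weights cost only their last value plus their total variation. This is applied to 1/(1 -
    e^{id}), to 1/n and to e^{in(x-y)} - 1. *)
Lemma abel_normc z w L (M : R) :
  (forall k, (k <= L.+1)%N -> normc (\sum_(i < k) z i) <= M) ->
  normc (\sum_(i < L.+1) w i * z i) <=
  M * (normc (w L) + \sum_(i < L) normc (w i.+1 - w i)).
Proof.
move=> zM; rewrite abel_sum mulrDr.
apply: le_trans (normcD _ _) _; rewrite normcN normcM mulrC.
apply: lerD; first by apply: ler_wpM2r; rewrite ?normc_ge0 ?zM.
apply: le_trans (normc_sum _ _ _) _; rewrite mulr_sumr; apply: ler_sum => i _.
by rewrite normcM mulrC ler_wpM2r ?normc_ge0 ?zM// ltnS ltnW.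
Qed.

(* 1 / (1 - e^{id}) = (1 + i cot(d/2)) / 2 runs along a vertical line, and
   its total variation is that of the cotangent. *)
Lemma kusmin_landau z d L (theta : R) :
  0 < theta -> (forall i, normc (z i) = 1) ->
  (forall i, (i < L)%N -> z i.+1 = z i * expi (d i)) ->
  (forall i, (i.+1 < L)%N -> d i <= d i.+1) ->
  (forall i, (i < L)%N -> theta <= d i <= pi *+ 2 - theta) ->
  normc (\sum_(i < L) z i) <= 10 / theta.
Proof.
case: L => [|L] th0 z1 zS dS dth; first by rewrite big_ord0 normc0 divr_ge0// ltW.
pose cot i := cos (d i / 2) / sin (d i / 2).
pose w i : R[i] := 2^-1 +i* (cot i / 2).
have dpi i : (i < L.+1)%N -> theta / 2 <= d i / 2 <= pi - theta / 2.
  by move=> /dth; rewrite -mulr_natr => /andP[? ?]; lra.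
have s0 i : (i < L.+1)%N -> 0 < sin (d i / 2).
  by move=> /dpi /andP[? ?]; apply: sin_gt0_pi; apply/andP; split; lra.
(* [w] is 1/(1 - e^{id}), so each term is a weight times a difference of consecutive terms, and sums
   of these differences telescope to modulus at most 2. *)
have wz i : (i < L.+1)%N -> z i = w i * (z i - z i.+1).
  move=> iL; rewrite zS// -{2}[z i]mulr1 -mulrBr mulrCA -[LHS]mulr1; congr (_ * _).
  have si := s0 _ iL; have [s c] : sin (d i) = sin (d i / 2) * cos (d i / 2) *+ 2 /\
     cos (d i) = 1 - sin (d i / 2) ^+ 2 *+ 2.
    split; rewrite -{1}[d i](@divfK _ 2)// mulr_natr ?sin_mulr2n ?cos_mulr2n ?cos2sin2;
      first by rewrite mulrC.
    ring.
  rewrite /expi s c /w /cot.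
  have cs := cos2Dsin2 (d i / 2).
  have sn : sin (d i / 2) != 0 by rewrite gt_eqF.
  apply/eqP; rewrite eq_complex; apply/andP; split; apply/eqP => /=.
    transitivity (cos (d i / 2) ^+ 2 + sin (d i / 2) ^+ 2); first by rewrite cs.
    by field.
  by field.
(* [ler_xcos_sin] at y and at pi - y bounds |cot y| by the inverse distance from y to the nearer of
   0 and pi. *)
have cot_le i : (i < L.+1)%N -> `|cot i| <= 2 / theta.
  move=> iL; have := dpi _ iL; have := s0 _ iL.
  rewrite /cot; move: (d i / 2) => y s /andP[y1 y2].
  have e1 : y * cos y <= sin y by apply: ler_xcos_sin; apply/andP; split; lra.
  have e2 : (pi - y) * - cos y <= sin y.
    have := @ler_xcos_sin _ (pi - y).
    have -> : cos (pi - y) = - cos y by rewrite cosB cospi sinpi; ring.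
    have -> : sin (pi - y) = sin y by rewrite sinB cospi sinpi; ring.
    by apply; apply/andP; split; lra.
  rewrite normrM normfV (gtr0_norm s) ler_pdivrMr// mulrC mulrA ler_pdivlMr//.
  by case: ger0P => c0; nra.
have cot_decr i : (i.+1 < L.+1)%N -> cot i.+1 <= cot i.
  move=> iL; have := dS _ iL; have := dpi _ (ltnW iL); have := dpi _ iL.
  have := s0 _ (ltnW iL); have := s0 _ iL; rewrite /cot.
  move: (d i) (d i.+1) => a b sb sa /andP[b1 b2] /andP[a1 a2] ab.
  rewrite ler_pdivrMr// mulrAC ler_pdivlMr//.
  have : 0 <= sin (b / 2 - a / 2) by apply: sin_ge0_pi; apply/andP; split; lra.
  by rewrite sinB; lra.
rewrite (eq_bigr (fun i : 'I_L.+1 => w i * (z i - z i.+1))); last first.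
  by move=> i _; apply: wz.
apply: le_trans (@abel_normc (fun i => z i - z i.+1) w L 2 _) _.
  move=> k kL; have -> : \sum_(i < k) (z i - z i.+1) = z 0%N - z k.
    elim: k {kL} => [|k IH]; first by rewrite big_ord0 subrr.
    by rewrite big_ord_recr/= IH addrA subrK.
  by apply: le_trans (normcD _ _) _; rewrite normcN !z1.
have -> : \sum_(i < L) normc (w i.+1 - w i) = (cot 0%N - cot L) / 2.
  rewrite (eq_bigr (fun i : 'I_L => (cot i - cot i.+1) / 2)).
    elim: (L) => [|k IH]; first by rewrite big_ord0 subrr mul0r.
    by rewrite big_ord_recr/= IH; ring.
  move=> i _; rewrite /w /= subrr expr0n add0r sqrtr_sqr distrC.
  rewrite -mulrBl ger0_norm// divr_ge0// subr_ge0 cot_decr//.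
  by rewrite ltnS.
have wL : normc (w L) <= 2^-1 + `|cot L| / 2.
  apply: le_trans (normc_le_ReIm _) _; rewrite /= lerD//.
    by rewrite ger0_norm.
  by rewrite normrM (@ger0_norm _ (2^-1)).
have := cot_le 0%N (ltn0Sn _); have := cot_le L (ltnSn _).
have thpi : theta <= pi by have := dpi L (ltnSn _); lra.
(* Abel summation leaves 1 + |cot L| + cot 0 - cot L <= 1 + 6/theta, and theta <= 4 turns the 1 into
   4/theta. *)
have : theta <= 4 by have := pihalf_lt2 R; lra.
have it0 : 0 < theta^-1 by rewrite invr_gt0.
move=> t4; have : 1 <= 4 * theta^-1 by rewrite ler_pdivlMr// mul1r.
have := ler_norm (cot 0%N); have := ler_norm (- cot L); rewrite normrN.
move: wL; lra.
Qed.

(** Monotonicity makes the indices below the level [y] an initial run; [c] ends it, and equals [a]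
    or [b] when one of the runs is empty. *)
Lemma monotone_split d L (y : R) a b :
  (forall i, (i.+1 < L)%N -> d i <= d i.+1) -> (a <= b <= L)%N ->
  exists c, [/\ (a <= c <= b)%N, forall i, (a <= i < c)%N -> d i < y
              & forall i, (c <= i < b)%N -> y <= d i].
Proof.
move=> dS; elim: b => [|b IH] /andP[ab bL].
  by exists a; split => [|i ?|i ?]; [|exfalso|exfalso]; lia.
move: ab; rewrite leq_eqVlt => /predU1P[->|ab].
  by exists b.+1; split => [|i ?|i ?]; [|exfalso|exfalso]; lia.
have [|c [c1 c2 c3]] := IH; first by lia.
have [yd|dy] := leP y (d b).
  exists c; split => //; first lia.
  move=> i ic; have [->//|ib] := eqVneq i b; apply: c3; lia.
have cb : c = b.
  apply/eqP; rewrite eqn_leq; apply/andP; split; first lia.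
  rewrite leqNgt; apply/negP => cb.
  have := c3 b.-1; rewrite leNgt => /(_ _)/negP; apply; first lia.
  by apply: le_lt_trans dy; rewrite -[in d b](@prednK b); [apply: dS|]; lia.
exists b.+1; split => [|i|i ?]; [lia| |exfalso; lia].
rewrite ltnS => /andP[ai]; rewrite leq_eqVlt => /predU1P[->//|ib].
by apply: c2; rewrite cb ai.
Qed.

Lemma normc_sum_cat (F : nat -> R[i]) a b c : (a <= c <= b)%N ->
  normc (\sum_(a <= i < b) F i) <=
  normc (\sum_(a <= i < c) F i) + normc (\sum_(c <= i < b) F i).
Proof. by move=> /andP[ac cb]; rewrite (big_cat_nat ac cb); exact: normcD. Qed.

Lemma normc_sum_nat1 z a b : (forall i, normc (z i) = 1) ->
  normc (\sum_(a <= i < b) z i) <= (b - a)%:R.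
Proof.
move=> z1; apply: le_trans (normc_sum _ _ _) _.
by rewrite (eq_bigr (fun=> 1)) ?sumr_const_nat// => i _; rewrite z1.
Qed.

Lemma increment_lower d L (lam : R) a b :
  (forall i, (i < L)%N -> lam <= d i.+1 - d i) -> (a <= b <= L)%N ->
  (b - a)%:R * lam <= d b - d a.
Proof.
move=> dS; elim: b => [|b IH] /andP[ab bL].
  by move: ab; rewrite leqn0 => /eqP->; rewrite subrr mul0r.
move: ab; rewrite leq_eqVlt => /predU1P[->|ab]; first by rewrite subnn subrr mul0r.
rewrite subSn// -natr1 mulrDl mul1r.
have := IH ltac:(lia); have := dS b bL; lra.
Qed.

Lemma increment_upper d L (lam : R) a b :
  (forall i, (i < L)%N -> d i.+1 - d i <= lam) -> (a <= b <= L)%N ->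
  d b - d a <= (b - a)%:R * lam.
Proof.
move=> dS ab; rewrite -lerN2 -mulrN opprB.
have := @increment_lower (fun i => - d i) L (- lam) a b _ ab.
rewrite opprK addrC; apply => i iL.
by rewrite -opprD lerN2 dS.
Qed.

(* Indices with d(i) within [theta] of 2 pi m are counted, the others are
   left to [kusmin_landau]; theta = sqrt lam balances both. *)
Lemma second_derivative_period z d L (lam : R) (m : int) a b :
  0 < lam <= 1 -> (forall i, normc (z i) = 1) ->
  (forall i, (i < L)%N -> z i.+1 = z i * expi (d i)) ->
  (forall i, (i < L)%N -> lam <= d i.+1 - d i) ->
  (a <= b <= L)%N ->
  (forall i, (a <= i < b)%N -> pi *+ 2 * m%:~R <= d i < pi *+ 2 * (m + 1)%:~R) ->
  normc (\sum_(a <= i < b) z i) <= 14 / Num.sqrt lam.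
Proof.
move=> /andP[l0 l1] z1 zS dS ab dm.
pose th := Num.sqrt lam.
have th0 : 0 < th by rewrite sqrtr_gt0.
have th2 : th ^+ 2 = lam by rewrite sqr_sqrtr// ltW.
have th1 : th <= 1 by rewrite -[leRHS]sqrtr1 ler_sqrt.
have dmon i : (i.+1 < L)%N -> d i <= d i.+1.
  by move=> iL; have := dS i (ltnW iL); lra.
have [c [ac c1 c2]] := @monotone_split d L (pi *+ 2 * m%:~R + th) a b dmon ab.
have [|e [ce e1 e2]] := @monotone_split d L (pi *+ 2 * (m + 1)%:~R - th) c b dmon;
  first lia.
(* A run on which [d] varies by at most theta has at most theta/lam + 1 = 1/theta + 1 <= 2/theta
   terms. Two such runs and the Kusmin-Landau middle give 2 + 2 + 10 = 14. *)
have short p q : (p <= q)%N -> (q <= L)%N ->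
    (forall i, (p <= i < q)%N -> forall j, (p <= j < q)%N -> d i - d j <= th) ->
    normc (\sum_(p <= i < q) z i) <= 2 / th.
  move=> pq qL pqth; apply: le_trans (normc_sum_nat1 _ _ z1) _.
  have [->|pq'] := eqVneq p q; first by rewrite subnn divr_ge0// ltW.
  have H := @increment_lower d L lam p q.-1 dS ltac:(lia).
  have {H} := le_trans H (pqth q.-1 ltac:(lia) p ltac:(lia)).
  have -> : (q - p = (q.-1 - p).+1)%N by lia.
  rewrite -natr1 -th2 => H; rewrite ler_pdivlMr//.
  have : (q.-1 - p)%:R * th <= 1.
    by rewrite -(ler_pM2r th0) mul1r -mulrA -expr2.
  lra.
apply: le_trans (@normc_sum_cat z a b c _) _; first lia.
apply: le_trans (lerD (lexx _) (@normc_sum_cat z c b e _)) _; first lia.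
have S1 : normc (\sum_(a <= i < c) z i) <= 2 / th.
  apply: short => [||i ic j jc]; [lia|lia|].
  have := c1 i ic; have /andP[? ?] := dm j ltac:(lia); lra.
have S2 : normc (\sum_(e <= i < b) z i) <= 2 / th.
  apply: short => [||i ic j jc]; [lia|lia|].
  have := e2 j jc; have /andP[? ?] := dm i ltac:(lia); lra.
have S3 : normc (\sum_(c <= i < e) z i) <= 10 / th.
  rewrite -{1}[c]add0n big_addn big_mkord.
  apply: (@kusmin_landau (fun i => z (i + c)%N)
    (fun i => d (i + c)%N - pi *+ 2 * m%:~R)) => //.
  - by move=> i ie; rewrite addSn zS; [|lia];
      rewrite -[in RHS](@expi_periodz _ (_ - _) m) subrK.
  - by move=> i ie; rewrite addSn lerD2r dmon; lia.
  - move=> i ie; have := c2 (i + c)%N ltac:(lia); have := e1 (i + c)%N ltac:(lia).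
    by rewrite intrD mulrDr mulr1 => ? ?; apply/andP; split; lra.
rewrite -/th; lra.
Qed.

(** Since [d] increases, each of the [k] periods is met along one run of consecutive indices; the
    induction peels off the last period. *)
Lemma second_derivative_range z d L (lam : R) (m : int) k a b :
  0 < lam <= 1 -> (forall i, normc (z i) = 1) ->
  (forall i, (i < L)%N -> z i.+1 = z i * expi (d i)) ->
  (forall i, (i < L)%N -> lam <= d i.+1 - d i) ->
  (a <= b <= L)%N ->
  (forall i, (a <= i < b)%N ->
     pi *+ 2 * m%:~R <= d i < pi *+ 2 * (m + k%:Z)%:~R) ->
  normc (\sum_(a <= i < b) z i) <= 14 / Num.sqrt lam * k%:R.
Proof.
move=> l01 z1 zS dS; elim: k b => [|k IH] b ab dm.
  have [->|ab'] := eqVneq a b; first by rewrite big_geq// normc0 mulr0.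
  by have := dm a; rewrite addr0 ltNge => /(_ _)/andP[]; [lia|move=> ->].
have dmon i : (i.+1 < L)%N -> d i <= d i.+1.
  by move=> iL; have := dS i (ltnW iL); case/andP: l01 => ? ?; lra.
have [c [ac c1 c2]] := @monotone_split d L (pi *+ 2 * (m + k%:Z)%:~R) a b dmon ab.
apply: le_trans (@normc_sum_cat z a b c _) _; first lia.
rewrite -[k.+1]addn1 natrD mulrDr mulr1 lerD//.
  apply: IH; first lia.
  by move=> i ic; rewrite c1// andbT; have /andP[] := dm i ltac:(lia).
apply: (@second_derivative_period z d L lam (m + k%:Z)) => //; first lia.
move=> i ic; rewrite c2//=; have /andP[_] := dm i ltac:(lia).
by rewrite -addrA (_ : k%:Z + 1 = k.+1)//; lia.
Qed.

Lemma second_derivative_test_pos z d L (lam Lam : R) :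
  0 < lam -> (forall i, normc (z i) = 1) ->
  (forall i, (i < L)%N -> z i.+1 = z i * expi (d i)) ->
  (forall i, (i < L)%N -> lam <= d i.+1 - d i <= Lam) ->
  normc (\sum_(i < L) z i) <= 14 / Num.sqrt lam * (L%:R * Lam + 2).
Proof.
case: L => [|L] l0 z1 zS dS.
  by rewrite big_ord0 normc0 mul0r add0r mulr_ge0// divr_ge0// sqrtr_ge0.
have s0 : 0 < Num.sqrt lam by rewrite sqrtr_gt0.
have lL : lam <= Lam by have /andP[/le_trans] := dS 0%N isT; apply.
(* [second_derivative_period] requires lam <= 1. For lam > 1 the number of terms is a sufficient
   bound, as sqrt lam <= lam <= [Lam]. *)
have [l1|l1] := leP lam 1; last first.
  have s1 : 1 <= Num.sqrt lam by rewrite -sqrtr1 ler_sqrt// ltW.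
  rewrite -(big_mkord xpredT z); apply: le_trans (normc_sum_nat1 _ _ z1) _.
  rewrite subn0 mulrAC ler_pdivlMr//.
  have : Num.sqrt lam <= lam by have := @sqr_sqrtr _ lam (ltW l0); nra.
  have : 0 <= L.+1%:R :> R by []. nra.
pose q : R := (d 0%N) / (pi *+ 2).
have p0 : 0 < pi *+ 2 :> R by rewrite mulrn_wgt0// pi_gt0.
have p2 : 2 <= pi *+ 2 :> R by rewrite -mulr_natl; have := pi_ge2 R; lra.
pose m := Num.floor q.
(* [d] grows by at most [Lam] per step, so it meets about L Lam / (2 pi) periods; the 2 pays for
   rounding at the two ends. *)
have [k [k1 k2]] : exists k, d L < pi *+ 2 * (m + k%:Z)%:~R /\ (k%:R : R) <=
  L.+1%:R * Lam + 2.
  pose x : R := (d L - d 0%N) / (pi *+ 2) + 1.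
  have x0 : 0 <= x.
    rewrite addr_ge0// mulr_ge0 ?invr_ge0 ?(ltW p0)// subr_ge0.
    have := @increment_lower d L.+1 0 0%N L; rewrite mulr0 subr_ge0; apply; last lia.
    by move=> i /dS/andP[+ _]; apply: le_trans; exact: ltW.
  exists (Num.truncn x).+1; split.
    have := floorD1_gt q; rewrite -/m intrD => H1.
    have := truncnS_gt x => H2.
    rewrite intrD mulrC -ltr_pdivrMr//.
        have -> : d L / (pi *+ 2) = x - 1 + q 
      by move: p0; rewrite /x /q; move: (pi *+ 2) => P P0; field; rewrite gt_eqF.
    move: H1 H2; rewrite -!pmulrn /=; lra.
  have H : (Num.truncn x)%:R <= x by rewrite truncn_le.
  rewrite -[(Num.truncn x).+1]addn1 natrD.
  have H2 : d L - d 0%N <= L%:R * Lam.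
    have := @increment_upper d L.+1 Lam 0%N L; rewrite subn0; apply; last lia.
    by move=> i /dS/andP[].
  have H3 : x - 1 <= L.+1%:R * Lam.
    rewrite /x addrK ler_pdivrMr//; apply: le_trans H2 _.
    rewrite -[L.+1]addn1 natrD; have nL : 0 <= L%:R :> R by [].
    have Lam0 : 0 <= Lam by apply: le_trans lL; exact: ltW.
    have := mulr_ge0 (addr_ge0 nL (@ler01 R)) Lam0; move: p2; move: (pi *+ 2) => P; nra.
  lra.
rewrite -(big_mkord xpredT z).
apply: le_trans (@second_derivative_range z d L.+1 lam m k 0 L.+1 _ z1 zS _ _ _) _.
- by rewrite l0.
- by move=> i /dS/andP[].
- by rewrite leqnn.
- move=> i /andP[_ iL]; apply/andP; split.
    apply: (@le_trans _ _ (d 0%N)).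
      by rewrite mulrC -ler_pdivlMr// Num.Theory.floor_le.
    have := @increment_lower d L.+1 0 0%N i; rewrite mulr0 subr_ge0; apply; last lia.
    by move=> j /dS/andP[+ _]; apply: le_trans; exact: ltW.
  apply: le_lt_trans k1.
  have := @increment_lower d L.+1 0 i L; rewrite mulr0 subr_ge0; apply; last lia.
  by move=> j /dS/andP[+ _]; apply: le_trans; exact: ltW.
- by apply: ler_wpM2l => //; rewrite divr_ge0// ltW.
Qed.

(** Complex conjugation negates [d] and keeps the modulus, which reduces the decreasing case to the
    increasing one. *)
Lemma second_derivative_test z d L (lam Lam : R) :
  0 < lam -> (forall i, normc (z i) = 1) ->
  (forall i, (i < L)%N -> z i.+1 = z i * expi (d i)) ->
  (forall i, (i < L)%N -> lam <= d i.+1 - d i <= Lam) \/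
  (forall i, (i < L)%N -> lam <= d i - d i.+1 <= Lam) ->
  normc (\sum_(i < L) z i) <= 14 / Num.sqrt lam * (L%:R * Lam + 2).
Proof.
move=> l0 z1 zS [dS|dS]; first exact: second_derivative_test_pos dS.
rewrite -normcJ rmorph_sum/=.
apply: (@second_derivative_test_pos (fun i => (z i)^*%C) (fun i => - d i)) => //.
- by move=> i; rewrite normcJ.
- by move=> i iL; rewrite zS// -expiJ; exact: rmorphM.
- by move=> i iL; rewrite opprK addrC dS.
Qed.

End ExponentialSums.

(** * Weyl-van der Corput differencing and the third derivative test *)

Section VanDerCorputInequality.
Context {R : realType}.
Implicit Types (z : nat -> R[i]) (d e : nat -> R).

(** The squared deviations from the mean [A / n] have a nonnegative sum. *)
Lemma cauchy_schwarz_sum (a : nat -> R) L :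
  (\sum_(i < L) a i) ^+ 2 <= L%:R * \sum_(i < L) a i ^+ 2.
Proof.
case: L => [|L]; first by rewrite !big_ord0 mul0r expr0n.
set A := \sum_(i < _) a i; set n : R := L.+1%:R.
have n0 : 0 < n by rewrite ltr0n.
have : 0 <= \sum_(i < L.+1) (a i - A / n) ^+ 2 by apply: sumr_ge0 => i _;
  exact: sqr_ge0.
rewrite (eq_bigr (fun i : 'I_L.+1 => a i ^+ 2 - a i * (2 * A / n) + (A / n) ^+ 2));
  last first.
  by move=> i _; ring.
rewrite big_split/= sumrB -mulr_suml -/A sumr_const card_ord -[X in _ +
  X]mulr_natl -/n => H.
rewrite -subr_ge0; have -> : n * (\sum_(i < L.+1) a i ^+ 2) - A ^+ 2 =
  n * (\sum_(i < L.+1) a i ^+ 2 - A * (2 * A / n) + n * (A / n) ^+ 2).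
  by field; rewrite gt_eqF.
by rewrite mulr_ge0.
Qed.

(* S = H^-1 sum_h sum_i z_{i+h} up to an error of at most 2H. *)
Lemma shift_average z L H : (forall i, normc (z i) = 1) -> (0 < H)%N ->
  normc (\sum_(i < L) z i) <=
  2 * H%:R + H%:R^-1 * \sum_(i < L) normc (\sum_(h < H) z (i + h)%N).
Proof.
move=> z1 H0; have H0' : 0 < H%:R :> R by rewrite ltr0n.
set S := \sum_(i < L) z i.
have tel h : \sum_(i < L) z (i + h)%N - \sum_(i < L) z (i + h.+1)%N = z h - z (L + h)%N.
  elim: (L) => [|k IH]; first by rewrite !big_ord0 add0n !subrr.
  by rewrite !big_ord_recr/= opprD addrACA IH addrA subrK addSnnS.
have Sh h : normc (S - \sum_(i < L) z (i + h)%N) <= 2 * h%:R.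
  elim: h => [|h IH].
    by rewrite /S; under [X in _ - X]eq_bigr do rewrite addn0;
      rewrite subrr normc0 mulr0.
  apply: le_trans (normc_triangle (\sum_(i < L) z (i + h)%N) _ _) _.
  rewrite -[h.+1]addn1 natrD mulrDr lerD// addn1 tel.
  by apply: le_trans (normcD _ _) _; rewrite normcN !z1 mulr1.
have HS : H%:R * S = \sum_(h < H) (S - \sum_(i < L) z (i + h)%N) +
                     \sum_(i < L) \sum_(h < H) z (i + h)%N.
  rewrite sumrB [X in _ - X + _]exchange_big/= subrK sumr_const card_ord.
  by rewrite mulr_natl.
rewrite -(ler_pM2l H0') mulrDr mulVKf ?gt_eqF//.
have -> : H%:R * normc S = normc (H%:R * S).
  by rewrite normcM -(rmorph_nat (real_complex R)) normc_real ger0_norm.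
rewrite HS; apply: le_trans (normcD _ _) _; apply: lerD; last exact: normc_sum.
apply: le_trans (normc_sum _ _ _) _.
apply: (@le_trans _ _ (\sum_(h < H) (2 * H%:R))).
  by apply: ler_sum => h _; apply: le_trans (Sh _) _; rewrite ler_pM2l// ler_nat ltnW.
by rewrite sumr_const card_ord -[leLHS]mulr_natl.
Qed.

Lemma sum_ord_le (B : nat -> R) m n : (forall r, 0 <= B r) -> (m <= n)%N ->
  \sum_(r < m) B r <= \sum_(r < n) B r.
Proof.
move=> B0 mn; rewrite -!(big_mkord xpredT B) (big_cat_nat (leq0n m) mn)/=.
by rewrite lerDl sumr_ge0.
Qed.

(** [h - k + (k - h)] is |h - k| in truncated subtraction; a given distance occurs at most once on
    each side of [h]. *)
Lemma sum_dist_le (B : nat -> R) H h : (forall r, 0 <= B r) -> (h < H)%N ->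
  \sum_(k < H) B (h - k + (k - h))%N <= 2 * \sum_(r < H) B r.
Proof.
move=> B0 hH; rewrite -(big_mkord xpredT (fun k => B (h - k + (k - h))%N)).
rewrite (big_cat_nat (leq0n h) (ltnW hH))/= mulr_natl mulr2n; apply: lerD.
  rewrite big_nat_rev/= add0n big_mkord.
  rewrite (eq_bigr (fun r : 'I_h => B r.+1)); last by move=> r _; congr B;
    have := ltn_ord r; lia.
  case: H hH => // H hH; rewrite [leRHS]big_ord_recl ler_wpDl//=.
  exact: (@sum_ord_le (fun r => B r.+1)).
rewrite -{1}[h]add0n big_addn big_mkord.
rewrite (eq_bigr (fun r : 'I_(H - h) => B r)); last by move=> r _; congr B; lia.
by apply: sum_ord_le => //; lia.
Qed.

(** Cauchy-Schwarz squares the window sums of [shift_average]; expanding the squares leaves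
    correlations at lag |h - k|, whose phase has lost one degree. Each of the [H] rows is bounded by
    [sum_dist_le], and [B 0] takes the diagonal. *)
Lemma weyl_van_der_corput z L H (B : nat -> R) :
  (forall i, normc (z i) = 1) -> (0 < H)%N -> (forall r, 0 <= B r) ->
  L%:R <= B 0%N ->
  (forall h r, (0 < r)%N -> (h + r < H)%N ->
     normc (\sum_(i < L) z (i + h + r)%N * (z (i + h)%N)^*%C) <= B r) ->
  normc (\sum_(i < L) z i) <=
  2 * H%:R + H%:R^-1 * Num.sqrt (L%:R * (2 * H%:R * \sum_(r < H) B r)).
Proof.
move=> z1 H0 B0 BL zB; have H0' : 0 < H%:R :> R by rewrite ltr0n.
apply: le_trans (shift_average _ z1 H0) _.
rewrite lerD2l ler_pM2l ?invr_gt0//.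
set w := fun i => \sum_(h < H) z (i + h)%N.
have pos : 0 <= \sum_(r < H) B r by apply: sumr_ge0.
rewrite -(@ler_pXn2r _ 2)// ?nnegrE ?sqrtr_ge0// ?sumr_ge0//; last first.
  by move=> i _; exact: normc_ge0.
rewrite sqr_sqrtr ?mulr_ge0//.
apply: le_trans (cauchy_schwarz_sum (fun i => normc (w i)) L) _.
apply: ler_wpM2l => //.
have zz h k : (h < H)%N -> (k < H)%N ->
    normc (\sum_(i < L) z (i + h)%N * (z (i + k)%N)^*%C) <= B (h - k + (k - h))%N.
  move=> hH kH; have [hk|hk|->] := ltngtP h k.
  - have := zB h (k - h)%N ltac:(lia) ltac:(lia).
    rewrite (_ : h - k + (k - h) = k - h)%N; last lia.
    rewrite -normcJ rmorph_sum/=.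
    congr (normc _ <= _); apply: eq_bigr => i _; rewrite rmorphM/= conjcK mulrC.
    by congr (_ * (z _)^*%C); lia.
  - have := zB k (h - k)%N ltac:(lia) ltac:(lia).
    rewrite (_ : h - k + (k - h) = h - k)%N; last lia.
    by congr (normc _ <= _); apply: eq_bigr => i _; congr (z _ * _); lia.
  - rewrite subnn addn0; apply: le_trans BL; apply: le_trans (normc_sum _ _ _) _.
    rewrite (eq_bigr (fun=> 1)) ?sumr_const ?card_ord//.
    by move=> i _; rewrite normcM normcJ !z1 mulr1.
have -> : \sum_(i < L) normc (w i) ^+ 2 =
          normc (\sum_(h < H) \sum_(k < H) \sum_(i < L) z (i + h)%N * (z (i +
            k)%N)^*%C).
  transitivity (normc (\sum_(i < L) w i * (w i)^*%C)).
    rewrite (eq_bigr (fun i : 'I_L => (normc (w i) ^+ 2)%:C)) => [|i _];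
      last exact: normc_sqrJ.
    by rewrite -rmorph_sum normc_real ger0_norm// sumr_ge0// => i _; exact: sqr_ge0.
  congr normc; under [RHS]eq_bigr do rewrite exchange_big/=.
  rewrite [RHS]exchange_big/=; apply: eq_bigr => i _.
  rewrite /w rmorph_sum/= mulr_suml; apply: eq_bigr => h _.
  by rewrite mulr_sumr.
apply: le_trans (normc_sum _ _ _) _.
apply: (@le_trans _ _ (\sum_(h < H) (2 * \sum_(r < H) B r))).
  apply: ler_sum => h _; apply: le_trans (sum_dist_le B0 (ltn_ord h)).
  by apply: le_trans (normc_sum _ _ _) _; apply: ler_sum => k _; exact: zz.
by rewrite sumr_const card_ord -[leLHS]mulr_natl mulrCA mulrA.
Qed.

(* The term r = 0 is 0, as 0^-1 = 0. *)
Lemma sum_inv_sqrt H : \sum_(r < H.+1) (Num.sqrt r%:R)^-1 <= 2 * Num.sqrt H%:R :> R.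
Proof.
elim: H => [|H IH]; first by rewrite big_ord_recr big_ord0/= sqrtr0 invr0 addr0 mulr0.
rewrite big_ord_recr/=; apply: le_trans (lerD IH (lexx _)) _.
have := @sqr_sqrtr R H%:R (ler0n _ _); have := @sqr_sqrtr R H.+1%:R (ler0n _ _).
have : 0 < Num.sqrt H.+1%:R :> R by rewrite sqrtr_gt0 ltr0n.
rewrite -[H.+1]addn1 natrD.
set a := Num.sqrt (H%:R); set b := Num.sqrt (_ + _) => b0 bE aE.
rewrite -lerBrDl -[leLHS]mul1r ler_pdivrMr//; nra.
Qed.

(* The differences z_{i+h} z_i^* have second derivative of size h mu; the
   balance H ~ mu^(-1/3) is imposed by c1 <= mu H^3 <= c2. *)
Lemma third_derivative_test z d L H (mu C c1 c2 : R) :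
  (0 < H)%N -> 0 < mu -> 1 <= C -> 0 < c1 -> c1 <= mu * H%:R ^+ 3 <= c2 ->
  (forall i, normc (z i) = 1) ->
  (forall i, (i < L + H)%N -> z i.+1 = z i * expi (d i)) ->
  (forall i, (i < L + H)%N -> mu <= (d i.+2 - d i.+1) - (d i.+1 - d i) <= C * mu) \/
  (forall i, (i < L + H)%N -> mu <= (d i.+1 - d i) - (d i.+2 - d i.+1) <= C * mu) ->
  normc (\sum_(i < L) z i) <=
  2 * H%:R + Num.sqrt (2 * (1 + 14 * C * Num.sqrt c2 + 56 / Num.sqrt c1)
                      * (L%:R ^+ 2 / H%:R + L%:R * H%:R)).
Proof.
move=> H0 mu0 C1 c10 /andP[c1H c2H] z1 zS eS; set K := 1 + _ + _.
pose e i := d i.+1 - d i.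
have H0' : 0 < H%:R :> R by rewrite ltr0n.
have C0 : 0 <= C by apply: le_trans C1.
(* The second summand vanishes at r = 0, again because 0^-1 = 0. *)
pose B r : R := L%:R * (r == 0%N)%:R +
  14 * (L%:R * C * Num.sqrt (r%:R * mu) + 2 / Num.sqrt (r%:R * mu)).
have B0 r : 0 <= B r.
  by rewrite addr_ge0 ?mulr_ge0 ?addr_ge0 ?mulr_ge0 ?invr_ge0 ?sqrtr_ge0.
apply: le_trans (@weyl_van_der_corput z L H B z1 H0 B0 _ _) _.
- by rewrite /B eqxx mulr1 mul0r sqrtr0 invr0 !mulr0 addr0 mulr0 addr0.
- move=> h r r0 hrH; have rmu0 : 0 < r%:R * mu by rewrite mulr_gt0// ltr0n.
  have rmu2 := sqr_sqrtr (ltW rmu0).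
  have rmus : 0 < Num.sqrt (r%:R * mu) by rewrite sqrtr_gt0.
  (* At lag [r] the phase increment is d(i+h+r) - d(i+h). Its own step is a sum of [r] consecutive
     second differences of [d], hence of modulus between r mu and r C mu. *)
  apply: le_trans (@second_derivative_test _
    (fun i => z (i + h + r)%N * (z (i + h)%N)^*%C)
    (fun i => d (i + h + r)%N - d (i +
      h)%N) L (r%:R * mu) (r%:R * (C * mu)) rmu0 _ _ _) _.
  + by move=> i; rewrite normcM normcJ !z1 mulr1.
  + move=> i iL; rewrite 2!addSn !zS; try lia.
    by rewrite expiD -expiJ rmorphM/=; ring.
  + have step i : d (i.+1 + h + r)%N - d (i.+1 + h)%N - (d (i + h + r)%N - d (i + h)%N)
               = e (i + h + r)%N - e (i + h)%N by rewrite /e !addSn; ring.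
    have step' i : (d (i + h + r)%N - d (i + h)%N) - (d (i.+1 + h + r)%N - d (i.+1 +
      h)%N)
               = - e (i + h + r)%N + e (i + h)%N by rewrite /e !addSn; ring.
    case: eS => eS; [left|right] => i iL.
      rewrite step; have := @increment_lower _ e (L + H) mu (i + h) (i + h +
        r) _ ltac:(lia).
      have := @increment_upper _ e (L + H) (C * mu) (i + h) (i + h + r) _ ltac:(lia).
      rewrite addKn => -> => [->//|]; by move=> j /eS/andP[].
    rewrite step'; have := @increment_lower _ (fun i =>
      - e i) (L + H) mu (i + h) (i + h + r) _ ltac:(lia).
    have := @increment_upper _ (fun i =>
      - e i) (L + H) (C * mu) (i + h) (i + h + r) _ ltac:(lia).
    rewrite addKn opprK => -> => [->//|]; by move=> j /eS/andP[]; rewrite opprK addrC.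
  + rewrite /B (gtn_eqF r0) mulr0 add0r -mulrA ler_pM2l// le_eqVlt; apply/orP; left.
    apply/eqP; rewrite [in LHS](_ : r%:R * (C * mu) = C * (r%:R * mu)); last by ring.
    by rewrite -{2}rmu2; field; rewrite gt_eqF.
rewrite lerD2l -{1}[H%:R^-1]ger0_norm ?invr_ge0// -sqrtr_sqr -sqrtrM ?sqr_ge0//.
apply: ler_wsqrtr.
(* Summed over r < H, sqrt(r mu) gives at most sqrt(mu H^3) <= sqrt c2, and 1/sqrt(r mu) at most 2
   sqrt(H/mu) <= 2 H^2 / sqrt c1. These produce the last two summands of [K], with 56 = 14 * 2 *
   2. *)
have sumB : \sum_(r < H) B r <= K * (L%:R + H%:R ^+ 2).
  have s1 : 0 < Num.sqrt mu by rewrite sqrtr_gt0.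
  have s2 := sqr_sqrtr (ltW mu0).
  have t1 : 0 < Num.sqrt H%:R :> R by rewrite sqrtr_gt0.
  have t2 := @sqr_sqrtr R _ (ltW H0').
  have u1 : 0 < Num.sqrt c1 by rewrite sqrtr_gt0.
  have u2 := sqr_sqrtr (ltW c10).
  have c20 : 0 <= c2 by apply: le_trans c2H; rewrite mulr_ge0 ?exprn_ge0// ltW.
  have v2 := sqr_sqrtr c20.
  have v1 := sqrtr_ge0 c2.
  have c1H' : Num.sqrt c1 <= Num.sqrt mu * Num.sqrt H%:R ^+ 3.
    by rewrite -(@ler_pXn2r _ 2)// ?nnegrE ?mulr_ge0 ?exprn_ge0 ?(ltW s1) ?(ltW t1)
      ?(ltW u1)//
      u2 exprMn s2 -exprM mulnC exprM t2.
  have c2H' : Num.sqrt mu * Num.sqrt H%:R ^+ 3 <= Num.sqrt c2.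
    by rewrite -(@ler_pXn2r _ 2)// ?nnegrE ?mulr_ge0 ?exprn_ge0 ?(ltW s1) ?(ltW t1)
      ?v1//
      v2 exprMn s2 -exprM mulnC exprM t2.
  rewrite /B big_split/= -mulr_sumr;
    case: H H0 H0' {B B0 zS eS c1H c2H} t1 t2 c1H' c2H' => // H _ H0' t1 t2 c1H' c2H'.
  rewrite big_ord_recl/= big1 ?addr0 ?mulr1// -mulr_sumr big_split/= -!mulr_sumr.
  set T := Num.sqrt H.+1%:R in t1 t2 c1H' c2H' *.
  set M := Num.sqrt mu in s1 s2 c1H' c2H' *.
  set X1 := \sum_(_ < _) Num.sqrt _; set X2 := \sum_(_ < _) _^-1.
  have X1le : X1 <= T ^+ 3 * M.
    apply: (@le_trans _ _ (\sum_(i < H.+1) (T * M))).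
      apply: ler_sum => i _; rewrite sqrtrM ?ler0n// ler_pM2r// ler_wsqrtr// ler_nat.
      exact: ltnW.
    by rewrite sumr_const card_ord -[leLHS]mulr_natl -t2 exprS; lra.
  have X2le : X2 <= 2 * T / M.
    have -> : X2 = (\sum_(r < H.+1) (Num.sqrt r%:R)^-1) / M.
      by rewrite mulr_suml; apply: eq_bigr => i _; rewrite sqrtrM ?ler0n// invfM.
    rewrite ler_pM2r ?invr_gt0//; apply: le_trans (sum_inv_sqrt _) _.
    by rewrite ler_pM2l// ler_wsqrtr// ler_nat.
  have X2le' : X2 <= 2 * H.+1%:R ^+ 2 / Num.sqrt c1.
    apply: le_trans X2le _; rewrite -mulrA -[leRHS]mulrA ler_pM2l//.
    rewrite ler_pdivrMr// mulrAC ler_pdivlMr// -t2.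
    have : 0 <= T by exact: ltW. nra.
  have L0 : 0 <= L%:R :> R by [].
  have h0 : 0 <= H.+1%:R ^+ 2 :> R by exact: sqr_ge0.
  have a1 : L%:R * C * X1 <= L%:R * C * Num.sqrt c2.
    by apply: ler_wpM2l; [rewrite mulr_ge0|apply: le_trans X1le _; rewrite mulrC].
  have a2 : 0 <= 14 * C * Num.sqrt c2 * H.+1%:R ^+ 2 by rewrite !mulr_ge0.
  have a3 : 0 <= L%:R / Num.sqrt c1 by rewrite mulr_ge0// invr_ge0 ltW.
  rewrite /K; lra.
rewrite [leLHS](_ : _ = 2 * (L%:R / H%:R) * \sum_(r < H) B r); last first.
  by field; rewrite gt_eqF.
rewrite [leRHS](_ : _ = 2 * (L%:R / H%:R) * (K * (L%:R + H%:R ^+ 2))); last first.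
  by field; rewrite gt_eqF.
by apply: ler_wpM2l => //; rewrite mulr_ge0// divr_ge0.
Qed.

End VanDerCorputInequality.

(** * Finite differences of n^alpha and the bounds for the sums over a block *)

Section FiniteDifferences.
Context {R : realType}.
Implicit Types (f df : R -> R) (a x t alpha : R).

(** The step is 1 but the argument is real, so that the mean value theorem applies to [fdiff k f]
    itself. *)
Fixpoint fdiff k f x : R :=
  if k is k'.+1 then fdiff k' f (x + 1) - fdiff k' f x else f x.

Local Notation fpow a := (fun y : R => y `^ a).

Lemma fdiffZ k (c : R) f x : fdiff k (fun y => c * f y) x = c * fdiff k f x.
Proof. by elim: k x => // k IH x; rewrite /= !IH mulrBr. Qed.

Lemma fdiff_derive k f df : (forall x, 0 < x -> is_derive x 1 f (df x)) ->
  forall x, 0 < x -> is_derive x 1 (fdiff k f) (fdiff k df x).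
Proof.
move=> fdf; elim: k => // k IH x x0.
have x1 : 0 < x + 1 by rewrite addr_gt0.
have D1 := IH _ x0; have D2 := IH _ x1.
have Ds : is_derive x 1 (fun y : R => y + 1) 1.
  by apply: is_derive_eq; rewrite addr0.
have := @is_derive1_comp R (fdiff k f) (fun y => y + 1) x _ _ D2 Ds.
rewrite mulr1 => D3; exact: is_deriveB.
Qed.

(** One mean value step per difference: differencing commutes with the derivative, so each step
    trades a difference for a factor of the falling product, lowers the exponent by 1 and moves the
    point by at most 1. *)
Lemma fdiff_powR k a x : 0 < x -> exists xi,
  [/\ x <= xi, xi <= x + k%:R &
      fdiff k (fpow a) x = (\prod_(j < k) (a - j%:R)) * xi `^ (a - k%:R)].
Proof.
elim: k a x => [|k IH] a x x0.
  by exists x; rewrite big_ord0 mul1r subr0 addr0.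
have D (y : R) : 0 < y -> is_derive y 1 (fdiff k (fpow a)) (a * fdiff k (fpow (a -
  1)) y).
  move=> y0; rewrite -fdiffZ.
  by apply: fdiff_derive y0 => z z0; exact: is_derive1_powR.
have pos (y : R) : y \in `[x, x + 1] -> 0 < y.
  by rewrite in_itv/= => /andP[+ _]; exact: lt_le_trans.
have [|||c] := @MVT_segment R (fdiff k (fpow a))
  (fun y => a * fdiff k (fpow (a - 1)) y) x (x + 1).
- by rewrite lerDl.
- by move=> y /subset_itv_oo_cc yx; exact: D (pos _ yx).
- apply: derivable_within_continuous => y /pos y0.
  by have [] := D _ y0.
move=> cx; have c0 := pos _ cx.
have [xi [xi1 xi2 ->]] := IH (a - 1) _ c0.
move: cx; rewrite in_itv/= => /andP[cx1 cx2] E.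
exists xi; split.
- exact: le_trans xi1.
- by apply: le_trans xi2 _; rewrite -[k.+1]add1n natrD addrA lerD2r.
- rewrite E (_ : x + 1 - x = 1); last by ring.
  rewrite mulr1 big_ord_recl subr0 mulrA.
  congr (_ * _ * _ `^ _); last by rewrite -[k.+1]add1n natrD opprD addrA.
  by apply: eq_bigr => j _; rewrite lift0 -[j.+1]add1n natrD opprD addrA.
Qed.

(** The exponent [a - k] is nonpositive, so the power is antitone in the intermediate point, which
    lies in [N, 8N]. The 8 leaves room for a block up to 2N, van der Corput shifts up to 2N and
    three difference steps. *)
Lemma fdiff_powR_bounds k a x (N : R) : a <= k%:R -> 0 < N -> N <= x -> x + k%:R <=
  8 * N ->
  exists r, fdiff k (fpow a) x = (\prod_(j < k) (a - j%:R)) * r /\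
            8 `^ (a - k%:R) * N `^ (a - k%:R) <= r <= N `^ (a - k%:R).
Proof.
move=> ak N0 Nx xN; have x0 : 0 < x by exact: lt_le_trans Nx.
have [xi [xi1 xi2 ->]] := fdiff_powR k a x0.
have xi0 : 0 < xi by exact: lt_le_trans xi1.
exists (xi `^ (a - k%:R)); split => //.
have anti (u v : R) : 0 < u -> u <= v -> v `^ (a - k%:R) <= u `^ (a - k%:R).
  move=> u0 uv; rewrite -opprB !powRN lef_pV2 ?posrE ?powR_gt0//;
    last exact: lt_le_trans uv.
  by apply: ge0_ler_powR; rewrite ?subr_ge0// nnegrE ltW//; exact: lt_le_trans uv.
rewrite -powRM ?(ltW N0)//; apply/andP; split; apply: anti => //;
  first exact: le_trans xi2 xN.
exact: le_trans Nx xi1.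
Qed.

Section Phase.
Context (t alpha x : R) (a : nat).

Let f i := t * (a + i)%:R `^ alpha + (a + i)%:R * x.
Let d i := t * fdiff 1 (fpow alpha) (a + i)%:R + x.

Let natrS i : (a + i.+1)%:R = (a + i)%:R + 1 :> R.
Proof. by rewrite addnS -natr1. Qed.

Lemma phase_step i : expi (f i.+1) = expi (f i) * expi (d i).
Proof. by rewrite -expiD; congr expi; rewrite /f /d natrS /=; ring. Qed.

Lemma phase_step2 i : d i.+1 - d i = t * fdiff 2 (fpow alpha) (a + i)%:R.
Proof. by rewrite /d natrS /=; ring. Qed.

Lemma phase_step3 i : (d i.+2 - d i.+1) - (d i.+1 - d i) =
  t * fdiff 3 (fpow alpha) (a + i)%:R.
Proof. by rewrite !phase_step2 natrS /=; ring. Qed.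

End Phase.

(** [t] and the falling product [c] may have either sign; the two cases feed the two alternatives of
    the derivative tests. *)
Lemma sign_bounds (t c r l u : R) : l <= r <= u -> 0 <= u ->
  (0 < t * c -> `|t * c| * l <= t * (c * r) <= `|t * c| * u) /\
  (t * c < 0 -> `|t * c| * l <= - (t * (c * r)) <= `|t * c| * u).
Proof.
move=> /andP[lr ru] u0; rewrite mulrA; move: (t * c) => m; split => tc.
  by rewrite gtr0_norm// !ler_pM2l// lr.
by rewrite ltr0_norm// -mulNr !ler_pM2l ?oppr_gt0// lr.
Qed.

Lemma index_le (k N a L H i : nat) : (0 < N)%N -> (a + L <= 2 * N)%N -> (H <=
  2 * N)%N ->
  (i < L + H)%N -> (k <= 3)%N -> (a + i + k <= 8 * N)%N.
Proof. lia. Qed.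

Lemma block_size (N a L : nat) : (N <= a)%N -> (a + L <= 2 * N)%N -> (L <= N)%N.
Proof. lia. Qed.

(** With second differences of size lam = N^(alpha-2), a block meets about N lam + 1 periods at a
    cost of lam^(-1/2) each; N lam^(1/2) and lam^(-1/2) are the two powers in the bound. *)
Lemma expsum_second_derivative t alpha : 0 < alpha < 2 -> alpha != 1 -> t != 0 ->
  exists2 K, 0 <= K & forall (N a L : nat) x,
    (0 < N)%N -> (N <= a)%N -> (a + L <= 2 * N)%N ->
    normc (\sum_(i < L) expi (t * (a + i)%:R `^ alpha + (a + i)%:R * x)) <=
    K * (N%:R `^ (alpha / 2) + N%:R `^ (1 - alpha / 2)).
Proof.
move=> /andP[a0 a2] a1 t0.
pose c : R := \prod_(j < 2) (alpha - j%:R).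
have c0 : c != 0.
  rewrite /c big_ord_recl big_ord1 subr0 mulf_neq0 ?(gt_eqF a0)// lift0 subr_eq0//.
pose T := `|t * c|; have T0 : 0 < T by rewrite normr_gt0 mulf_neq0.
pose l0 := T * 8 `^ (alpha - 2).
have l00 : 0 < l0 by rewrite mulr_gt0// powR_gt0.
exists (14 / Num.sqrt l0 * (T + 2)).
  by rewrite mulr_ge0// ?divr_ge0 ?sqrtr_ge0// addr_ge0// ltW.
move=> N a L x N0 Na aL; have N0' : 0 < N%:R :> R by rewrite ltr0n.
pose Q : R := N%:R `^ (alpha / 2 - 1).
have Q0 : 0 < Q by rewrite powR_gt0.
have Q2 : N%:R `^ (alpha - 2) = Q ^+ 2.
  by rewrite -powR_mulrn ?ltW// -powRrM; congr (_ `^ _); field.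
have lam0 : 0 < l0 * Q ^+ 2 by rewrite mulr_gt0// exprn_gt0.
apply: le_trans (@second_derivative_test _
   (fun i => expi (t * (a + i)%:R `^ alpha + (a + i)%:R * x))
   (fun i => t * fdiff 1 (fpow alpha) (a + i)%:R + x) L (l0 * Q ^+ 2) (T * Q ^+ 2)
   lam0 _ _ _) _.
- by move=> i; exact: normc_expi.
- by move=> i _; exact: phase_step.
- have H i : (i < L)%N -> exists r, fdiff 2 (fpow alpha) (a + i)%:R = c * r /\
     8 `^ (alpha - 2) * Q ^+ 2 <= r <= Q ^+ 2.
    move=> iL; rewrite -Q2; apply: fdiff_powR_bounds => //; first exact: ltW.
      by rewrite ler_nat (leq_trans Na)// leq_addr.
    by rewrite -natrD -natrM ler_nat (index_le (k := 2) (H := 0) N0 aL _ _)// ?addn0.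
  have Q20 : 0 <= Q ^+ 2 by exact: sqr_ge0.
  have [tc|tc|/eqP] := ltgtP (t * c) 0;
    last by rewrite mulf_eq0 (negbTE t0) (negbTE c0).
    right => i /H[r [E /(@sign_bounds t c)/(_ Q20)[_ /(_ tc)]]].
    by rewrite -E -(phase_step2 t alpha x) opprB -/T mulrA.
  left => i /H[r [E /(@sign_bounds t c)/(_ Q20)[/(_ tc)]]].
  by rewrite -E -(phase_step2 t alpha x) -/T mulrA.
rewrite sqrtrM ?(ltW l00)// sqrtr_sqr (gtr0_norm Q0).
have NQ : N%:R * Q = N%:R `^ (alpha / 2).
  rewrite -{1}[N%:R](@powRr1 _) ?ltW// -powRD; last by rewrite (gt_eqF N0') implybT.
  by congr (_ `^ _); ring.
have QV : Q^-1 = N%:R `^ (1 - alpha / 2).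
  by rewrite -powRN; congr (_ `^ _); ring.
have sl : 0 < Num.sqrt l0 by rewrite sqrtr_gt0.
rewrite -NQ -QV; apply: (@le_trans _ _ (14 / Num.sqrt l0 * (T * (N%:R * Q) +
  2 * Q^-1))).
  rewrite [leLHS](_ : _ = 14 / Num.sqrt l0 * (T * (L%:R * Q) + 2 * Q^-1)).
    by rewrite ler_pM2l ?divr_gt0// lerD2r ler_pM2l// ler_pM2r//
      ler_nat (block_size Na aL).
  by field; rewrite !gt_eqF.
rewrite -[leRHS]mulrA ler_pM2l ?divr_gt0//.
have A : 0 <= N%:R * Q by rewrite mulr_ge0// ltW.
have B : 0 <= Q^-1 by rewrite invr_ge0 ltW.
nra.
Qed.

(** With third differences of size mu = N^(alpha-3), shifts of length H = N^(1-alpha/3) keep mu H^3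
    bounded above and below. The terms under the root become N^(1+alpha/3) and N^(2-alpha/3), of
    which the first dominates from alpha = 3/2 on. *)
Lemma expsum_third_derivative t alpha : 3 / 2 < alpha < 2 -> t != 0 ->
  exists2 K, 0 <= K & forall (N a L : nat) x,
    (0 < N)%N -> (N <= a)%N -> (a + L <= 2 * N)%N ->
    normc (\sum_(i < L) expi (t * (a + i)%:R `^ alpha + (a + i)%:R * x)) <=
    K * N%:R `^ (1 / 2 + alpha / 6).
Proof.
move=> /andP[a0 a2] t0.
pose c : R := \prod_(j < 3) (alpha - j%:R).
have c0 : c != 0.
  rewrite /c !big_ord_recl big_ord0 mulr1 !lift0 /= subr0 !mulf_neq0//; apply/eqP; lra.
pose T := `|t * c|; have T0 : 0 < T by rewrite normr_gt0 mulf_neq0.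
pose C : R := 8 `^ (3 - alpha).
have C1 : 1 <= C by rewrite -[leLHS](@powRr0 R 8); apply: ler_powR; [rewrite ler1n|lra].
pose m0 := T * 8 `^ (alpha - 3).
have m00 : 0 < m0 by rewrite mulr_gt0// powR_gt0.
have Cm : C * m0 = T.
  rewrite /C /m0 mulrCA -powRD; last by rewrite (gt_eqF (ltr0n _ 8)) implybT.
  by rewrite (_ : 3 - alpha + (alpha - 3) = 0) ?powRr0 ?mulr1//; ring.
pose K := 1 + 14 * C * Num.sqrt (8 * m0) + 56 / Num.sqrt m0.
have K0 : 0 <= K.
  by rewrite !addr_ge0// !mulr_ge0 ?invr_ge0 ?sqrtr_ge0//; exact: le_trans C1.
exists (4 + Num.sqrt (6 * K)); first by rewrite addr_ge0// sqrtr_ge0.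
move=> N a L x N0 Na aL; have N0' : 0 < N%:R :> R by rewrite ltr0n.
have N1 : 1 <= N%:R :> R by rewrite ler1n.
pose P : R := N%:R `^ (1 - alpha / 3).
have mono (u v : R) : u <= v -> N%:R `^ u <= N%:R `^ v by exact: ler_powR.
have Nadd (u v : R) : N%:R `^ u * N%:R `^ v = N%:R `^ (u + v).
  by rewrite -powRD// (gt_eqF N0') implybT.
have P0 : 0 < P by rewrite powR_gt0.
have P1 : 1 <= P by rewrite -[leLHS](@powRr0 _ N%:R) /P; apply: mono; lra.
have PN : P <= N%:R by rewrite -[leRHS](@powRr1 _ N%:R) ?(ltW N0')// /P; apply: mono;
  lra.
(* Rounding up keeps P <= H <= 2P, which is why [m0] and [8 * m0] serve as [c1] and [c2]. *)
pose H := (Num.truncn P).+1.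
have H1 : P <= H%:R by exact/ltW/truncnS_gt.
have H2 : H%:R <= 2 * P.
  rewrite /H -natr1; have : (Num.truncn P)%:R <= P by rewrite truncn_le ltW.
  lra.
have H0 : 0 < H%:R :> R by rewrite ltr0n.
pose q : R := N%:R `^ (alpha - 3).
have q0 : 0 < q by rewrite powR_gt0.
have qP : q * P ^+ 3 = 1.
  rewrite -powR_mulrn ?(ltW P0)// -powRrM Nadd.
  by rewrite (_ : _ + _ = 0) ?powRr0//; field.
have HN : (H <= 2 * N)%N by rewrite -(ler_nat R) natrM; lra.
have main : normc (\sum_(i < L) expi (t * (a + i)%:R `^ alpha + (a + i)%:R * x)) <=
    2 * H%:R + Num.sqrt (2 * K * (L%:R ^+ 2 / H%:R + L%:R * H%:R)).
  pose z i : R[i] := expi (t * (a + i)%:R `^ alpha + (a + i)%:R * x).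
  have T3 := @third_derivative_test _ z
     (fun i => t * fdiff 1 (fpow alpha) (a + i)%:R + x) L H (m0 * q) C m0 (8 * m0)
     isT _ C1 m00.
  apply: T3.
  - by rewrite mulr_gt0.
  - have HP : P ^+ 3 <= H%:R ^+ 3 <= 8 * P ^+ 3.
      rewrite lerXn2r ?nnegrE ?(ltW P0) ?(ltW H0)//=.
      have -> : 8 * P ^+ 3 = (2 * P) ^+ 3 by ring.
      by rewrite lerXn2r ?nnegrE ?mulr_ge0 ?(ltW P0) ?(ltW H0).
    case/andP: HP => HP1 HP2.
    have A1 : q * P ^+ 3 <= q * H%:R ^+ 3 by rewrite ler_pM2l.
    have A2 : q * H%:R ^+ 3 <= q * (8 * P ^+ 3) by rewrite ler_pM2l.
    rewrite qP in A1; rewrite [leRHS]mulrCA qP mulr1 in A2.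
    rewrite -mulrA; apply/andP; split; last by rewrite [8 * _]mulrC ler_pM2l.
    by rewrite -[leLHS]mulr1 ler_pM2l.
  - by move=> i; exact: normc_expi.
  - by move=> i _; exact: phase_step.
  - have F i : (i < L + H)%N -> exists r, fdiff 3 (fpow alpha) (a + i)%:R = c * r /\
       8 `^ (alpha - 3) * q <= r <= q.
      move=> iL; apply: fdiff_powR_bounds => //; first lra.
        by rewrite ler_nat (leq_trans Na)// leq_addr.
      by rewrite -natrD -natrM ler_nat (index_le (k := 3) N0 aL HN iL).
    rewrite mulrA Cm.
    have [tc|tc|/eqP] := ltgtP (t * c) 0;
      last by rewrite mulf_eq0 (negbTE t0) (negbTE c0).
      right => i /F[r [E /(@sign_bounds t c)/(_ (ltW q0))[_ /(_ tc)]]].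
      by rewrite -E -(phase_step3 t alpha x) opprB -/T mulrA.
    left => i /F[r [E /(@sign_bounds t c)/(_ (ltW q0))[/(_ tc)]]].
    by rewrite -E -(phase_step3 t alpha x) -/T mulrA.
apply: le_trans main _.
rewrite [leRHS]mulrDl; apply: lerD.
  apply: (@le_trans _ _ (4 * P)); first lra.
  by rewrite ler_pM2l//; apply: mono; lra.
pose Z : R := N%:R `^ (1 / 2 + alpha / 6).
have Z0 : 0 < Z by rewrite powR_gt0.
have Z2 : Z ^+ 2 = N%:R `^ (1 + alpha / 3).
  by rewrite -powR_mulrn ?ltW// -powRrM; congr (_ `^ _); field.
rewrite -/Z -[Z](gtr0_norm Z0) -sqrtr_sqr -sqrtrM; last by rewrite mulr_ge0.
apply: ler_wsqrtr; rewrite [leRHS](_ : _ = 2 * K * (3 * Z ^+ 2)); last by ring.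
apply: ler_wpM2l; first by rewrite mulr_ge0.
have LN : L%:R <= N%:R :> R by rewrite ler_nat (block_size Na aL).
have NP : N%:R ^+ 2 / P = Z ^+ 2.
  rewrite Z2 -powR_mulrn ?ltW// -powRN Nadd; congr (_ `^ _); ring.
have NP2 : N%:R * P <= Z ^+ 2.
  have -> : N%:R * P = N%:R `^ (1 + (1 - alpha / 3)) by rewrite -Nadd powRr1// ltW.
  by rewrite Z2; apply: mono; lra.
have L1 : L%:R ^+ 2 / H%:R <= Z ^+ 2.
  rewrite -NP; apply: ler_pM; rewrite ?sqr_ge0 ?invr_ge0 ?(ltW H0)//.
    by rewrite lerXn2r ?nnegrE.
  by rewrite lef_pV2 ?posrE.
have L2 : L%:R * H%:R <= 2 * Z ^+ 2.
  apply: (@le_trans _ _ (N%:R * (2 * P))); first by apply: ler_pM => //; exact: ltW.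
  by rewrite mulrCA ler_pM2l.
lra.
Qed.

Lemma frac_beta_lt1 alpha : 0 < alpha < 2 -> alpha != 1 -> 0 < frac_beta alpha < 1.
Proof.
move=> /andP[a0 a2] a1; rewrite /frac_beta.
by case: ifPn => [?|]; [|case: ifPn => ? ?]; apply/andP; split; lra.
Qed.

(** Up to 3/2 the larger of alpha/2 and 1 - alpha/2 is 1 - beta: the second for alpha < 1, the first
    for alpha > 1. Beyond 3/2 it is the exponent of the third derivative test that equals 1 -
    beta. *)
Lemma expsum_bound t alpha : 0 < alpha < 2 -> alpha != 1 -> t != 0 ->
  exists2 K, 0 <= K & forall (N a L : nat) x,
    (0 < N)%N -> (N <= a)%N -> (a + L <= 2 * N)%N ->
    normc (\sum_(i < L) expi (t * (a + i)%:R `^ alpha + (a + i)%:R * x)) <=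
    K * N%:R `^ (1 - frac_beta alpha).
Proof.
move=> a02 a1 t0.
have [a32|a32] := leP alpha (3 / 2); last first.
  have [|K K0 HK] := @expsum_third_derivative t alpha _ t0.
    by rewrite a32; case/andP: a02.
  exists K => // N a L x N0 Na aL; apply: le_trans (HK N a L x N0 Na aL) _.
  rewrite (_ : 1 - _ = 1 / 2 + alpha / 6)// /frac_beta !ifF; first by field.
    by apply/negbTE; rewrite -ltNge.
  apply/negbTE; rewrite -leNgt; lra.
have [K K0 HK] := expsum_second_derivative a02 a1 t0.
exists (2 * K); first by rewrite mulr_ge0.
move=> N a L x N0 Na aL; apply: le_trans (HK N a L x N0 Na aL) _.
rewrite [2 * K]mulrC -mulrA; apply: ler_wpM2l => //.
have N1 : 1 <= N%:R :> R by rewrite ler1n.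
rewrite mulr_natl [leRHS]mulr2n /frac_beta a32; case: ifPn => a11.
  by rewrite lerD2r; apply: ler_powR => //; lra.
have -> : 1 - (1 - alpha / 2) = alpha / 2 by ring.
rewrite lerD2l; apply: ler_powR => //; move: a11; rewrite -leNgt; lra.
Qed.

End FiniteDifferences.

(** * Fourier coefficients of functions of bounded variation *)

Section BoundedVariationIntegral.
Context {R : realType}.
Implicit Types (f h v F dF : R -> R) (a b : R).
Notation mu := (@lebesgue_measure R).

(** A real-valued stand-in for the running total variation: [v b - v a] plays the part of the mass
    of |df|, without extended reals. *)
Definition var_majorant a b f v :=
  forall x y, a <= x -> x <= y -> y <= b -> `|f y - f x| <= v y - v x.

Lemma bounded_variation_majorant a b f : a <= b -> bounded_variation a b f ->
  exists v, var_majorant a b f v.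
Proof.
move=> ab bv; exists (fun x => fine (total_variation a x f)) => x y ax xy yb.
have bx : bounded_variation a x f by apply: bounded_variationl bv => //;
  exact: le_trans yb.
have by_ : bounded_variation a y f by apply: bounded_variationl bv => //;
  exact: le_trans xy.
have bxy : bounded_variation x y f by apply: bounded_variationr by_.
move/(bounded_variationP _ ax): bx => bx; move/(bounded_variationP _ xy): bxy => bxy.
rewrite (total_variationD f ax xy) fineD// [X in _ <= X -
  _]addrC addrK -lee_fin fineK//.
exact: total_variation_ge.
Qed.

Lemma majorant_nd a b f v x y : var_majorant a b f v -> a <= x -> x <= y -> y <= b ->
  v x <= v y.
Proof. by move=> fv ax xy yb; rewrite -subr_ge0; apply: le_trans (fv _ _ ax xy yb). Qed.

(** f = v - (v - f) is a difference of two nondecreasing functions. The clamp [c] extends both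
    monotonically to the whole line. *)
Lemma majorant_measurable a b f v : a <= b -> var_majorant a b f v ->
  measurable_fun `[a, b] f.
Proof.
move=> ab fv; pose c x := Num.max a (Num.min x b).
have c1 x : a <= c x by rewrite /c le_max lexx.
have c2 x : c x <= b by rewrite /c ge_max ab ge_min lexx orbT.
have cc x y : x <= y -> c x <= c y.
  move=> xy; rewrite /c ge_max le_max lexx/= le_max; apply/orP; right.
  by rewrite le_min !ge_min lexx orbT xy.
have cE x : x \in `[a, b] -> c x = x.
  by rewrite in_itv/= => /andP[ax xb]; rewrite /c min_l// max_r.
have m1 : measurable_fun `[a, b] (v \o c).
  apply: nondecreasing_measurable => // x y xy /=.
  by apply: majorant_nd fv _ _ _ => //; exact: cc.
have m2 : measurable_fun `[a, b] (fun x => v (c x) - f (c x)).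
  apply: nondecreasing_measurable => // x y xy /=.
  have := fv _ _ (c1 x) (cc _ _ xy) (c2 y).
  by rewrite ler_norml => /andP[_]; lra.
apply: (eq_measurable_fun (fun x => v (c x) - (v (c x) - f (c x)))).
  by move=> x; rewrite inE/= => /cE ->; rewrite subKr.
exact: measurable_funB.
Qed.

Lemma majorant_bounded a b f v x : var_majorant a b f v -> a <= x -> x <= b ->
  `|f x| <= `|f a| + (v b - v a).
Proof.
move=> fv ax xb; rewrite -[f x](subrK (f a)); apply: le_trans (ler_normD _ _) _.
rewrite addrC lerD2l; apply: le_trans (fv _ _ (lexx _) ax xb) _.
by rewrite lerD2r; apply: majorant_nd fv _ _ _.
Qed.

Lemma bounded_integrable a b f B : measurable_fun `[a, b] f ->
  (forall x, a <= x -> x <= b -> `|f x| <= B) -> mu.-integrable `[a, b] (EFin \o f).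
Proof.
move=> mf fB; apply: measurable_bounded_integrable => //.
- by rewrite /= lebesgue_measure_itv/=; case: ifP => // _; rewrite -EFinB ltry.
- exists B; split; first exact: num_real.
  move=> M BM x /=; rewrite in_itv/= => /andP[ax xb].
  by apply: le_trans (ltW BM); exact: fB.
Qed.

Lemma bv_continuous_integrable a b f v phi S : a <= b -> var_majorant a b f v ->
  continuous phi -> (forall x, `|phi x| <= S) ->
  mu.-integrable `[a, b] (EFin \o (fun x => f x * phi x)).
Proof.
move=> ab fv cphi phiS; apply: (@bounded_integrable _ _ _ ((`|f a| + (v b - v a)) * S)).
  apply: measurable_funM; first exact: majorant_measurable fv.
  by apply: measurable_funTS; exact: continuous_measurable_fun.
move=> x ax xb; rewrite normrM; apply: ler_pM => //.
exact: majorant_bounded fv ax xb.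
Qed.

Lemma FTC_is_derive a b F dF : a <= b -> (forall x : R, is_derive x 1 F (dF x)) ->
  continuous dF -> \int[mu]_(x in `[a, b]) dF x = F b - F a.
Proof.
rewrite le_eqVlt => /predU1P[-> _ _|ab Fd cdF].
  by rewrite set_itv1 Rintegral_set1 subrr.
have cF : continuous F.
  by move=> x; apply/differentiable_continuous/derivable1_diffP; have [] := Fd x.
rewrite /Rintegral (@continuous_FTC2 _ dF F)//.
- exact: continuous_subspaceT.
- split; first by move=> x _; have [] := Fd x.
    exact/cvg_at_right_filter/cF.
  exact/cvg_at_left_filter/cF.
- by move=> x _; rewrite derive1E; exact: derive_val.
Qed.

(** Once [f] is frozen at the left end the integral is exact by the fundamental theorem; the error
    is the oscillation of [f] times [S] times the length. *)
Lemma integral_piece a b f v F dF S : a <= b -> var_majorant a b f v ->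
  (forall x : R, is_derive x 1 F (dF x)) -> continuous dF -> (forall x, `|dF x| <= S) ->
  `|\int[mu]_(x in `[a, b]) (f x * dF x) - f a * (F b - F a)| <=
  S * (v b - v a) * (b - a).
Proof.
move=> ab fv Fd cdF dFS.
have i1 : mu.-integrable `[a, b] (EFin \o (fun x => f x * dF x)).
  exact: bv_continuous_integrable fv cdF dFS.
have ca : var_majorant a b (cst (f a)) (cst 0).
  by move=> x y _ _ _; rewrite !subrr normr0.
have i2 : mu.-integrable `[a, b] (EFin \o (fun x => f a * dF x)).
  exact: bv_continuous_integrable ca cdF dFS.
have i3 : mu.-integrable `[a, b] (EFin \o dF).
  apply: (@bounded_integrable _ _ _ S) => //.
  by apply: measurable_funTS; exact: continuous_measurable_fun.
rewrite -(FTC_is_derive ab Fd cdF) -RintegralZl// -RintegralB//.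
have i4 : mu.-integrable `[a, b] (EFin \o (fun x => f x * dF x - f a * dF x)).
  by have := integrableB _ i1 i2; apply.
apply: le_trans (le_normr_Rintegral _ i4) _ => //.
have cS : (mu `[a, b] = (b - a)%:E)%E.
  by rewrite /= lebesgue_measure_itv/= lte_fin; case: ltP => // ba;
    rewrite (_ : b = a) ?subrr//; apply/eqP; rewrite eq_le ab ba.
have -> : S * (v b - v a) * (b - a) = \int[mu]_(x in `[a, b]) (S * (v b - v a)).
  by rewrite Rintegral_cst//=; move: cS => /= ->.
apply: le_Rintegral => //.
- exact: integrable_norm.
- apply: (@bounded_integrable _ _ _ `|S * (v b - v a)|) => //.
move=> x; rewrite /= in_itv/= => /andP[ax xb].
rewrite -mulrBl normrM mulrC; apply: ler_pM => //.
apply: le_trans (fv _ _ (lexx _) ax xb) _; rewrite lerD2r.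
exact: majorant_nd fv ax xb _.
Qed.

Lemma Rintegral_itv_cat a b c f : a <= b -> b <= c ->
  mu.-integrable `[a, c] (EFin \o f) ->
  \int[mu]_(x in `[a, c]) f x =
  \int[mu]_(x in `[a, b]) f x + \int[mu]_(x in `[b, c]) f x.
Proof.
move=> ab bc i1.
have := @Rintegral_itvB _ f (BLeft a) (BRight c) b i1;
  rewrite !bnd_simp => /(_ ab bc) E.
rewrite -(Rintegral_itv_obnd_cbnd (r := b) (b := BRight c));
  first by rewrite -E addrC subrK.
by apply: integrableS i1 => //; apply: subset_itvr; rewrite bnd_simp.
Qed.

(* Riemann sums and Abel summation stand in for integration by parts. *)
Lemma bv_integral_bound (T : R) f v F dF S M : 0 < T -> var_majorant 0 T f v ->
  f 0 = f T -> F 0 = F T ->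
  (forall x : R, is_derive x 1 F (dF x)) -> continuous dF -> (forall x, `|dF x| <= S) ->
  (forall x, `|F x| <= M) ->
  `|\int[mu]_(x in `[0, T]) (f x * dF x)| <= M * (v T - v 0).
Proof.
move=> T0 fv fT FT Fd cdF dFS FM.
have V0 : 0 <= v T - v 0 by rewrite subr_ge0; apply: majorant_nd fv _ _ _ => //;
  exact: ltW.
have S0 : 0 <= S by apply: le_trans (dFS 0).
set I := \int[mu]_(x in _) _.
(* Over n + 1 equal pieces the errors of [integral_piece] add up to S times the total variation
   times the mesh T/(n+1), which tends to 0. *)
suff H n : `|I| <= M * (v T - v 0) + S * (v T - v 0) * T / n.+1%:R.
  apply/ler_addgt0Pr => e e0.
  have [n nB] : exists n : nat, S * (v T - v 0) * T / e < n%:R.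
    by exists (Num.truncn (S * (v T - v 0) * T / e)).+1; exact: truncnS_gt.
  apply: le_trans (H n) _; rewrite lerD2l ler_pdivrMr// [leRHS]mulrC -ler_pdivrMr//.
  by apply: le_trans (ltW nB) _; rewrite ler_nat.
pose d := T / n.+1%:R; have d0 : 0 < d by rewrite divr_gt0.
pose x k := k%:R * d.
have xS k : x k.+1 = x k + d by rewrite /x -natr1; ring.
have x0 k : 0 <= x k by rewrite mulr_ge0// ltW.
have xk k : x k <= x k.+1 by rewrite xS lerDl ltW.
have xn : x n.+1 = T by rewrite /x /d mulrC divfK.
have xT k : (k <= n.+1)%N -> x k <= T.
  by move=> kn; rewrite -xn ler_pM2r// ler_nat.
have step k : (k <= n.+1)%N ->
  `|\int[mu]_(y in `[0, x k]) (f y * dF y) - \sum_(j < k) f (x j) * (F (x j.+1) -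
    F (x j))|
   <= S * (v (x k) - v 0) * d.
  elim: k => [|k IH] kn.
    by rewrite big_ord0 subr0 /x mul0r set_itv1 Rintegral_set1 normr0 subrr mulr0 mul0r.
  rewrite big_ord_recr/= (Rintegral_itv_cat (x0 k) (xk k)); last first.
    apply: (@bv_continuous_integrable _ _ _ v _ S) => //.
    by move=> p q p0 pq qx; apply: fv => //; exact: le_trans (xT _ kn).
  rewrite opprD addrACA; apply: le_trans (ler_normD _ _) _.
  apply: (@le_trans _ _ (S * (v (x k) - v 0) * d + S * (v (x k.+1) -
    v (x k)) * (x k.+1 - x k))).
    apply: lerD; first exact: IH (ltnW kn).
    apply: integral_piece => // p q xp pq qx; apply: fv => //.
      exact: le_trans xp.
    exact: le_trans (xT _ kn).
  by rewrite [x k.+1 - _](_ : _ = d) ?xS; lra.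
(* Summation by parts moves the differences onto [f]; at the last node the boundary terms cancel
   because [f] and [F] each take equal values at 0 and [T]. *)
have abel k : \sum_(j < k) f (x j) * (F (x j.+1) - F (x j)) =
   f (x k) * F (x k) - f 0 * F 0 - \sum_(j < k) F (x j.+1) * (f (x j.+1) - f (x j)).
  elim: k => [|k IH]; first by rewrite !big_ord0 /x mul0r subrr subr0.
  by rewrite !big_ord_recr/= IH; ring.
have telv k : (k <= n.+1)%N ->
  `|\sum_(j < k) F (x j.+1) * (f (x j.+1) - f (x j))| <= M * (v (x k) - v 0).
  elim: k => [|k IH] kn; first by rewrite big_ord0 normr0 /x mul0r subrr mulr0.
  rewrite big_ord_recr/=; apply: le_trans (ler_normD _ _) _.
  apply: (@le_trans _ _ (M * (v (x k) - v 0) + M * (v (x k.+1) - v (x k))));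
    last by lra.
  apply: lerD; first exact: IH (ltnW kn).
  by rewrite normrM; apply: ler_pM => //; apply: fv => //; exact: xT.
have := step n.+1 (leqnn _); have := telv n.+1 (leqnn _).
rewrite abel xn -fT -FT subrr sub0r opprK -/I => H1 H2.
rewrite -[I](addrK (\sum_(j < n.+1) F (x j.+1) * (f (x j.+1) - f (x j)))).
apply: le_trans (ler_normB _ _) _; rewrite addrC; apply: lerD => //.
by apply: le_trans H2 _; rewrite /d mulrA.
Qed.

End BoundedVariationIntegral.

(** * Fourier coefficients paired with trigonometric polynomials *)

Section FourierCoefficients.
Context {R : realType}.
Implicit Types (g F G : R -> R[i]) (c : R[i]).
Notation mu := (@lebesgue_measure R).
Notation T := (pi *+ 2 : R).

Lemma twopi_gt0 : 0 < T. Proof. by rewrite mulrn_wgt0// pi_gt0. Qed.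

Definition torus_integrable F :=
  mu.-integrable `[0, T] (EFin \o (fun x => complex.Re (F x))) /\
  mu.-integrable `[0, T] (EFin \o (fun x => complex.Im (F x))).

Lemma integrable_lin (f h : R -> R) (a b : R) :
  mu.-integrable `[0, T] (EFin \o f) -> mu.-integrable `[0, T] (EFin \o h) ->
  mu.-integrable `[0, T] (EFin \o (fun x => a * f x + b * h x)) /\
  \int[mu]_(x in `[0, T]) (a * f x + b * h x) =
  a * \int[mu]_(x in `[0, T]) f x + b * \int[mu]_(x in `[0, T]) h x.
Proof.
move=> fi hi.
have fi' : mu.-integrable `[0, T] (EFin \o (fun x => a * f x)).
  by have := integrableZl _ a fi; apply.
have hi' : mu.-integrable `[0, T] (EFin \o (fun x => b * h x)).
  by have := integrableZl _ b hi; apply.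
split; first by have := integrableD _ fi' hi'; apply.
by rewrite RintegralD// !RintegralZl.
Qed.

Lemma torus_meanDZ F G c : torus_integrable F -> torus_integrable G ->
  torus_integrable (fun x => F x + c * G x) /\
  torus_mean (fun x => F x + c * G x) = torus_mean F + c * torus_mean G.
Proof.
case: c => c d [Fr Fi] [Gr Gi].
have [Hr Er] := integrable_lin c (- d) Gr Gi.
have [Hi Ei] := integrable_lin d c Gr Gi.
have [Kr Er'] := integrable_lin 1 1 Fr Hr.
have [Ki Ei'] := integrable_lin 1 1 Fi Hi.
have RE x : complex.Re (F x + (c +i* d) * G x) = 1 * complex.Re (F x) +
    1 * (c * complex.Re (G x) + - d * complex.Im (G x)).
  by case: (F x) (G x) => [? ?] [? ?] /=; ring.
have IE x : complex.Im (F x + (c +i* d) * G x) = 1 * complex.Im (F x) +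
    1 * (d * complex.Re (G x) + c * complex.Im (G x)).
  by case: (F x) (G x) => [? ?] [? ?] /=; ring.
split; first by split; [rewrite (eq_fun RE)|rewrite (eq_fun IE)].
rewrite /torus_mean (eq_fun RE) (eq_fun IE).
rewrite Er' Er Ei' Ei.
by apply/eqP; rewrite eq_complex /=; apply/andP; split; apply/eqP; ring.
Qed.

Lemma torus_mean0 : torus_integrable (fun=> 0) /\ torus_mean (fun=> 0 : R[i]) = 0.
Proof.
have H : mu.-integrable `[0, T] (EFin \o (fun=> 0 : R)).
  by apply: (@bounded_integrable _ _ _ _ 0) => // x _ _; rewrite normr0.
split; first by split.
by rewrite /torus_mean /= Rintegral_cst// !mul0r.
Qed.

Lemma torus_mean_sum L (w : nat -> R[i]) (G : nat -> R -> R[i]) :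
  (forall i, torus_integrable (G i)) ->
  torus_integrable (fun x => \sum_(i < L) w i * G i x) /\
  torus_mean (fun x => \sum_(i < L) w i * G i x) = \sum_(i < L) w i * torus_mean (G i).
Proof.
move=> Gi; elim: L => [|L [IH1 IH2]].
  rewrite big_ord0 (_ : (fun x => _) = fun=> 0); first exact: torus_mean0.
  by apply/funext => x; rewrite big_ord0.
have [H1 H2] := torus_meanDZ (w L) IH1 (Gi L).
rewrite (_ : (fun x => _) = (fun x => \sum_(i < L) w i * G i x + w L * G L x));
  last first.
  by apply/funext => x; rewrite big_ord_recr.
by rewrite big_ord_recr/= H2 IH2.
Qed.

Lemma BV_torus_majorant g : BV_torus g -> exists v w,
  var_majorant 0 T (fun x => complex.Re (g x)) v /\
  var_majorant 0 T (fun x => complex.Im (g x)) w.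
Proof.
have T0 := ltW twopi_gt0.
move=> [_ /(bounded_variation_majorant T0)[v Hv] /(bounded_variation_majorant T0)[w
  Hw]].
by exists v, w.
Qed.

Lemma continuous_cosN (m : R) : continuous (fun x : R => cos (- (m * x))).
Proof.
move=> x; apply: (@continuous_comp _ _ _ (fun x => - (m * x)) (@cos R));
  last exact: continuous_cos.
by apply: cvgN; apply: cvgM; [exact: cvg_cst|exact: cvg_id].
Qed.

Lemma continuous_sinN (m : R) : continuous (fun x : R => sin (- (m * x))).
Proof.
move=> x; apply: (@continuous_comp _ _ _ (fun x => - (m * x)) (@sin R));
  last exact: continuous_sin.
by apply: cvgN; apply: cvgM; [exact: cvg_cst|exact: cvg_id].
Qed.

Lemma normr_cos_le1 (x : R) : `|cos x| <= 1.
Proof. by rewrite ler_norml cos_geN1 cos_le1. Qed.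

Lemma normr_sin_le1 (x : R) : `|sin x| <= 1.
Proof. by rewrite ler_norml sin_geN1 sin_le1. Qed.

Lemma BV_expi_integrable g (m : int) : BV_torus g ->
  torus_integrable (fun x => g x * expi (- (m%:~R * x))).
Proof.
move=> /BV_torus_majorant[v [w [Hv Hw]]]; have T0 := ltW twopi_gt0.
have I1 := bv_continuous_integrable T0 Hv (@continuous_cosN m%:~R) (fun x =>
  normr_cos_le1 _).
have I2 := bv_continuous_integrable T0 Hv (@continuous_sinN m%:~R) (fun x =>
  normr_sin_le1 _).
have I3 := bv_continuous_integrable T0 Hw (@continuous_cosN m%:~R) (fun x =>
  normr_cos_le1 _).
have I4 := bv_continuous_integrable T0 Hw (@continuous_sinN m%:~R) (fun x =>
  normr_sin_le1 _).
split.
  have [H _] := integrable_lin 1 (-1) I1 I4.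
  apply: eq_integrable H => // x _ /=; congr EFin.
  by case: (g x) => p q /=; ring.
have [H _] := integrable_lin 1 1 I2 I3.
apply: eq_integrable H => // x _ /=; congr EFin.
by case: (g x) => p q /=; ring.
Qed.

Lemma is_derive_sum (L : nat) (f df : nat -> R -> R) :
  (forall i (x : R), is_derive x 1 (f i) (df i x)) ->
  forall x : R, is_derive x 1 (fun y => \sum_(i < L) f i y) (\sum_(i < L) df i x).
Proof.
move=> fd; elim: L => [|L IH] x.
  rewrite big_ord0 (_ : (fun y => _) = cst 0); first exact: is_derive_cst.
  by apply/funext => y; rewrite big_ord0.
rewrite big_ord_recr/= (_ : (fun y => _) = (fun y => \sum_(i < L) f i y + f L y)).
  by have := IH x; have := fd L x => ? ?; exact: is_deriveD.
by apply/funext => y; rewrite big_ord_recr.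
Qed.

Lemma continuous_sum (L : nat) (f : nat -> R -> R) :
  (forall i, continuous (f i)) -> continuous (fun y => \sum_(i < L) f i y).
Proof.
move=> fc; elim: L => [|L IH].
  rewrite (_ : (fun y => _) = cst 0); first by move=> x; exact: cvg_cst.
  by apply/funext => y; rewrite big_ord0.
rewrite (_ : (fun y => _) = (fun y => \sum_(i < L) f i y + f L y)).
  by move=> x; apply: cvgD; [exact: IH|exact: fc].
by apply/funext => y; rewrite big_ord_recr.
Qed.

(* The numbers 2 pi i n * fourier_coef g n are the coefficients of the measure
   dg, so the sum is the integral of a trigonometric polynomial against dg. *)
Lemma fourier_bv_bound g : BV_torus g -> exists2 V, 0 <= V &
  forall (L : nat) (w : nat -> R[i]) (m : nat -> int) M,
  (forall y : R, normc (\sum_(i < L) w i * expi (- ((m i)%:~R * y))) <= M) ->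
  normc (\sum_(i < L) ((m i)%:~R * w i) * fourier_coef g (m i)) <= V * M.
Proof.
move=> gBV; have [v1 [v2 [Hv1 Hv2]]] := BV_torus_majorant gBV.
have T0 := twopi_gt0.
have V1 : 0 <= v1 T - v1 0 by rewrite subr_ge0; apply: majorant_nd Hv1 _ _ _ => //;
  exact: ltW.
have V2 : 0 <= v2 T - v2 0 by rewrite subr_ge0; apply: majorant_nd Hv2 _ _ _ => //;
  exact: ltW.
exists (2 * ((v1 T - v1 0) + (v2 T - v2 0)) / T).
  by rewrite mulr_ge0 ?invr_ge0 ?(ltW T0)// mulr_ge0// addr_ge0.
move=> L w m M wM; pose k i : R := (m i)%:~R.
pose P y := \sum_(i < L) w i * expi (- (k i * y)).
pose ar i := complex.Re (w i); pose ai i := complex.Im (w i).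
pose A y := \sum_(i < L) (ar i * cos (- (k i * y)) - ai i * sin (- (k i * y))).
pose B y := \sum_(i < L) (ar i * sin (- (k i * y)) + ai i * cos (- (k i * y))).
(* P' = dA + i dB, so the sum of the k w e^{-iky} is i P' = -dB + i dA; this is the identity [FE]
   below. *)
pose dA y := \sum_(i < L) k i * (ar i * sin (- (k i * y)) + ai i * cos (- (k i * y))).
pose dB y := \sum_(i < L) - k i * (ar i * cos (- (k i * y)) - ai i * sin (- (k i * y))).
have PA y : complex.Re (P y) = A y.
  rewrite Re_sum; apply: eq_bigr => i _; rewrite /ar /ai.
  by case: (w i).
have PB y : complex.Im (P y) = B y.
  rewrite Im_sum; apply: eq_bigr => i _; rewrite /ar /ai.
  by case: (w i).
have A_M y : `|A y| <= M by rewrite -PA; apply: le_trans (normc_Re _) (wM y).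
have B_M y : `|B y| <= M by rewrite -PB; apply: le_trans (normc_Im _) (wM y).
have DA (y : R) : is_derive y 1 A (dA y).
  apply: (@is_derive_sum L (fun i y =>
    ar i * cos (- (k i * y)) - ai i * sin (- (k i * y)))
    (fun i y => k i * (ar i * sin (- (k i * y)) + ai i * cos (- (k i * y))))) => i x.
  by apply: is_derive_eq; rewrite /GRing.scale/=; ring.
have DB (y : R) : is_derive y 1 B (dB y).
  apply: (@is_derive_sum L (fun i y =>
    ar i * sin (- (k i * y)) + ai i * cos (- (k i * y)))
    (fun i y => - k i * (ar i * cos (- (k i * y)) - ai i * sin (- (k i * y))))) => i x.
  by apply: is_derive_eq; rewrite /GRing.scale/=; ring.
have cdA : continuous dA.
  apply: (@continuous_sum L (fun i y =>
    k i * (ar i * sin (- (k i * y)) + ai i * cos (- (k i * y))))) => i x.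
  apply: cvgM; first exact: cvg_cst.
  apply: cvgD; apply: cvgM; try exact: cvg_cst;
    [exact: continuous_sinN|exact: continuous_cosN].
have cdB : continuous dB.
  apply: (@continuous_sum L (fun i y =>
    - k i * (ar i * cos (- (k i * y)) - ai i * sin (- (k i * y))))) => i x.
  apply: cvgM; first exact: cvg_cst.
  apply: cvgB; apply: cvgM; try exact: cvg_cst;
    [exact: continuous_cosN|exact: continuous_sinN].
(* A crude bound suffices: it only controls the mesh error inside [bv_integral_bound], which
   vanishes in the limit. *)
pose S := \sum_(i < L) `|k i| * (`|ar i| + `|ai i|).
have dAS y : `|dA y| <= S.
  apply: le_trans (ler_norm_sum _ _ _) _; apply: ler_sum => i _.
  rewrite normrM ler_wpM2l//; apply: le_trans (ler_normD _ _) _; rewrite !normrM.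
  by apply: lerD; rewrite ler_piMr// ?normr_cos_le1 ?normr_sin_le1.
have dBS y : `|dB y| <= S.
  apply: le_trans (ler_norm_sum _ _ _) _; apply: ler_sum => i _.
  rewrite normrM normrN ler_wpM2l//; apply: le_trans (ler_normB _ _) _; rewrite !normrM.
  by apply: lerD; rewrite ler_piMr// ?normr_cos_le1 ?normr_sin_le1.
have per i : expi (- (k i * T)) = 1.
  have -> : - (k i * T) = 0 + T * (- m i)%:~R by rewrite mulrNz /k; ring.
  by rewrite expi_periodz expi0.
have PT : P T = P 0.
  by apply: eq_bigr => i _; rewrite per mulr0 oppr0 expi0.
have AT : A 0 = A T by rewrite -!PA PT.
have BT : B 0 = B T by rewrite -!PB PT.
have gT : g 0 = g T by have [/(_ 0)] := gBV; rewrite add0r.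
have g1 : complex.Re (g 0) = complex.Re (g T) by rewrite gT.
have g2 : complex.Im (g 0) = complex.Im (g T) by rewrite gT.
have J1 := bv_integral_bound T0 Hv1 g1 AT DA cdA dAS A_M.
have J2 := bv_integral_bound T0 Hv1 g1 BT DB cdB dBS B_M.
have J3 := bv_integral_bound T0 Hv2 g2 AT DA cdA dAS A_M.
have J4 := bv_integral_bound T0 Hv2 g2 BT DB cdB dBS B_M.
have K1 := bv_continuous_integrable (ltW T0) Hv1 cdA dAS.
have K2 := bv_continuous_integrable (ltW T0) Hv1 cdB dBS.
have K3 := bv_continuous_integrable (ltW T0) Hv2 cdA dAS.
have K4 := bv_continuous_integrable (ltW T0) Hv2 cdB dBS.
have [_ E] := @torus_mean_sum L (fun i => (m i)%:~R * w i)
  (fun i x => g x * expi (- ((m i)%:~R * x))) (fun i => BV_expi_integrable (m i) gBV).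
rewrite -E.
have FE x : \sum_(i < L) ((m i)%:~R * w i) * (g x * expi (- ((m i)%:~R * x))) =
    g x * (- dB x +i* dA x).
  under eq_bigr do rewrite mulrCA; rewrite -mulr_sumr; congr (_ * _).
  apply/eqP; rewrite eq_complex; apply/andP; split; apply/eqP.
    rewrite Re_sum /= -sumrN; apply: eq_bigr => i _.
    rewrite /ar /ai -(rmorph_int (real_complex R)) -/(k i).
    by case: (w i) => p q /=; ring.
  rewrite Im_sum /=; apply: eq_bigr => i _.
  rewrite /ar /ai -(rmorph_int (real_complex R)) -/(k i).
  by case: (w i) => p q /=; ring.
rewrite (eq_fun FE) /torus_mean.
have RE x : complex.Re (g x * (- dB x +i* dA x)) =
   -1 * (complex.Re (g x) * dB x) + -1 * (complex.Im (g x) * dA x).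
  by case: (g x) => p q /=; ring.
have IE x : complex.Im (g x * (- dB x +i* dA x)) =
   1 * (complex.Re (g x) * dA x) + -1 * (complex.Im (g x) * dB x).
  by case: (g x) => p q /=; ring.
rewrite (eq_fun RE) (eq_fun IE).
have [_ ->] := integrable_lin (-1) (-1) K2 K3.
have [_ ->] := integrable_lin 1 (-1) K1 K4.
apply: le_trans (normc_le_ReIm _) _ => /=.
rewrite !normrM normfV (gtr0_norm T0) -mulrDl mulrAC ler_pM2r ?invr_gt0//.
move: J1 J2 J3 J4; set a := \int[mu]_(x in _) _; set b := \int[mu]_(x in _) _.
set c := \int[mu]_(x in _) _; set d := \int[mu]_(x in _) _ => J1 J2 J3 J4.
apply: (@le_trans _ _ ((`|b| + `|c|) + (`|a| + `|d|))); last lra.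
apply: lerD; apply: le_trans (ler_normD _ _) _; rewrite ?mulN1r ?mul1r ?normrN //.
Qed.

End FourierCoefficients.

(** * The evolution and its Hoelder continuity *)

(** Serves twice: for partial sums of the evolution, where raising the cutoff adds pairs of opposite
    frequencies, and for sums of squared coefficients. *)
Lemma sum_symmetric_cat (V : zmodType) (G : int -> V) (a L : nat) :
  \sum_(k < (a + L).*2.+1) G (k%:Z - (a + L)%:Z) =
  \sum_(k < a.*2.+1) G (k%:Z - a%:Z) +
  \sum_(i < L) (G (a.+1 + i)%:Z + G (- (a.+1 + i)%:Z)).
Proof.
elim: L => [|L IH]; first by rewrite addn0 big_ord0 addr0.
rewrite [X in _ = _ + X]big_ord_recr/= addrA -IH addnS doubleS big_ord_recl big_ord_recr
  /=.
have -> : G (0%:Z - (a + L).+1%:Z) = G (- (a.+1 + L)%:Z) by congr G; lia.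
have -> : G ((bump 0 (a + L).*2.+1)%:Z - (a + L).+1%:Z) = G (a.+1 + L)%:Z.
  by congr G; rewrite /bump; lia.
rewrite (eq_bigr (fun k : 'I_((a + L).*2.+1) => G (k%:Z - (a + L)%:Z))); last first.
  by move=> k _; congr G; rewrite /bump /=; lia.
by rewrite [LHS]addrCA; congr (_ + _); exact: addrC.
Qed.

Section EvolutionBlocks.
Context {R : realType}.
Context (alpha t : R) (g : R -> R[i]).
Notation beta := (frac_beta alpha).

Definition evo_term (n : int) (x : R) : R[i] :=
  fourier_coef g n * expi (t * frac_omega alpha n + n%:~R * x).

Lemma evolution_partial_sum_cat a L x :
  evolution_partial_sum (frac_omega alpha) g t (a + L) x =
  evolution_partial_sum (frac_omega alpha) g t a x +
  \sum_(i < L) (evo_term (a.+1 + i)%:Z x + evo_term (- (a.+1 + i)%:Z) x).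
Proof. exact: (sum_symmetric_cat (fun n => evo_term n x)). Qed.

Lemma frac_omega_sign (s : int) (n : nat) : s ^+ 2 = 1 ->
  frac_omega alpha (s * n%:Z) = n%:R `^ alpha.
Proof.
move=> s2; rewrite /frac_omega intrM normrM [`|n%:Z%:~R|]ger0_norm ?ler0z//.
rewrite (_ : `|s%:~R| = 1) ?mul1r//; apply/eqP.
by rewrite -sqrp_eq1// real_normK ?num_real// -rmorphXn/= s2.
Qed.

Context (halpha : 0 < alpha < 2) (halpha1 : alpha != 1) (t0 : t != 0).
Context (gBV : BV_torus g).

(** [fourier_bv_bound] trades the coefficients of [g] for a supremum over y of the sum of e^{it
    n^alpha + ins(x-y)}/n, and partial summation turns 1/n into a factor 1/N in front of
    [expsum_bound]. The sign [s] selects positive or negative frequencies. *)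
Lemma block_term_bound : exists2 C, 0 <= C & forall (s : int) (N a L : nat) x,
  s ^+ 2 = 1 -> (0 < N)%N -> (N <= a)%N -> (a + L <= 2 * N)%N ->
  normc (\sum_(i < L) evo_term (s * (a + i)%:Z) x) <= C * N%:R `^ (- beta).
Proof.
have [K K0 HK] := expsum_bound halpha halpha1 t0.
have [V V0 HV] := fourier_bv_bound gBV.
exists (V * K); first by rewrite mulr_ge0.
move=> s N a [|L] x s2 N0 Na aL.
  by rewrite big_ord0 normc0 !mulr_ge0// powR_ge0.
have a0 i : 0 < (a + i)%:R :> R by rewrite ltr0n addn_gt0 (leq_trans N0 Na).
have ss : (s%:~R ^+ 2 : R) = 1 by rewrite -rmorphXn/= s2.
pose m i : int := s * (a + i)%:Z.
(* The weight s/n makes m w unimodular, as m = s n and s^2 = 1. *)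
pose w i : R[i] := (s%:~R / (a + i)%:R)%:C *
  expi (t * (a + i)%:R `^ alpha + s%:~R * (a + i)%:R * x).
have mR i : (m i)%:~R = s%:~R * (a + i)%:R :> R by rewrite /m intrM.
have E i : evo_term (m i) x = ((m i)%:~R * w i) * fourier_coef g (m i).
  rewrite /evo_term frac_omega_sign// mulrC; congr (_ * _).
  rewrite -(rmorph_int (real_complex R)) mR /w mulrA -rmorphM/=.
  rewrite [X in X%:C](_ : _ = s%:~R ^+ 2); last first.
    by move: (a0 i); move: ((a + i)%:R : R) (s%:~R : R) => r u r0; field;
      rewrite gt_eqF.
  by rewrite ss mul1r.
rewrite (eq_bigr (fun i : 'I_L.+1 => ((m i)%:~R * w i) * fourier_coef g (m i)));
  last by move=> i _; exact: E.
rewrite -mulrA; apply: HV => y.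
pose v i : R[i] := ((a + i)%:R^-1)%:C.
(* The sign moves into the space variable, so that only positive frequencies reach
   [expsum_bound]. *)
pose z i := expi (t * (a + i)%:R `^ alpha + (a + i)%:R * (s%:~R * (x - y))).
rewrite (eq_bigr (fun i : 'I_L.+1 => s%:~R * (v i * z i))); last first.
  move=> i _; rewrite /w /z /v mR -mulrA -expiD rmorphM/= rmorph_int [RHS]mulrA.
  by congr (_ * expi _); ring.
rewrite -mulr_sumr normcM -(rmorph_int (real_complex R)) normc_real.
have -> : `|s%:~R : R| = 1.
  by apply/eqP; rewrite -sqrp_eq1// real_normK ?num_real// ss.
rewrite mul1r; apply: le_trans (@abel_normc _ z v L (K * N%:R `^ (1 - beta)) _) _.
  by move=> k kL; apply: HK => //; apply: leq_trans aL; rewrite leq_add2l.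
have vn i : normc (v i) = (a + i)%:R^-1.
  by rewrite normc_real ger0_norm// invr_ge0 ltW.
(* 1/n decreases, so its variation telescopes and, together with the last value, amounts to 1/a <=
   1/N. *)
have -> : \sum_(i < L) normc (v i.+1 - v i) = a%:R^-1 - (a + L)%:R^-1.
  rewrite (eq_bigr (fun i : 'I_L => (a + i)%:R^-1 - (a + i.+1)%:R^-1)).
    elim: (L) => [|k IH]; first by rewrite big_ord0 addn0 subrr.
    by rewrite big_ord_recr/= IH addrA subrK.
  move=> i _; rewrite /v -(rmorphB (real_complex R)) normc_real distrC ger0_norm//
    subr_ge0.
  by rewrite lef_pV2 ?posrE// ler_nat leq_add2l.
have Np : 0 < N%:R :> R by rewrite ltr0n.
rewrite vn [X in _ * X]addrC subrK -mulrA; apply: ler_wpM2l => //.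
have -> : N%:R `^ (- beta) = N%:R `^ (1 - beta) / N%:R.
  rewrite -{3}[N%:R](@powRr1 _ N%:R) ?ltW// -powRN -powRD;
    last by rewrite (gt_eqF Np) implybT.
  by congr (_ `^ _); ring.
rewrite ler_wpM2l ?powR_ge0// lef_pV2 ?posrE ?ler_nat//.
by have := a0 0%N; rewrite addn0.
Qed.

(** Takes the place of Bernstein's inequality. The terms at [x] are those at [y] times e^{isn(x-y)};
    this factor minus 1 is at most 2N|x-y| at the last frequency and has variation at most L|x-y| <=
    N|x-y|, whence the 3. *)
Lemma block_term_diff : exists2 C, 0 <= C & forall (s : int) (N a L : nat) x y,
  s ^+ 2 = 1 -> (0 < N)%N -> (N <= a)%N -> (a + L <= 2 * N)%N ->
  normc (\sum_(i < L) (evo_term (s * (a + i)%:Z) x - evo_term (s * (a + i)%:Z) y)) <=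
  C * N%:R `^ (- beta) * (N%:R * `|x - y|).
Proof.
have [C C0 HC] := block_term_bound.
exists (3 * C); first by rewrite mulr_ge0.
move=> s N a [|L] x y s2 N0 Na aL.
  by rewrite big_ord0 normc0 !mulr_ge0 ?powR_ge0.
have ss : `|s%:~R : R| = 1.
  by apply/eqP; rewrite -sqrp_eq1// real_normK ?num_real// -rmorphXn/= s2.
pose w i := expi (s%:~R * (a + i)%:R * (x - y)) - 1.
rewrite (eq_bigr (fun i : 'I_L.+1 => w i * evo_term (s * (a + i)%:Z) y)); last first.
  move=> i _; rewrite /w mulrBl mul1r; congr (_ - _).
  rewrite /evo_term mulrCA -expiD; congr (_ * expi _).
  by rewrite intrM/=; ring.
apply: le_trans (@abel_normc _ (fun i =>
  evo_term (s * (a + i)%:Z) y) w L (C * N%:R `^ (- beta)) _) _.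
  by move=> k kL; apply: HC => //; apply: leq_trans aL; rewrite leq_add2l.
rewrite [leRHS](_ : _ = C * N%:R `^ (- beta) * (3 * (N%:R * `|x - y|))); last by ring.
apply: ler_wpM2l; first by rewrite mulr_ge0// powR_ge0.
have w1 : normc (w L) <= 2 * (N%:R * `|x - y|).
  apply: le_trans (normc_expiB_le _) _; rewrite !normrM ss mul1r mulrA.
  apply: ler_wpM2r => //; rewrite ger0_norm//.
  by rewrite -natrM ler_nat; lia.
have w2 i : normc (w i.+1 - w i) <= `|x - y|.
  have -> : w i.+1 - w i = expi (s%:~R * (a + i)%:R * (x - y)) * (expi (s%:~R * (x -
    y)) - 1).
    rewrite mulrBr mulr1 -expiD /w opprB addrA subrK; congr (expi _ - _).
    by rewrite addnS -natr1; ring.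
  by rewrite normcM normc_expi mul1r; apply: le_trans (normc_expiB_le _) _;
    rewrite normrM ss mul1r.
apply: (@le_trans _ _ (2 * (N%:R * `|x - y|) + \sum_(i < L) `|x - y|)).
  by apply: lerD => //; apply: ler_sum => i _.
rewrite sumr_const card_ord -[_ *+ L]mulr_natl.
have LN : L%:R <= N%:R :> R by rewrite ler_nat; lia.
have := normr_ge0 (x - y); nra.
Qed.

End EvolutionBlocks.

(** * Uniform limits and Hoelder bounds from dyadic blocks *)

Section UniformLimit.
Context {R : realType}.

(** The limit is the supremum of the lower bounds a k - e k, each of which lies below every a l + e
    l; the rate comes out explicitly. *)
Lemma real_limit (a e : nat -> R) :
  (forall k l, (k <= l)%N -> `|a l - a k| <= e k) ->
  exists u, forall k, `|u - a k| <= e k.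
Proof.
move=> ae; pose A := [set a k - e k | k in setT].
have Aub l : ubound A (a l + e l).
  move=> _ [k _ <-]; have [kl|lk] := leqP k l.
    by have := ae _ _ kl; have := ae _ _ (leqnn l); rewrite subrr normr0 ler_norml; lra.
  by have := ae _ _ (ltnW lk); have := ae _ _ (leqnn k);
    rewrite subrr normr0 ler_norml; lra.
have A0 : A !=set0 by exists (a 0%N - e 0%N), 0%N.
have As : has_sup A by split => //; exists (a 0%N + e 0%N); exact: Aub.
exists (sup A) => k; rewrite ler_norml.
have h1 : a k - e k <= sup A by apply: ub_le_sup; [exact: As.2|exists k].
have h2 : sup A <= a k + e k by apply: ge_sup => //; exact: Aub.
by apply/andP; split; lra.
Qed.

Lemma complex_limit (a : nat -> R[i]) (e : nat -> R) :
  (forall k l, (k <= l)%N -> normc (a l - a k) <= e k) ->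
  exists u, forall k, normc (u - a k) <= 2 * e k.
Proof.
move=> ae.
have [k l kl|x Hx] := @real_limit (fun k => complex.Re (a k)) e.
  by rewrite -raddfB; apply: le_trans (normc_Re _) (ae _ _ kl).
have [k l kl|y Hy] := @real_limit (fun k => complex.Im (a k)) e.
  by rewrite -raddfB; apply: le_trans (normc_Im _) (ae _ _ kl).
exists (x +i* y) => k; apply: le_trans (normc_le_ReIm _) _.
rewrite !raddfB/= mulr_natl mulr2n; exact: lerD (Hx k) (Hy k).
Qed.

Lemma dyadic_scale (theta : R) : 0 < theta <= 1 ->
  exists k, theta <= (2 ^+ k)^-1 /\ (2 ^+ k.+1)^-1 <= theta.
Proof.
move=> /andP[t0 t1]; pose n := Num.truncn theta^-1.
have it1 : 1 <= theta^-1 by rewrite invf_ge1.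
have n1 : (0 < n)%N by rewrite truncn_gt0.
have ln : n%:R <= theta^-1 by rewrite truncn_le invr_ge0 ltW.
have [|k1 k2] := andP (@trunc_log_bounds 2 n _ n1); first by [].
exists (trunc_log 2 n); split.
  rewrite -[leLHS]invrK lef_pV2 ?posrE ?exprn_gt0 ?invr_gt0//.
  by apply: le_trans ln; rewrite -natrX ler_nat.
rewrite -[leRHS]invrK lef_pV2 ?posrE ?exprn_gt0 ?invr_gt0//.
apply: (le_trans (ltW (truncnS_gt _))).
by rewrite -natrX ler_nat.
Qed.

Section DyadicBlocks.
Context (P : nat -> R -> R[i]) (C b : R).
Context (b01 : 0 < b < 1) (C0 : 0 <= C).
Context (P_block : forall N a L x, (0 < N)%N -> (N <= a)%N -> (a + L <= 2 * N)%N ->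
  normc (P (a + L)%N x - P a x) <= C * N%:R `^ (- b)).
Context (P_diff : forall N x y, (0 < N)%N ->
  normc ((P (2 * N)%N x - P N x) - (P (2 * N)%N y - P N y)) <=
  C * N%:R `^ (- b) * (N%:R * `|x - y|)).
Context (P1 : forall x y, P 1%N x = P 1%N y).

(** The ratio of the block bounds at consecutive powers of 2. From 0 < b < 1 follows q < 1 < 2q: the
    sizes of high blocks sum to about the first of them, the increments of low blocks to about the
    last. *)
Let q : R := 2 `^ (- b).

Let q_gt0 : 0 < q. Proof. exact: powR_gt0. Qed.

Let q_lt1 : q < 1.
Proof.
case/andP: b01 => b0 _; rewrite /q powRN invf_lt1 ?powR_gt0//.
have := @gt0_ltr_powR R b b0 1 2; rewrite powR1; apply; rewrite ?nnegrE//; exact: ltr1n.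
Qed.

Let q2_gt1 : 1 < 2 * q.
Proof.
case/andP: b01 => _ b1; rewrite /q -{1}[2](@powRr1 R) // -powRD ?pnatr_eq0 ?implybT//.
have := @gt0_ltr_powR R (1 - b) _ 1 2; rewrite powR1; apply;
  rewrite ?nnegrE ?subr_gt0//; exact: ltr1n.
Qed.

Let qX k : (2 ^ k)%N%:R `^ (- b) = q ^+ k.
Proof.
by rewrite natrX -(powR_mulrn k (ler0n R 2)) -(powR_mulrn k (ltW q_gt0)) powRAC. Qed.

Let pow2_cauchy k m x : normc (P (2 ^ (k + m))%N x - P (2 ^ k)%N x) <=
  C * q ^+ k * (1 - q ^+ m) / (1 - q).
Proof.
have q1 : 0 < 1 - q by rewrite subr_gt0.
elim: m => [|m IH].
  by rewrite addn0 subrr normc0 expr0 subrr mulr0 mul0r.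
apply: le_trans (normc_triangle (P (2 ^ (k + m))%N x) _ _) _.
have -> : (2 ^ (k + m.+1) = 2 ^ (k + m) + 2 ^ (k +
  m))%N by rewrite addnS expnS mul2n addnn.
apply: le_trans (lerD (@P_block (2 ^ (k + m)) _ _ x _ (leqnn _) _) IH) _.
- by rewrite expn_gt0.
- by rewrite mul2n addnn.
rewrite qX exprD exprS le_eqVlt; apply/orP; left; apply/eqP.
by field; rewrite gt_eqF.
Qed.

Let E k := C * q ^+ k / (1 - q).

Let pow2_limit : exists u : R -> R[i], forall x k, normc (u x - P (2 ^ k)%N x) <=
  2 * E k.
Proof.
have H x : exists z, forall k, normc (z - P (2 ^ k)%N x) <= 2 * E k.
  apply: (@complex_limit (fun k => P (2 ^ k)%N x) E) => k l /subnKC <-.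
  apply: le_trans (pow2_cauchy _ _ _) _; rewrite ler_pM2r ?invr_gt0 ?subr_gt0//.
  rewrite ler_piMr ?mulr_ge0 ?exprn_ge0 ?(ltW q_gt0)// gerBl.
  by rewrite exprn_ge0// ltW.
have [u Hu] := choice H; by exists u.
Qed.

(** For |x-y| about 2^-k, increments of the blocks below 2^k add up to |x-y| (2q)^k, about q^k; the
    blocks above contribute q^k by their size alone; and q^k is |x-y|^b up to a constant. *)
Lemma dyadic_uniform_limit : exists u D, [/\ 0 <= D,
  forall n x, (0 < n)%N -> normc (u x - P n x) <= D * n%:R `^ (- b) &
  forall x y, normc (u x - u y) <= D * `|x - y| `^ b].
Proof.
have [b0 b1] := andP b01.
have [u Hu] := pow2_limit.
have q1 : 0 < 1 - q by rewrite subr_gt0.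
pose D0 := (2 * C / (1 - q) + C).
have D00 : 0 <= D0 by rewrite addr_ge0// mulr_ge0 ?mulr_ge0// invr_ge0 ltW.
(* A general n is compared with the power of 2 just below it; passing from 2^k back to n < 2^(k+1)
   costs the factor 1/q. *)
have near_u n x : (0 < n)%N -> normc (u x - P n x) <= D0 / q * n%:R `^ (- b).
  move=> n0; have [|k1 k2] := andP (@trunc_log_bounds 2 n _ n0); first by [].
  set k := trunc_log 2 n in k1 k2.
  apply: (@le_trans _ _ (D0 * q ^+ k)).
    apply: le_trans (normc_triangle (P (2 ^ k)%N x) _ _) _.
    rewrite /D0 mulrDl; apply: lerD.
      by apply: le_trans (Hu x k) _; rewrite /E; lra.
    rewrite normcBC -{1}(subnKC k1) -qX; apply: P_block => //;
      first by rewrite expn_gt0.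
    by rewrite subnKC// -expnS ltnW.
  rewrite -mulrA; apply: ler_wpM2l => //; rewrite mulrC ler_pdivlMr// -exprSr -qX.
  rewrite !powRN lef_pV2 ?posrE ?powR_gt0 ?ltr0n ?expn_gt0//.
  by apply: ge0_ler_powR; rewrite ?(ltW b0) ?nnegrE// ler_nat ltnW.
(* The telescoping starts at [P 1], whose increments vanish, and sums a geometric progression of
   ratio 2q. *)
have diff_pow2 k x y : normc (P (2 ^ k)%N x - P (2 ^ k)%N y) <=
    C * `|x - y| * (((2 * q) ^+ k - 1) / (2 * q - 1)).
  have qq : 0 < 2 * q - 1 by rewrite subr_gt0.
  elim: k => [|k IH]; first by rewrite (P1 x y) !subrr normc0 mul0r mulr0.
  have -> : P (2 ^ k.+1)%N x - P (2 ^ k.+1)%N y =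
     ((P (2 * 2 ^ k)%N x - P (2 ^ k)%N x) - (P (2 * 2 ^ k)%N y - P (2 ^ k)%N y)) +
     (P (2 ^ k)%N x - P (2 ^ k)%N y) by rewrite -expnS; ring.
  apply: le_trans (normcD _ _) _.
  apply: le_trans (lerD (P_diff x y _) IH) _; first by rewrite expn_gt0.
  rewrite qX natrX exprS exprMn le_eqVlt; apply/orP; left; apply/eqP.
  by field; rewrite gt_eqF.
pose D1 := (C / (2 * q - 1) + 4 * C / (1 - q)).
have qq : 0 < 2 * q - 1 by rewrite subr_gt0.
have D10 : 0 <= D1.
  by rewrite addr_ge0// mulr_ge0 ?mulr_ge0// ?invr_ge0 ltW.
exists u, (2 * D0 / q + D1 / q); split.
- by rewrite addr_ge0// mulr_ge0 ?mulr_ge0 ?invr_ge0 ?(ltW q_gt0).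
- move=> n x n0; apply: le_trans (near_u n x n0) _; apply: ler_wpM2r;
    first exact: powR_ge0.
  have a1 : 0 <= D0 / q by rewrite mulr_ge0// invr_ge0 ltW.
  have a2 : 0 <= D1 / q by rewrite mulr_ge0// invr_ge0 ltW.
  lra.
move=> x y.
have a1 : 0 <= D0 / q by rewrite mulr_ge0// invr_ge0 ltW.
have a2 : 0 <= D1 / q by rewrite mulr_ge0// invr_ge0 ltW.
have [->|xy] := eqVneq x y.
  by rewrite !subrr normc0 mulr_ge0 ?powR_ge0//; lra.
have th0 : 0 < `|x - y| by rewrite normr_gt0 subr_eq0.
have [th1|th1] := leP `|x - y| 1.
  have [|k [k1 k2]] := @dyadic_scale `|x - y|; first by rewrite th0.
  apply: (@le_trans _ _ (D1 * q ^+ k)).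
    have h1 := Hu x k; have h2 := Hu y k; have h3 := diff_pow2 k x y.
    apply: le_trans (normc_triangle (P (2 ^ k)%N x) _ _) _.
    apply: le_trans (lerD h1 (normc_triangle (P (2 ^ k)%N y) _ _)) _.
    rewrite [normc (_ - u y)]normcBC.
    have h4 : C * `|x - y| * (((2 * q) ^+ k - 1) / (2 * q - 1)) <= C / (2 * q -
      1) * q ^+ k.
      rewrite [leLHS](_ : _ = C / (2 * q - 1) * (`|x - y| * ((2 * q) ^+ k - 1)));
        last by ring.
      apply: ler_wpM2l; first by rewrite mulr_ge0// invr_ge0 ltW.
      apply: (@le_trans _ _ ((2 ^+ k)^-1 * (2 * q) ^+ k)).
        apply: ler_pM => //; last by rewrite gerBl.
        by rewrite subr_ge0 exprn_ege1// ltW.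
      by rewrite exprMn mulKf// gt_eqF// exprn_gt0.
    rewrite /D1 mulrDl; rewrite /E in h1 h2 *; lra.
  (* |x-y| >= 2^-(k+1) yields a bound for q^(k+1), one power more than needed; hence [D1 / q]. *)
  have h : q ^+ k.+1 <= `|x - y| `^ b.
    rewrite -qX powRN natrX -powR_inv1 ?powR_ge0// -powRrM mulrN1 powRN.
    apply: (@le_trans _ _ (((2 ^+ k.+1)^-1) `^ b)).
      by rewrite -powR_inv1 ?exprn_ge0// -powRrM mulrC powRrM powR_inv1 ?powR_ge0.
    by apply: ge0_ler_powR; rewrite ?nnegrE ?invr_ge0 ?exprn_ge0// ltW.
  apply: (@le_trans _ _ (D1 / q * `|x - y| `^ b)).
    by rewrite -mulrA; apply: ler_wpM2l => //; rewrite mulrC ler_pdivlMr// -exprSr.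
  by apply: ler_wpM2r; [exact: powR_ge0|lra].
(* At distance above 1 it is enough that both values are within a fixed distance of the constant
   [P 1]. *)
have h : 1 <= `|x - y| `^ b.
  rewrite -[leLHS](powRr0 `|x - y|); apply: ler_powR; exact: ltW.
have hx := near_u 1%N x isT; have hy := near_u 1%N y isT.
rewrite powR1 mulr1 in hx hy.
apply: (@le_trans _ _ (2 * D0 / q)).
  apply: le_trans (normc_triangle (P 1%N x) _ _) _; rewrite {2}(P1 x y).
  by rewrite [normc (P _ _ - _)]normcBC; lra.
rewrite -[leLHS]mulr1; apply: ler_pM => //; lra.
Qed.

End DyadicBlocks.
End UniformLimit.

Section ContinuousComplex.
Context {R : realType}.
Implicit Types (F G : R -> R[i]).
Notation T := (pi *+ 2 : R).

Definition ccontinuous F :=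
  continuous (fun x => complex.Re (F x)) /\ continuous (fun x => complex.Im (F x)).

Lemma ccontinuousD F G : ccontinuous F -> ccontinuous G -> ccontinuous (fun x =>
  F x + G x).
Proof.
move=> [Fr Fi] [Gr Gi]; split => x.
  under eq_fun do rewrite raddfD; apply: cvgD; [exact: Fr|exact: Gr].
under eq_fun do rewrite raddfD; apply: cvgD; [exact: Fi|exact: Gi].
Qed.

Lemma ccontinuousB F G : ccontinuous F -> ccontinuous G -> ccontinuous (fun x =>
  F x - G x).
Proof.
move=> [Fr Fi] [Gr Gi]; split => x.
  under eq_fun do rewrite raddfB; apply: cvgB; [exact: Fr|exact: Gr].
under eq_fun do rewrite raddfB; apply: cvgB; [exact: Fi|exact: Gi].
Qed.

Lemma ccontinuous_expi (c : R[i]) (p k : R) : ccontinuous (fun x =>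
  c * expi (p + k * x)).
Proof.
have cc : continuous (fun x : R => cos (p + k * x)).
  move=> x; apply: (@continuous_comp _ _ _ (fun x => p + k * x) (@cos R));
    last exact: continuous_cos.
  by apply: cvgD; [exact: cvg_cst|apply: cvgM; [exact: cvg_cst|exact: cvg_id]].
have cs : continuous (fun x : R => sin (p + k * x)).
  move=> x; apply: (@continuous_comp _ _ _ (fun x => p + k * x) (@sin R));
    last exact: continuous_sin.
  by apply: cvgD; [exact: cvg_cst|apply: cvgM; [exact: cvg_cst|exact: cvg_id]].
case: c => a b; split => x /=.
  by apply: cvgB; apply: cvgM; try exact: cvg_cst; [exact: cc|exact: cs].
by apply: cvgD; apply: cvgM; try exact: cvg_cst; [exact: cs|exact: cc].
Qed.

Lemma ccontinuous_sum (L : nat) (F : nat -> R -> R[i]) :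
  (forall i, ccontinuous (F i)) -> ccontinuous (fun x => \sum_(i < L) F i x).
Proof.
move=> Fc; elim: L => [|L IH].
  rewrite (_ : (fun x => _) = fun=> 0); first by split => x; exact: cvg_cst.
  by apply/funext => y; rewrite big_ord0.
rewrite (_ : (fun x => _) = (fun y => \sum_(i < L) F i y + F L y)).
  exact: ccontinuousD.
by apply/funext => y; rewrite big_ord_recr.
Qed.

Lemma ccontinuous_sqr F : ccontinuous F -> continuous (fun x => normc (F x) ^+ 2).
Proof.
move=> [Fr Fi] x; under eq_fun do rewrite sqr_normcE.
apply: cvgD; rewrite expr2; under eq_fun do rewrite expr2.
  by apply: cvgM; exact: Fr.
by apply: cvgM; exact: Fi.
Qed.

Lemma evolution_partial_sum_ccontinuous omega (g : R -> R[i]) t N :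
  ccontinuous (evolution_partial_sum omega g t N).
Proof.
apply: (@ccontinuous_sum N.*2.+1 (fun k x => fourier_coef g (k%:Z - N%:Z) *
  expi (t * omega (k%:Z - N%:Z) + (k%:Z - N%:Z)%:~R * x))) => i.
exact: ccontinuous_expi.
Qed.

Lemma hoelder_continuous (f : R -> R) (D b : R) : 0 < b -> 0 <= D ->
  (forall x y, `|f x - f y| <= D * `|x - y| `^ b) -> continuous f.
Proof.
move=> b0 D0 fD x; apply/cvgrPdist_le => /= e e0.
pose d := (e / (D + 1)) `^ b^-1.
have D1 : 0 < D + 1 by rewrite ltr_wpDl.
have d0 : 0 < d by rewrite powR_gt0// divr_gt0.
near=> y; apply: le_trans (fD _ _) _.
have xy : `|x - y| <= d.
  by near: y; exists d => //= y /= /ltW.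
apply: (@le_trans _ _ (D * (e / (D + 1)))).
  apply: ler_wpM2l => //.
  have -> : e / (D + 1) = d `^ b.
    by rewrite /d -powRrM mulVf ?gt_eqF// powRr1// divr_ge0// ltW.
  by apply: ge0_ler_powR; rewrite ?nnegrE// ltW.
by rewrite mulrCA ler_piMr ?(ltW e0)// ler_pdivrMr// mul1r lerDl.
Unshelve. all: by end_near. Qed.

Lemma powRN_small (D b e : R) : 0 < b -> 0 <= D -> 0 < e ->
  exists N0, forall N, (N0 <= N)%N -> D * N.+1%:R `^ (- b) <= e.
Proof.
move=> b0 D0 e0; exists (Num.truncn ((D / e) `^ b^-1)) => N NN.
have De : 0 <= D / e by rewrite divr_ge0// ltW.
rewrite powRN ler_pdivrMr ?powR_gt0 ?ltr0n// mulrC -ler_pdivrMr//.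
have -> : D / e = ((D / e) `^ b^-1) `^ b by rewrite -powRrM mulVf ?gt_eqF// powRr1.
apply: ge0_ler_powR; rewrite ?nnegrE ?powR_ge0 ?ler0n ?(ltW b0)//.
by apply: (le_trans (ltW (truncnS_gt _))); rewrite ler_nat.
Qed.

Lemma torus_reduce (x : R) : exists m : int, 0 <= x + T * m%:~R < T.
Proof.
have T0 := @twopi_gt0 R.
exists (- Num.floor (x / T)); rewrite mulrNz mulrN.
have h1 := Num.Theory.floor_le (x / T); have h2 := floorD1_gt (x / T).
rewrite intrD in h2.
have -> : x - T * (Num.floor (x / T))%:~R = T * (x / T - (Num.floor (x / T))%:~R).
  by rewrite mulrBr mulrCA divff ?mulr1// gt_eqF.
apply/andP; split; first by rewrite mulr_ge0 ?subr_ge0// ltW.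
by rewrite -[ltRHS]mulr1 ltr_pM2l//; lra.
Qed.

Lemma periodic_int (A : Type) (f : R -> A) (x : R) (m : int) :
  (forall y, f (y + T) = f y) -> f (x + T * m%:~R) = f x.
Proof.
move=> fT; have fn n y : f (y + T * n%:R) = f y.
  elim: n => [|n IH]; first by rewrite mulr0 addr0.
  by rewrite -[n.+1]addn1 natrD mulrDr mulr1 addrA fT.
case: m => n; first exact: fn.
by rewrite NegzE mulrNz mulrN -[in RHS](subrK (T * n.+1%:R) x) fn.
Qed.

End ContinuousComplex.

(** * The continuous representative of the evolution: construction and uniqueness *)

Section Evolution.
Context {R : realType} (alpha t : R) (g : R -> R[i]).
Context (halpha : 0 < alpha < 2) (halpha1 : alpha != 1) (t0 : t != 0).
Context (gBV : BV_torus g).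
Notation beta := (frac_beta alpha).
Notation mu := (@lebesgue_measure R).
Notation T := (pi *+ 2 : R).
Notation psum := (evolution_partial_sum (frac_omega alpha) g t).

Lemma evolution_uniform_limit : exists u D, [/\ 0 <= D,
  forall N x, normc (u x - psum N x) <= D * N.+1%:R `^ (- beta) &
  forall x y, normc (u x - u y) <= D * `|x - y| `^ beta].
Proof.
have [C1 C10 HC1] := block_term_bound halpha halpha1 t0 gBV.
have [C2 C20 HC2] := block_term_diff halpha halpha1 t0 gBV.
have s1 : (1 : int) ^+ 2 = 1 by rewrite expr1n.
have s2 : (- 1 : int) ^+ 2 = 1 by rewrite sqrrN expr1n.
(* With the shift [n.-1], [P n] holds the frequencies |k| < n: [P 1] is then constant in x, and P (a
   + L) - P a is the block of frequencies a, ..., a + L - 1 with their opposites. *)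
have [||||u [D [D0 H1 H2]]] := @dyadic_uniform_limit R (fun n =>
  psum n.-1) (2 * (C1 + C2)) beta (frac_beta_lt1 halpha halpha1).
- by rewrite mulr_ge0// addr_ge0.
- move=> N [|a] L x N0 Na aL; first by rewrite leqn0 eqn0Ngt N0 in Na.
  rewrite addSn [_.-1]/= [a.+1.-1]/= evolution_partial_sum_cat.
  rewrite addrAC subrr add0r big_split/=.
  apply: le_trans (normcD _ _) _.
  have h1 := HC1 1 N a.+1 L x s1 N0 Na aL; have h2 := HC1 (-1) N a.+1 L x s2 N0 Na aL.
  under eq_bigr do rewrite -[_%:Z]mul1r.
  under [X in _ + normc X <= _]eq_bigr do rewrite -mulN1r.
  have := powR_ge0 (N%:R : R) (- beta) => p0.
  have : 0 <= C2 * N%:R `^ (- beta) by rewrite mulr_ge0.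
  lra.
- move=> [//|N'] x y N0; set N := N'.+1.
  have -> : ((2 * N)%N.-1 = N' + N)%N by rewrite mul2n -addnn /N addSn.
  have -> : (N.-1 = N')%N by [].
  rewrite !evolution_partial_sum_cat -/N.
  rewrite [psum _ x + _]addrC [psum _ y + _]addrC !addrK -sumrB.
  have -> : \sum_(i < N) (evo_term alpha t g (N + i)%N x + evo_term alpha t g (- (N +
    i)%N%:Z) x -
      (evo_term alpha t g (N + i)%N y + evo_term alpha t g (- (N + i)%N%:Z) y)) =
    \sum_(i < N) (evo_term alpha t g (1 * (N + i)%N%:Z) x -
      evo_term alpha t g (1 * (N + i)%N%:Z) y) +
    \sum_(i < N) (evo_term alpha t g (-1 * (N + i)%N%:Z) x -
      evo_term alpha t g (-1 * (N + i)%N%:Z) y).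
    by rewrite -big_split/=; apply: eq_bigr => i _; rewrite mul1r mulN1r; ring.
  apply: le_trans (normcD _ _) _.
  have NN : (N + N <= 2 * N)%N by rewrite mul2n addnn.
  have h1 := HC2 1 N N N x y s1 N0 (leqnn _) NN;
    have h2 := HC2 (-1) N N N x y s2 N0 (leqnn _) NN.
  apply: le_trans (lerD h1 h2) _; rewrite -mulrDl; apply: ler_wpM2r;
    first by rewrite mulr_ge0.
  rewrite -mulrDl; apply: ler_wpM2r; first exact: powR_ge0.
  lra.
- move=> x y; rewrite /evolution_partial_sum /= !big_ord1 subrr.
  by rewrite [0%:~R]mulr0z !mul0r.
exists u, D; split => // N x; exact: (H1 N.+1 x isT).
Qed.

Lemma psum_period N x : psum N (x + T) = psum N x.
Proof.
apply: eq_bigr => i _; congr (_ * _);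
  rewrite mulrDr addrA -[in RHS](expi_periodz _ (i%:Z - N%:Z)).
by rewrite [_ * T]mulrC.
Qed.

Section Limit.
Context (u : R -> R[i]) (D : R).
Context (D0 : 0 <= D) (u_psum : forall N x, normc (u x - psum N x) <=
  D * N.+1%:R `^ (- beta)).
Context (u_hoelder : forall x y, normc (u x - u y) <= D * `|x - y| `^ beta).

Let beta0 : 0 < beta. Proof. by have /andP[] := frac_beta_lt1 halpha halpha1. Qed.

Lemma limit_period : on_torus u.
Proof.
move=> x; apply/eqP; rewrite -subr_eq0; apply/eqP/eq0_normc/eqP.
rewrite eq_le normc_ge0 andbT; apply/ler_addgt0Pr => e e0; rewrite add0r.
have [|N HN] := @powRN_small R (2 * D) beta e beta0 _ e0; first by rewrite mulr_ge0.
apply: le_trans (HN N (leqnn _)).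
apply: le_trans (normc_triangle (psum N x) _ _) _; rewrite -{1}psum_period.
have := u_psum N (x + T); have := u_psum N x; rewrite [normc (psum _ _ - _)]normcBC.
lra.
Qed.

Lemma limit_ccontinuous : ccontinuous u.
Proof.
split; apply: (hoelder_continuous beta0 D0) => x y.
  by rewrite -raddfB; apply: le_trans (normc_Re _) (u_hoelder _ _).
by rewrite -raddfB; apply: le_trans (normc_Im _) (u_hoelder _ _).
Qed.

Lemma L2norm2_le F B : ccontinuous F -> 0 <= B ->
  (forall x, 0 <= x -> x <= T -> normc (F x) <= B) -> (L2norm2 F <= (B ^+ 2 * T)%:E)%E.
Proof.
move=> Fc B0 FB; have T0 := @twopi_gt0 R.
have cS : (mu `[0%R, T] = T%:E)%E by rewrite /= lebesgue_measure_itv/= lte_fin T0 -EFinB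
  subr0.
apply: (@le_trans _ _ (\int[mu]_(x in `[0%R, T]) (cst (B ^+ 2)%:E x))%E).
  apply: ge0_le_integral => //.
  - by move=> x _; rewrite lee_fin sqr_ge0.
  - apply/measurable_EFinP; apply: measurable_funTS; apply: continuous_measurable_fun.
    exact: ccontinuous_sqr.
  - move=> x /=; rewrite in_itv/= => /andP[x0 xT]; rewrite lee_fin.
    by rewrite lerXn2r ?nnegrE ?normc_ge0// FB.
by rewrite integral_cst//; move: cS => /= ->; rewrite -EFinM.
Qed.

Lemma limit_is_evolution : is_evolution (frac_omega alpha) g t u.
Proof.
have [ur ui] := limit_ccontinuous; have T0 := @twopi_gt0 R.
split.
  split; [exact: limit_period|exact: continuous_measurable_fun|exact:
    continuous_measurable_fun|].
  apply: le_lt_trans (ltry _); apply: (@L2norm2_le u (normc (u 0) +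
    D * T `^ beta)) => //.
    by rewrite addr_ge0 ?normc_ge0// mulr_ge0// powR_ge0.
  move=> x x0 xT; rewrite -[u x](subrK (u 0)); apply: le_trans (normcD _ _) _.
  rewrite addrC lerD2l; apply: le_trans (u_hoelder _ _) _; rewrite subr0 ger0_norm//.
  by apply: ler_wpM2l => //; apply: ge0_ler_powR => //; rewrite ?nnegrE// ltW.
pose r N := (D * N.+1%:R `^ (- beta)) ^+ 2 * T.
have r0 : r @ \oo --> 0.
  apply/cvgr0Pnorm_le => e e0.
  have [|N HN] := @powRN_small R D beta (Num.sqrt (e / T)) beta0 D0.
    by rewrite sqrtr_gt0 divr_gt0.
  exists N => // n /= Nn; rewrite ger0_norm; last by rewrite mulr_ge0 ?sqr_ge0// ltW.
  rewrite /r -ler_pdivlMr//.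
  rewrite -[leRHS](@sqr_sqrtr _ (e / T)); last by rewrite ltW// divr_gt0.
  by rewrite lerXn2r ?nnegrE ?sqrtr_ge0 ?HN// mulr_ge0// powR_ge0.
apply: (@squeeze_cvge _ _ _ _ (cst 0%E) _ (fun N => (r N)%:E)).
- apply: nearW => N; apply/andP; split.
    by apply: integral_ge0 => x _; rewrite lee_fin sqr_ge0.
  apply: L2norm2_le => //.
  + apply: ccontinuousB => //; exact: evolution_partial_sum_ccontinuous.
  + by rewrite mulr_ge0// powR_ge0.
- exact: cvg_cst.
- by apply: cvg_EFin => //; exact: nearW.
Qed.

Lemma evolution_unique w : is_evolution (frac_omega alpha) g t w ->
  continuous_torus w ->
  w = u.
Proof.
move=> [_ wlim] [wT wr wi]; have T0 := @twopi_gt0 R.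
apply/funext => x0; apply/eqP/negPn/negP => wu.
have [m /andP[]] := torus_reduce x0; set x := x0 + _ => xge xlt.
pose phi y := normc (w y - u y) ^+ 2.
have phic : continuous phi by apply: ccontinuous_sqr; apply: ccontinuousB => //;
  exact: limit_ccontinuous.
pose c := normc (w x - u x).
have c0 : 0 < c.
  rewrite lt_neqAle normc_ge0 andbT eq_sym; apply: contra wu => /eqP /eq0_normc.
  by rewrite /x (periodic_int x0 m wT) (periodic_int x0 m limit_period) => /subr0_eq ->.
have c20 : 0 < (c / 2) ^+ 2 by rewrite exprn_gt0// divr_gt0.
have : \forall y \near x, (c / 2) ^+ 2 <= phi y.
  have := @cvgr_ge _ _ _ _ phi (phi x) (phic x) ((c / 2) ^+ 2); apply.
  rewrite /phi -/c ltrXn2r ?nnegrE ?divr_ge0 ?(ltW c0)//.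
  by rewrite ltr_pdivrMr// ltr_pMr// ltr1n.
move=> [d /= d0 Hd].
(* The interval extends to the right of [x], where there is room because the reduction gives x < T
   strictly. *)
pose p := x; pose q := Num.min T (x + d / 2).
have pq : p < q by rewrite /p /q lt_min xlt ltrDl divr_gt0.
have qT : q <= T by rewrite /q ge_min lexx.
have Hpq y : p <= y -> y <= q -> c / 2 <= normc (w y - u y).
  move=> py yq; have : (c / 2) ^+ 2 <= phi y.
    apply: Hd => /=; rewrite distrC ger0_norm ?subr_ge0//.
    have : y <= x + d / 2 by apply: le_trans yq _; rewrite /q ge_min lexx orbT.
    rewrite /p in py; lra.
  by rewrite /phi ler_pXn2r// ?nnegrE ?normc_ge0 ?divr_ge0 ?(ltW c0)//.
have [|N0 HN0] := @powRN_small R D beta (c / 4) beta0 D0; first by rewrite divr_gt0.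
have low N : (N0 <= N)%N ->
   (((c / 4) ^+ 2 * (q - p))%:E <= L2norm2 (fun x => (w x - psum N x)%R))%E.
  move=> NN.
  have fc : continuous (fun y => normc (w y - psum N y) ^+ 2).
    apply: ccontinuous_sqr; apply: ccontinuousB => //;
      exact: evolution_partial_sum_ccontinuous.
  have cS : (mu `[p, q] = (q - p)%:E)%E by rewrite /= lebesgue_measure_itv/= lte_fin pq
    -EFinB.
  apply: (@le_trans _ _ (\int[mu]_(y in `[p, q]) ((normc (w y -
    psum N y) ^+ 2)%R)%:E)%E).
    rewrite EFinM; have <- : (\int[mu]_(y in `[p, q]) (cst ((c / 4) ^+ 2)%:E y) =
      ((c / 4) ^+ 2)%:E * (q - p)%:E)%E.
      by rewrite integral_cst//; move: cS => /= ->.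
    apply: ge0_le_integral => //.
    - by move=> y _; rewrite lee_fin sqr_ge0.
    - apply/measurable_EFinP; apply: measurable_funTS; exact: continuous_measurable_fun.
    - move=> y /=; rewrite in_itv/= => /andP[py yq]; rewrite lee_fin.
      rewrite lerXn2r ?nnegrE ?normc_ge0 ?divr_ge0 ?(ltW c0)//.
      have h1 := Hpq y py yq; have h2 := HN0 N NN; have h3 := u_psum N y.
      have := normc_triangle (psum N y) (w y) (u y);
        rewrite [normc (psum _ _ - _)]normcBC.
      lra.
  apply: ge0_subset_integral => //.
  - apply/measurable_EFinP; apply: measurable_funTS; exact: continuous_measurable_fun.
  - by move=> y _; rewrite lee_fin sqr_ge0.
  - by move=> y /=; rewrite !in_itv/= => /andP[py yq];
      rewrite (le_trans xge py) (le_trans yq qT).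
have : (((c / 4) ^+ 2 * (q - p))%:E <= 0 :> \bar R)%E.
  by apply: cvge_ge wlim; exists N0 => // N /=; exact: low.
by rewrite lee_fin leNgt mulr_gt0// ?exprn_gt0 ?divr_gt0// subr_gt0.
Qed.

End Limit.
End Evolution.

(** * Dimension of graphs *)

Section FractalDimension.
Context {R : realType}.
Implicit Types (E : set (R * R)) (e L M : R).

(** Degenerate values agree as well: for nonpositive [x] the logarithm is -oo and both sides hold,
    for +oo both fail. *)
Lemma lne_quotient_le (x : \bar R) L M : 0 < L ->
  (lne x * (L^-1)%:E <= M%:E)%E = (x <= (expR (M * L))%:E)%E.
Proof.
move=> L0; have iL : 0 < L^-1 by rewrite invr_gt0.
case: x => [r| |] /=; last 2 first.
- by rewrite gt0_mulye ?lte_fin.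
- by rewrite gt0_mulNye ?lte_fin// !leNye.
case: ifPn => [r0|]; first by rewrite gt0_mulNye ?lte_fin//
  leNye lee_fin (le_trans r0) ?expR_ge0.
rewrite -ltNge => r0; rewrite -EFinM !lee_fin ler_pdivrMr//.
by rewrite -{2}(lnK r0) ler_expR.
Qed.

(** The slack [d] is there to absorb multiplicative constants in the covering number. *)
Lemma fractal_dim_le E (M : R) :
  (forall d, 0 < d -> exists2 e0, 0 < e0 & forall e, 0 < e -> e < e0 ->
     e < 1 /\ (covering_number E e <= (expR ((M + d) * ln e^-1))%:E)%E) ->
  (fractal_dim E <= M%:E)%E.
Proof.
move=> H; apply/lee_addgt0Pr => d d0; have [e0 e00 He] := H d d0.
apply: ge_ereal_inf; eexists.
  exists [set e | 0 < e /\ e < e0] => //.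
  near=> e; split; near: e; [exact: nbhs_right_gt|exact: nbhs_right_lt].
apply: ge_ereal_sup => _ [e [ep ee0] <-].
have [e1 Ne] := He e ep ee0; rewrite -EFinD lne_quotient_le//.
by rewrite ln_gt0// invf_gt1.
Unshelve. all: by end_near. Qed.

(** An upper limit below [M] controls all small scales at once, so covers are available at every
    small radius 2 pi / 2^(l+2) used later. *)
Lemma fractal_dim_lt_cover E (M : R) : (fractal_dim E < M%:E)%E ->
  exists2 e0, 0 < e0 & forall e, 0 < e -> e < e0 ->
    exists (k : nat) (c : 'I_k -> R * R),
      E `<=` \bigcup_i disk (c i) e /\ k%:R <= 2 * e `^ (- M).
Proof.
move=> /ereal_inf_lt[_ [V /= V0 <-] VM].
have [e1 /= e10 He1] : \forall e \near nbhs (0 : R), 0 < e -> V e by exact: V0.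
exists (Num.min e1 1); first by rewrite lt_min e10 ltr01.
move=> e e0; rewrite lt_min => /andP[ee1 e_lt1].
have Ve : V e by apply: He1 => //=; rewrite sub0r normrN gtr0_norm.
have L0 : 0 < ln e^-1 by rewrite ln_gt0// invf_gt1.
have : (lne (covering_number E e) * ((ln e^-1)^-1)%:E <= M%:E)%E.
  by apply: le_trans (ltW VM); apply: ereal_sup_ubound; exists e.
rewrite lne_quotient_le// => Ne.
have eM : expR (M * ln e^-1) = e `^ (- M).
  by rewrite /powR gt_eqF// lnV ?posrE// mulrN mulNr.
(* The factor 2 makes the inequality strict, so that an actual cover lies below the bound and not
   only the infimum. *)
have : (covering_number E e < (2 * e `^ (- M))%:E)%E.
  apply: le_lt_trans Ne _; rewrite eM lte_fin ltr_pMl ?powR_gt0//; exact: ltr1n.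
move=> /ereal_inf_lt[_ [k [c Ec] <-]]; rewrite lte_fin => /ltW kM.
by exists k, c.
Qed.

Lemma covering_number_le E e (m n : nat) (c : nat -> nat -> R * R) :
  (forall z, E z -> exists i j, [/\ (i < m)%N, (j < n)%N & disk (c i j) e z]) ->
  (covering_number E e <= (m%:R * n%:R)%:E)%E.
Proof.
move=> H; apply: ge_ereal_inf; exists (m * n)%:R%:E; last by rewrite natrM.
exists (m * n)%N => //; exists (fun l : 'I_(m * n) => c (l %/ n)%N (l %% n)%N).
move=> z /H[i [j [im jn zc]]].
have ij : (i * n + j < m * n)%N.
  apply: (@leq_trans (i.+1 * n)); first by rewrite mulSn addnC ltn_add2r.
  by rewrite leq_mul2r im orbT.
exists (Ordinal ij) => //=.
have n0 : (0 < n)%N by apply: leq_ltn_trans jn.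
by rewrite divnMDl// divn_small// addn0 modnMDl modn_small.
Qed.

Lemma grid_point (y s : R) : 0 <= y -> 0 < s ->
  0 <= y - (Num.truncn (y / s))%:R * s < s.
Proof.
move=> y0 s0; have ys : 0 <= y / s by rewrite divr_ge0// ltW.
have h1 : (Num.truncn (y / s))%:R <= y / s by rewrite truncn_le.
have := truncnS_gt (y / s); rewrite -[(Num.truncn _).+1]addn1 natrD => h2.
rewrite ler_pdivlMr// in h1; rewrite ltr_pdivrMr// in h2.
by apply/andP; split; lra.
Qed.

Lemma truncn_mono (x y : R) : 0 <= x -> x <= y -> (Num.truncn x < (Num.truncn y).+1)%N.
Proof.
move=> x0 xy; rewrite -(ltr_nat R); apply: le_lt_trans (truncnS_gt y).
by apply: le_trans xy; rewrite truncn_le.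
Qed.

Notation T := (pi *+ 2 : R).

(** Over a column of width e/2 the graph stays within A = D e^b of its value at the left end, so
    about 1/e columns of about e^(b-1) disks suffice. The +1 in each factor absorbs rounding. *)
Lemma hoelder_covering (f : R -> R) (D b e : R) : 0 < b < 1 -> 0 <= D ->
  (forall x y, `|f x - f y| <= D * `|x - y| `^ b) -> 0 < e < 1 ->
  (covering_number (torus_graph f) e <=
     ((2 * T + 1) * (4 * D + 1) * e `^ (b - 2))%:E)%E.
Proof.
move=> /andP[b0 b1] D0 fD /andP[e0 e1].
have T0 : 0 < T by rewrite mulrn_wgt0// pi_gt0.
(* A square of side e/2 has diagonal e/sqrt 2 < e, so it lies in the disk of radius e centred at its
   corner. *)
pose s := e / 2; have s0 : 0 < s by rewrite divr_gt0.
pose A := D * e `^ b; have A0 : 0 <= A by rewrite mulr_ge0// powR_ge0.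
pose m := (Num.truncn (T / s)).+1; pose n := (Num.truncn (2 * A / s)).+1.
apply: (@le_trans _ _ (m%:R * n%:R)%:E).
  apply: (@covering_number_le _ e m n
    (fun i j => (i%:R * s, f (i%:R * s) - A + j%:R * s))) => _ [x /= + <-].
  rewrite in_itv/= => /andP[x0 xT].
  pose i := Num.truncn (x / s); pose y := f x - (f (i%:R * s) - A).
  have /andP[i1 i2] := grid_point x0 s0; rewrite -/i in i1 i2.
  have fi : `|f x - f (i%:R * s)| <= A.
    apply: le_trans (fD _ _) _; apply: ler_wpM2l => //.
    apply: ge0_ler_powR; rewrite ?nnegrE ?(ltW b0) ?(ltW e0)//.
    by rewrite ger0_norm//; apply: le_trans (ltW i2) _; rewrite /s; lra.
  have /andP[y1 y2] : 0 <= y <= 2 * A.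
    by move: fi; rewrite ler_norml /y => /andP[? ?]; apply/andP; split; lra.
  exists i, (Num.truncn (y / s)); split.
  - by apply: truncn_mono; [exact: divr_ge0 (ltW s0)|rewrite ler_pM2r ?invr_gt0].
  - by apply: truncn_mono; [exact: divr_ge0 (ltW s0)|rewrite ler_pM2r ?invr_gt0].
  have /andP[j1 j2] := grid_point y1 s0.
  rewrite /disk /= -[ltRHS]ger0_norm ?(ltW e0)// -sqrtr_sqr ltr_sqrt ?exprn_gt0//.
  have -> : f x - (f (i%:R * s) - A + (Num.truncn (y / s))%:R * s) =
    y - (Num.truncn (y / s))%:R * s by rewrite /y; ring.
  move: i1 i2 j1 j2; move: (x - _) (y - _) => p q p1 p2 q1 q2.
  have : p ^+ 2 <= s ^+ 2 by rewrite lerXn2r ?nnegrE// ltW.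
  have : q ^+ 2 <= s ^+ 2 by rewrite lerXn2r ?nnegrE// ltW.
  have : e ^+ 2 = 4 * s ^+ 2 by rewrite /s; field.
  have : 0 < s ^+ 2 by rewrite exprn_gt0.
  lra.
rewrite lee_fin.
have m1 : m%:R <= (2 * T + 1) * e^-1.
  have : (Num.truncn (T / s))%:R <= T / s by rewrite truncn_le divr_ge0// ltW.
  rewrite /m -[_.+1]addn1 natrD => h.
  have : 1 <= e^-1 by rewrite invf_ge1 ?ltW.
  have : T / s = 2 * T * e^-1 by rewrite /s; move: (pi *+ 2) => P; field;
    rewrite gt_eqF.
  lra.
have eb : 1 <= e `^ (b - 1).
  rewrite -[leLHS](powRr0 e); apply: ger_powR; first by rewrite e0 ltW.
  lra.
have n1 : n%:R <= (4 * D + 1) * e `^ (b - 1).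
  have : (Num.truncn (2 * A / s))%:R <= 2 * A / s.
    by rewrite truncn_le; apply: divr_ge0; [apply: mulr_ge0|exact: ltW].
  rewrite /n -[_.+1]addn1 natrD => h.
  have : 2 * A / s = 4 * D * e `^ (b - 1).
    rewrite /A powRB; last by rewrite (gt_eqF e0) implybT.
    by rewrite powRr1 ?(ltW e0)// /s; field; rewrite gt_eqF.
  lra.
apply: (@le_trans _ _ ((2 * T + 1) * e^-1 * ((4 * D + 1) * e `^ (b - 1)))).
  by apply: ler_pM.
rewrite le_eqVlt; apply/orP; left; apply/eqP.
have -> : e `^ (b - 2) = e^-1 * e `^ (b - 1).
  rewrite -powR_inv1 ?(ltW e0)// -powRD; last by rewrite (gt_eqF e0) implybT.
  by congr (_ `^ _); ring.
ring.
Qed.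

Lemma hoelder_fractal_dim (f : R -> R) (D b : R) : 0 < b < 1 -> 0 <= D ->
  (forall x y, `|f x - f y| <= D * `|x - y| `^ b) ->
  (fractal_dim (torus_graph f) <= (2 - b)%:E)%E.
Proof.
move=> b01 D0 fD; apply: fractal_dim_le => d d0.
have T0 : 0 < T by rewrite mulrn_wgt0// pi_gt0.
pose K := (2 * T + 1) * (4 * D + 1).
have K0 : 0 < K by rewrite mulr_gt0// ltr_wpDl// mulr_ge0// ltW.
(* Below this threshold K <= e^(-d), so the constant [K] costs no more than the slack. *)
exists (Num.min 1 (expR (- (ln K / d)))); first by rewrite lt_min ltr01 expR_gt0.
move=> e e0; rewrite lt_min => /andP[e1 eK]; split => //.
apply: le_trans (hoelder_covering b01 D0 fD _) _; first by rewrite e0.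
rewrite lee_fin -/K -{1}(lnK K0) /powR gt_eqF// -expRD ler_expR lnV ?posrE//.
have : ln e <= - (ln K / d).
  by rewrite -(ler_expR) lnK ?posrE// ltW.
rewrite -mulNr ler_pdivlMr// => h; lra.
Qed.

Lemma graph_dim_le (u : R -> R[i]) (D b : R) : 0 < b < 1 -> 0 <= D ->
  (forall x y, normc (u x - u y) <= D * `|x - y| `^ b) ->
  (graph_dim u <= (2 - b)%:E)%E.
Proof.
move=> b01 D0 uD; rewrite /graph_dim ge_max; apply/andP; split;
  apply: (hoelder_fractal_dim b01 D0) => x y; rewrite -raddfB.
  by apply: le_trans (normc_Re _) (uD x y).
by apply: le_trans (normc_Im _) (uD x y).
Qed.

End FractalDimension.

(** * Oscillation over columns against the number of disks *)

Section ColumnCounting.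
Context {R : realType}.
Implicit Types (f : R -> R) (h p q a b : R).
Notation T := (pi *+ 2 : R).

Lemma disk_coord (c z : R * R) e : disk c e z -> `|z.1 - c.1| < e /\ `|z.2 - c.2| < e.
Proof.
rewrite /disk /= => d; split; apply: le_lt_trans d; rewrite -sqrtr_sqr;
  apply: ler_wsqrtr.
  by rewrite lerDl sqr_ge0.
by rewrite lerDr sqr_ge0.
Qed.

(* The points of the graph at heights min + 2hl lie in pairwise distinct
   disks of radius h. *)
Lemma column_oscillation f h p q a b (k : nat) (c : 'I_k -> R * R) :
  0 < h -> continuous f -> 0 <= p -> q <= T ->
  torus_graph f `<=` \bigcup_i disk (c i) h ->
  p <= a <= q -> p <= b <= q ->
  `|f b - f a| <= 2 * h * #|[pred j | p - h < (c j).1 < q + h]|%:R.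
Proof.
move=> h0 cf p0 qT fc; wlog ab : a b / a <= b => [H pa pb|].
  have [/H|/ltW/H] := leP a b; first exact.
  by rewrite distrC; exact.
move=> /andP[pa aq] /andP[pb bq].
pose lo := Num.min (f a) (f b); pose l := `|f b - f a|.
have h20 : 0 < 2 * h by rewrite mulr_gt0.
have hiE : Num.max (f a) (f b) = lo + l.
  rewrite /lo /l; have [ab'|ba'] := leP (f a) (f b).
    by rewrite ger0_norm ?subr_ge0// addrC subrK.
  by rewrite ltr0_norm ?subr_lt0// opprB addrC subrK.
pose m := Num.truncn (l / (2 * h)).
have ml : m%:R * (2 * h) <= l.
  by rewrite -ler_pdivlMr// truncn_le; apply: divr_ge0; [exact: normr_ge0|exact: ltW].
have H (i : 'I_m.+1) : exists j, [/\ p - h < (c j).1 < q + h &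
    `|lo + i%:R * (2 * h) - (c j).2| < h].
  have im : i%:R * (2 * h) <= l.
    by apply: le_trans ml; rewrite ler_pM2r// ler_nat -ltnS.
  have [||x xab fx] := @IVT _ f a b (lo + i%:R * (2 * h)) ab.
  - exact: continuous_subspaceT.
  - by rewrite hiE -/lo lerDl mulr_ge0 ?(ltW h20)//= lerD2l.
  move: xab; rewrite in_itv/= => /andP[ax xb].
  have [|j _ /disk_coord[/= d1 d2]] := fc (x, f x).
    exists x => //=; rewrite in_itv/= (le_trans p0 (le_trans pa ax)).
    exact: le_trans xb (le_trans bq qT).
  exists j; split; last by rewrite -fx.
  by move: d1; rewrite ltr_norml => /andP[? ?]; apply/andP; split; lra.
have [phi Hphi] := choice H.
have phi_inj : injective phi.
  move=> i i' E; have [_ d1] := Hphi i; have [_ d2] := Hphi i'; rewrite -E in d2.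
  have : `|(lo + i%:R * (2 * h) - (c (phi i)).2) - (lo + i'%:R * (2 * h) -
    (c (phi i)).2)| < 2 * h.
    by apply: le_lt_trans (ler_normB _ _) _; lra.
  rewrite (_ : _ - _ - _ = (i%:R - i'%:R) * (2 * h)); last by ring.
  rewrite normrM (gtr0_norm h20) -[ltRHS]mul1r ltr_pM2r// => ii.
  apply: val_inj => /=; move: ii; rewrite ltr_norml => /andP[i1 i2].
  have : i%:R < i'.+1%:R :> R by rewrite -natr1; lra.
  have : i'%:R < i.+1%:R :> R by rewrite -natr1; lra.
  by rewrite !ltr_nat !ltnS => ? ?; apply/eqP; rewrite eqn_leq; apply/andP.
have card_m : (m.+1 <= #|[pred j | (p - h < (c j).1 < q + h)%R]|)%N.
  rewrite -[m.+1]card_ord -(card_codom phi_inj); apply: subset_leq_card.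
  by apply/fintype.subsetP => _ /codomP[i ->]; rewrite inE; have [] := Hphi i.
apply: (@le_trans _ _ (2 * h * m.+1%:R)).
  by rewrite mulrC -ler_pdivrMr//; exact/ltW/truncnS_gt.
by rewrite ler_pM2l// ler_nat.
Qed.

(** An open interval of length 3 holds at most one integer of each residue class modulo 3. With x =
    (c j).1 / h this bounds the number of columns, widened by h on both sides, that contain the
    centre of one disk. *)
Lemma card_close (P : nat) (x : R) :
  (#|[pred i : 'I_P | (x - 2 < i%:R < x + 1)%R]| <= 3)%N.
Proof.
pose phi (i : 'I_P) : 'I_3 := inord (i %% 3).
have phi_inj : {in [pred i : 'I_P | (x - 2 < i%:R < x + 1)%R] &, injective phi}.
  move=> i j; rewrite !inE => /andP[i1 i2] /andP[j1 j2] /(congr1 val).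
  rewrite /phi /= !inordK ?ltn_mod// => E; apply: val_inj => /=.
  have : i%:R < (j + 3)%:R :> R by rewrite natrD; lra.
  have : j%:R < (i + 3)%:R :> R by rewrite natrD; lra.
  rewrite !ltr_nat; move: E; clear; lia.
by rewrite -(card_in_imset phi_inj) -[leqRHS](card_ord 3); exact: max_card.
Qed.

(** Double counting: [column_oscillation] charges 2h for each disk near a column, and a disk is near
    at most 3 columns. *)
Lemma columns_oscillation f h (P k : nat) (c : 'I_k -> R * R) (a b : nat -> R) :
  0 < h -> continuous f -> P%:R * h <= T ->
  torus_graph f `<=` \bigcup_i disk (c i) h ->
  (forall i, (i < P)%N -> i%:R * h <= a i <= i.+1%:R * h) ->
  (forall i, (i < P)%N -> i%:R * h <= b i <= i.+1%:R * h) ->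
  \sum_(i < P) `|f (b i) - f (a i)| <= 6 * h * k%:R.
Proof.
move=> h0 cf Ph fc Ha Hb.
apply: (@le_trans _ _ (\sum_(i < P) (2 * h *
  \sum_(j < k) (i%:R * h - h < (c j).1 < i.+1%:R * h + h)%R%:R))).
  apply: ler_sum => i _; apply: le_trans (column_oscillation h0 cf _ _ fc (Ha i _)
    (Hb i _)) _ => //.
  - by rewrite mulr_ge0// ltW.
  - by apply: le_trans Ph; rewrite ler_pM2r// ler_nat.
  rewrite ler_pM2l ?mulr_gt0// -sum1_card natr_sum big_mkcond/=.
  by apply: ler_sum => j _; rewrite inE; case: ifP.
rewrite -mulr_sumr exchange_big/= [6 * h](_ : _ = 2 * h * 3); last by ring.
rewrite -[leRHS]mulrA ler_pM2l ?mulr_gt0//.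
apply: (@le_trans _ _ (\sum_(j < k) 3));
  last by rewrite sumr_const card_ord -[leLHS]mulr_natr.
apply: ler_sum => j _; have := card_close P ((c j).1 / h).
rewrite -(ler_nat R); apply: le_trans.
rewrite -sum1_card natr_sum [leRHS]big_mkcond/=; apply: ler_sum => i _.
rewrite inE; have [/andP[c1 c2]|_] := boolP (i%:R * h - h < (c j).1 < i.+1%:R * h +
  h)%R.
  rewrite ifT//; rewrite -natr1 in c2; apply/andP; split.
    by rewrite ltrBlDr ltr_pdivrMr// mulrDl; lra.
  by rewrite -ltrBlDr ltr_pdivlMr// mulrBl; lra.
by case: ifP.
Qed.

(** Each step from ih + s to (i+1)h + s is cut at the grid point (i+1)h, so that either piece stays
    in one column. One cover thereby serves all shifts [s]. *)
Lemma shifted_variation f h (P k : nat) (c : 'I_k -> R * R) (s : R) :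
  0 < h -> continuous f -> periodic f T -> P%:R * h = T ->
  torus_graph f `<=` \bigcup_i disk (c i) h -> 0 <= s <= h ->
  \sum_(i < P) `|f (i.+1%:R * h + s) - f (i%:R * h + s)| <= 12 * h * k%:R.
Proof.
move=> h0 cf fT Ph fc /andP[s0 sh].
pose phi i := `|f (i%:R * h + s) - f (i%:R * h)|.
(* By periodicity the pieces to the right of the points (i+1)h are those to the right of the points
   ih, reindexed cyclically. *)
have cyc : \sum_(i < P) phi i.+1 = \sum_(i < P) phi i.
  case: P Ph => [|P] Ph; first by rewrite !big_ord0.
  rewrite big_ord_recr big_ord_recl/= addrC; congr (_ + _).
  by rewrite /phi Ph mul0r !add0r [T + s]addrC fT -[in f T](add0r T) fT.
apply: (@le_trans _ _ (\sum_(i < P) (phi i.+1 + `|f (i.+1%:R * h) - f (i%:R * h +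
  s)|))).
  apply: ler_sum => i _; apply: le_trans (ler_normD _ _).
  by rewrite addrA subrK.
rewrite big_split/= cyc.
have iS i : i.+1%:R * h = i%:R * h + h by rewrite -natr1; ring.
have -> : 12 * h * k%:R = 6 * h * k%:R + 6 * h * k%:R by ring.
apply: lerD.
  apply: (@columns_oscillation f h P k c (fun i => i%:R * h) (fun i =>
    i%:R * h + s)) => //.
  - by rewrite Ph.
  - by move=> i _; rewrite iS lexx lerDl ltW.
  - by move=> i _; rewrite iS lerDl s0 lerD2l.
apply: (@columns_oscillation f h P k c (fun i => i%:R * h + s) (fun i =>
  i.+1%:R * h)) => //.
- by rewrite Ph.
- by move=> i _; rewrite iS lerDl s0 lerD2l.
- by move=> i _; rewrite iS lexx lerDl ltW.
Qed.

(** Discrete form of bounding an L^2 norm by the sup and L^1 norms: one factor of each square is at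
    most D h^b, the other is summed as a variation. *)
Lemma shifted_square_variation (u : R -> R[i]) (D b h s : R) (P k1 k2 : nat)
  (c1 : 'I_k1 -> R * R) (c2 : 'I_k2 -> R * R) :
  0 < h -> 0 <= D -> continuous_torus u -> P%:R * h = T ->
  (forall x y, normc (u x - u y) <= D * `|x - y| `^ b) ->
  torus_graph (fun x => complex.Re (u x)) `<=` \bigcup_i disk (c1 i) h ->
  torus_graph (fun x => complex.Im (u x)) `<=` \bigcup_i disk (c2 i) h ->
  0 <= s <= h ->
  \sum_(i < P) normc (u (i.+1%:R * h + s) - u (i%:R * h + s)) ^+ 2 <=
  D * h `^ b * (12 * h * (k1%:R + k2%:R)).
Proof.
move=> h0 D0 [uT ur ui] Ph uD G1 G2 sh.
have V1 : _ <= _ := @shifted_variation _ h P k1 c1 s h0 ur _ Ph G1 sh.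
have V2 : _ <= _ := @shifted_variation _ h P k2 c2 s h0 ui _ Ph G2 sh.
have {}V1 := V1 (fun x => congr1 (@complex.Re R) (uT x)).
have {}V2 := V2 (fun x => congr1 (@complex.Im R) (uT x)).
rewrite mulrDr; apply: le_trans (ler_wpM2l _ (lerD V1 V2));
  last by rewrite mulr_ge0// powR_ge0.
rewrite -big_split/= mulr_sumr; apply: ler_sum => i _.
rewrite expr2; apply: ler_pM; rewrite ?normc_ge0//.
  apply: le_trans (uD _ _) _.
  by rewrite -natr1 (_ : _ - _ = h) ?(gtr0_norm h0)//; ring.
by rewrite -!raddfB; exact: normc_le_ReIm.
Qed.

End ColumnCounting.

(** * Parseval's identity on equispaced points *)

Section DiscreteParseval.
Context {R : realType}.
Notation T := (pi *+ 2 : R).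

Lemma conjc_sum (I : Type) (r : seq I) (P : pred I) (F : I -> R[i]) :
  (\sum_(i <- r | P i) F i)^*%C = \sum_(i <- r | P i) (F i)^*%C.
Proof. exact: rmorph_sum. Qed.

Lemma expi_neq1 (x : R) : 0 < x < T -> expi x != 1.
Proof.
move=> /andP[x0 xT]; apply/eqP => E.
have := normc_expiB x; rewrite E subrr normc0 => /esym/eqP.
rewrite mulf_eq0 pnatr_eq0/= normr_eq0 gt_eqF// sin_gt0_pi// divr_gt0//=.
by rewrite ltr_pdivrMr// mulr_natr.
Qed.

(** A geometric sum whose ratio is a Q-th root of unity, different from 1 unless k = l. Conjugation
    exchanges the roles of [k] and [l]. *)
Lemma expi_orthogonal (Q k l : nat) : (k < Q)%N -> (l < Q)%N ->
  \sum_(j < Q) expi (k%:R * (j%:R * (T / Q%:R)))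
    * (expi (l%:R * (j%:R * (T / Q%:R))))^*%C =
  if k == l then Q%:R else 0.
Proof.
wlog kl : k l / (l <= k)%N => [H kQ lQ|kQ lQ].
  have [/H/(_ kQ lQ)//|/ltnW kl] := leqP l k.
  transitivity ((\sum_(j < Q) expi (l%:R * (j%:R * (T / Q%:R))) *
      (expi (k%:R * (j%:R * (T / Q%:R))))^*%C)^*%C : R[i]).
    by rewrite conjc_sum; apply: eq_bigr => j _; rewrite conjcM conjcK mulrC.
  rewrite (H l k kl lQ kQ) eq_sym; case: ifP => _; last exact: conjc0.
  by rewrite -(rmorph_nat (real_complex R)) /= oppr0.
have Q0 : (0 < Q)%N by apply: leq_ltn_trans kQ.
have Q0' : 0 < Q%:R :> R by rewrite ltr0n.
pose z := expi ((k - l)%:R * (T / Q%:R)).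
rewrite (eq_bigr (fun j : 'I_Q => z ^+ j)); last first.
  by move=> j _; rewrite expiJ -expiD expiX natrB//; congr expi; ring.
have [kE|klN] := eqVneq k l.
  rewrite (eq_bigr (fun=> 1)) ?sumr_const ?card_ord// => j _.
  by rewrite /z kE subnn mul0r expi0 expr1n.
have z1 : z != 1.
  apply: expi_neq1; have kl0 : (0 < k - l)%N by rewrite subn_gt0 ltn_neqAle eq_sym klN.
  have T0 : 0 < T by exact: twopi_gt0.
  rewrite mulr_gt0 ?divr_gt0 ?ltr0n//= mulrCA -[ltRHS]mulr1 ltr_pM2l// ltr_pdivrMr//
    mul1r ltr_nat.
  by apply: leq_ltn_trans kQ; exact: leq_subr.
have zQ : z ^+ Q = 1.
  rewrite expiX (_ : _ * _ = 0 + T * (k - l)%:R) ?expi_period ?expi0//.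
  by rewrite add0r -mulrA divfK ?gt_eqF// mulrC.
have := subrX1 z Q; rewrite zQ subrr => /esym/eqP.
by rewrite mulf_eq0 subr_eq0 (negbTE z1)/= => /eqP.
Qed.

Lemma orthogonal_parseval (M Q : nat) (c : nat -> R[i]) (e : nat -> nat -> R[i]) :
  (forall k l : 'I_M, \sum_(j < Q) e k j * (e l j)^*%C = if k == l then Q%:R else 0) ->
  \sum_(j < Q) normc (\sum_(k < M) c k * e k j) ^+ 2 =
  Q%:R * \sum_(k < M) normc (c k) ^+ 2.
Proof.
move=> orth.
suff : (\sum_(j < Q) normc (\sum_(k < M) c k * e k j) ^+ 2)%:C =
       (Q%:R * \sum_(k < M) normc (c k) ^+ 2)%:C by move=> [].
rewrite rmorph_sum/=.
transitivity (\sum_(k < M) \sum_(l < M) (c k * (c l)^*%C) * \sum_(j < Q)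
  e k j * (e l j)^*%C).
  under [RHS]eq_bigr do under eq_bigr do rewrite mulr_sumr.
  under [RHS]eq_bigr do rewrite exchange_big/=.
  rewrite [RHS]exchange_big/=; apply: eq_bigr => j _.
  rewrite -[LHS]/(real_complex R (normc (\sum_(k < M) c k * e k j) ^+ 2)).
  rewrite -[LHS]normc_sqrJ conjc_sum mulr_suml; apply: eq_bigr => k _.
  by rewrite mulr_sumr; apply: eq_bigr => l _; rewrite conjcM mulrACA.
rewrite rmorphM rmorph_nat rmorph_sum/= mulr_sumr; apply: eq_bigr => k _.
rewrite (bigD1 k)//= [X in _ + X]big1 ?addr0.
  by rewrite orth eqxx mulrC normc_sqrJ.
by move=> l lk; rewrite orth eq_sym (negbTE lk) mulr0.
Qed.

(** With at most [Q] consecutive frequencies no aliasing occurs, so sampling at [Q] points is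
    exact. *)
Lemma discrete_parseval (M Q : nat) (c : nat -> R[i]) : (M <= Q)%N ->
  \sum_(j < Q) normc (\sum_(k < M) c k * expi (k%:R * (j%:R * (T / Q%:R)))) ^+ 2 =
  Q%:R * \sum_(k < M) normc (c k) ^+ 2.
Proof.
move=> MQ; apply: (@orthogonal_parseval M Q c (fun k j =>
  expi (k%:R * (j%:R * (T / Q%:R))))).
by move=> k l; apply: expi_orthogonal; exact: leq_trans MQ.
Qed.

(** Grouping by residues modulo [Q] splits a fine grid into [Q] translates of a coarse one. *)
Lemma sum_ord_mul (F : nat -> R) (P Q : nat) :
  \sum_(j < P * Q) F j = \sum_(r < Q) \sum_(i < P) F (i * Q + r)%N.
Proof.
elim: P => [|P IH].
  by rewrite big_ord0 big1// => r _; rewrite big_ord0.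
rewrite mulSn addnC -(big_mkord xpredT) (big_cat_nat (leq0n _)
  (leq_addr Q (P * Q)))/= big_mkord IH.
rewrite -{1}[(P * Q)%N]add0n big_addn addKn big_mkord -big_split/=.
by apply: eq_bigr => r _; rewrite big_ord_recr/= addnC.
Qed.

End DiscreteParseval.

(** * Fourier decay from small dimension *)

Section FourierDecay.
Context {R : realType}.
Notation T := (pi *+ 2 : R).
Implicit Types (g u : R -> R[i]).

Lemma psum_increment_parseval omega g (t h : R) (N Q : nat) : (N.*2.+1 <= Q)%N ->
  \sum_(j < Q) normc (evolution_partial_sum omega g t N (j%:R * (T / Q%:R) + h) -
                      evolution_partial_sum omega g t N (j%:R * (T / Q%:R))) ^+ 2 =
  Q%:R * \sum_(k < N.*2.+1)
    (normc (fourier_coef g (k%:Z - N%:Z)) * normc (expi ((k%:Z - N%:Z)%:~R * h) -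
      1)) ^+ 2.
Proof.
move=> NQ; pose n k : int := k%:Z - N%:Z.
pose c k : R[i] := fourier_coef g (n k) * expi (t * omega (n k))
  * (expi ((n k)%:~R * h) - 1).
transitivity (Q%:R * \sum_(k < N.*2.+1) normc (c k) ^+ 2); last first.
  congr (_ * _); apply: eq_bigr => k _; congr (_ ^+ 2).
  by rewrite /c !normcM normc_expi mulr1.
rewrite -(discrete_parseval c NQ); apply: eq_bigr => j _; congr (_ ^+ 2).
set x := j%:R * _.
(* The unimodular factor e^{-iNx} moves the frequencies 0, ..., 2N to -N, ..., N. *)
transitivity (normc (expi (- (N%:R * x)) * \sum_(k < N.*2.+1) c k * expi (k%:R * x)));
  last first.
  by rewrite normcM normc_expi mul1r.
rewrite mulr_sumr; congr normc; rewrite /evolution_partial_sum -sumrB;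
  apply: eq_bigr => k _ /=.
rewrite -/(n k) [RHS]mulrCA -expiD /c.
have -> : - (N%:R * x) + k%:R * x = (n k)%:~R * x by rewrite /n intrB; ring.
by rewrite mulrDr addrA !expiD; ring.
Qed.

(* Parseval on P (2N+1) equispaced points, which split into 2N+1 translates of
   the grid of step h on which the increments of u are controlled. *)
Lemma fourier_increment_bound omega g (t h B : R) u (P : nat) (eps : nat -> R) :
  (0 < P)%N -> P%:R * h = T -> (forall N x, normc (u x -
    evolution_partial_sum omega g t N x) <= eps N) ->
  (forall e, 0 < e -> exists N0, forall N, (N0 <= N)%N -> eps N <= e) ->
  (forall s, 0 <= s <= h -> \sum_(i < P) normc (u (i.+1%:R * h + s) - u (i%:R * h +
    s)) ^+ 2 <= B) ->
  forall m L, (0 < m)%N ->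
  \sum_(i < L)
    ((normc (fourier_coef g (m + i)%:Z) * normc (expi ((m + i)%:Z%:~R * h) - 1)) ^+ 2 +
     (normc (fourier_coef g (- (m + i)%:Z)) * normc (expi ((- (m + i)%:Z)%:~R * h) -
       1)) ^+ 2)
  <= 2 * B / P%:R.
Proof.
move=> P0 Ph uP eps0 SB m L m0.
pose G (n : int) := (normc (fourier_coef g n) * normc (expi (n%:~R * h) - 1)) ^+ 2.
rewrite -[X in X <= _]/(\sum_(i < L) (G (m + i)%:Z + G (- (m + i)%:Z))).
have P0' : 0 < P%:R :> R by rewrite ltr0n.
have h0 : 0 < h by rewrite -(pmulr_rgt0 _ P0') Ph twopi_gt0.
have G0 n : 0 <= G n by exact: sqr_ge0.
apply/ler_addgt0Pr => d d0.
(* With y = sqrt(d/8), (a + 2y)^2 <= 2 a^2 + 8 y^2 = 2 a^2 + d: an error [y] at both ends of an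
   increment costs an additive [d] and the factor 2 of the conclusion. *)
have [|N0 HN0] := eps0 (Num.sqrt (d / 8)); first by rewrite sqrtr_gt0 divr_gt0.
pose L' := (L + N0)%N; pose N := (m.-1 + L')%N.
have eN : eps N <= Num.sqrt (d / 8).
  by apply: HN0; rewrite /N /L' addnA leq_addl.
apply: (@le_trans _ _ (\sum_(k < N.*2.+1) G (k%:Z - N%:Z))).
  rewrite sum_symmetric_cat prednK// ler_wpDl ?sumr_ge0//.
  by apply: (@sum_ord_le _ (fun i => G (m + i)%:Z + G (- (m + i)%:Z))) => [r|];
    [rewrite addr_ge0|exact: leq_addr].
pose r0 := N.*2.+1; pose Q := (P * r0)%N.
have NQ : (r0 <= Q)%N by rewrite leq_pmull.
have Q0 : 0 < Q%:R :> R by rewrite ltr0n muln_gt0 P0.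
have r00 : 0 < r0%:R :> R by rewrite ltr0n.
have hQ : T / Q%:R = h / r0%:R.
  by rewrite -Ph /Q natrM; field; rewrite !gt_eqF.
rewrite -(ler_pM2l Q0) -(psum_increment_parseval omega g t h NQ).
pose psum := evolution_partial_sum omega g t N.
have step x : normc (psum (x + h) - psum x) ^+ 2 <= 2 * normc (u (x + h) - u x) ^+ 2 +
  d.
  have h1 : normc (psum (x + h) - psum x) <= normc (u (x + h) - u x) +
    2 * Num.sqrt (d / 8).
    have a1 := le_trans (uP N (x + h)) eN; have a2 := le_trans (uP N x) eN.
    apply: le_trans (normc_triangle (u (x + h)) _ _) _.
    apply: le_trans (lerD (lexx _) (normc_triangle (u x) _ _)) _.
    rewrite normcBC -/psum in a1; rewrite -/psum in a2; lra.
  have s2 := @sqr_sqrtr R (d / 8) ltac:(lra).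
  apply: (@le_trans _ _ ((normc (u (x + h) - u x) + 2 * Num.sqrt (d / 8)) ^+ 2)).
    by rewrite lerXn2r ?nnegrE ?normc_ge0// addr_ge0 ?normc_ge0 ?mulr_ge0 ?sqrtr_ge0.
  have : 0 <= (normc (u (x + h) - u x) - 2 * Num.sqrt (d / 8)) ^+ 2 by exact: sqr_ge0.
  move: (normc _) (Num.sqrt _) s2 => a b; nra.
apply: (@le_trans _ _ (\sum_(j < Q) (2 * normc (u (j%:R * (T / Q%:R) + h) -
  u (j%:R * (T / Q%:R))) ^+ 2 + d))).
  by apply: ler_sum => j _; exact: step.
rewrite big_split/= sumr_const card_ord -[d *+ Q]mulr_natl mulrDr lerD2r -mulr_sumr.
rewrite (@sum_ord_mul _ (fun j =>
  normc (u (j%:R * (T / Q%:R) + h) - u (j%:R * (T / Q%:R))) ^+ 2) P r0).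
apply: (@le_trans _ _ (2 * \sum_(r < r0) B)).
  rewrite ler_pM2l//; apply: ler_sum => r _.
  have rh : 0 <= r%:R * (h / r0%:R) <= h.
    rewrite mulr_ge0 ?divr_ge0 ?(ltW h0)//= mulrCA ler_piMr ?(ltW h0)//.
    by rewrite ler_pdivrMr// mul1r ler_nat ltnW.
  apply: le_trans (SB _ rh); apply: ler_sum => i _.
  rewrite hQ; have -> : (i * r0 + r)%N%:R * (h / r0%:R) = i%:R * h + r%:R * (h / r0%:R).
    by rewrite natrD natrM; field; rewrite gt_eqF.
  have -> : i.+1%:R * h + r%:R * (h / r0%:R) = i%:R * h + r%:R * (h / r0%:R) +
    h by rewrite -natr1; ring.
  exact: lexx.
rewrite sumr_const card_ord -[B *+ r0]mulr_natl /Q natrM le_eqVlt; apply/orP; left;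
  apply/eqP.
by field; rewrite gt_eqF.
Qed.

(** |e^{ix} - 1|^2 = 2 - 2 cos x, and the cosine is nonpositive on this interval. *)
Lemma normc_expiB_ge (x : R) : pi / 2 <= x <= pi -> 2 <= normc (expi x - 1) ^+ 2.
Proof.
move=> /andP[x1 x2]; rewrite sqr_normcE /= subr0.
have c0 : cos x <= 0.
  have -> : cos x = - sin (x - pi / 2) by rewrite sinBpihalf opprK.
  by rewrite oppr_le0; apply: sin_ge0_pi; apply/andP; split; lra.
have := cos2Dsin2 x; nra.
Qed.

Lemma normc_expiB_opp (x : R) : normc (expi (- x) - 1) = normc (expi x - 1).
Proof. by rewrite !normc_expiB mulNr sinN normrN. Qed.

(* For h = 2 pi / 2^(l+2) and 2^l <= n < 2^(l+1) the angle nh lies in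
   [pi/2, pi], where |e^{inh} - 1|^2 >= 2. *)
Lemma fourier_dyadic_decay omega g (t D b M : R) u (eps : nat -> R) :
  0 <= D -> continuous_torus u ->
  (forall x y, normc (u x - u y) <= D * `|x - y| `^ b) ->
  (forall N x, normc (u x - evolution_partial_sum omega g t N x) <= eps N) ->
  (forall e, 0 < e -> exists N0, forall N, (N0 <= N)%N -> eps N <= e) ->
  (graph_dim u < M%:E)%E ->
  exists C l0, 0 <= C /\ forall l, (l0 <= l)%N ->
  \sum_(i < 2 ^ l) (normc (fourier_coef g (2 ^ l + i)%N%:Z) ^+ 2 +
                    normc (fourier_coef g (- (2 ^ l + i)%N%:Z)) ^+ 2) <=
  C * (2 ^ l)%N%:R `^ (- (2 + b - M)).
Proof.
move=> D0 uc uD uP eps0; rewrite /graph_dim gt_max => /andP[].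
move=> /fractal_dim_lt_cover[e1 e10 H1] /fractal_dim_lt_cover[e2 e20 H2].
have T0 := @twopi_gt0 R.
pose S := T / 4; have S0 : 0 < S by rewrite divr_gt0.
(* 48 = 12 * 4: k1 + k2 is at most 4 h^(-M), and with 1/P = h/T the increment bound becomes twice
   (48 D / T) h^(2+b-M), where h = S / 2^l. *)
exists (48 * D / T * S `^ (2 + b - M)).
pose e0 := Num.min e1 e2; have e00 : 0 < e0 by rewrite lt_min e10.
(* Since 2^l > l, this puts h = S / 2^l below both scale thresholds. *)
exists (Num.truncn (S / e0)).+1; split.
  by rewrite !mulr_ge0 ?invr_ge0 ?powR_ge0 ?(ltW T0).
move=> l ll; pose P := (2 ^ l.+2)%N; pose h := T / P%:R.
have P0 : (0 < P)%N by rewrite expn_gt0.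
have P0' : 0 < P%:R :> R by rewrite ltr0n.
have Ph : P%:R * h = T by rewrite /h mulrC divfK ?gt_eqF.
have h0 : 0 < h by rewrite divr_gt0.
have p0 : 0 < (2 ^ l)%N%:R :> R by rewrite ltr0n expn_gt0.
have hS : h = S / (2 ^ l)%N%:R.
  rewrite /h /S /P !expnS !natrM; move: (pi *+ 2) => p.
  by field; rewrite gt_eqF.
have he : h < e0.
  rewrite hS ltr_pdivrMr// mulrC -ltr_pdivrMr//; apply: lt_le_trans (truncnS_gt _) _.
  by rewrite ler_nat; apply: leq_trans ll _; exact/ltnW/ltn_expl.
have [he1 he2] : h < e1 /\ h < e2 by apply/andP; rewrite -lt_min.
have [k1 [c1 [G1 K1]]] := H1 h h0 he1; have [k2 [c2 [G2 K2]]] := H2 h h0 he2.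
pose B := D * h `^ b * (12 * h * (k1%:R + k2%:R)).
have Bs s : 0 <= s <= h -> \sum_(i < P) normc (u (i.+1%:R * h + s) - u (i%:R * h +
  s)) ^+ 2 <= B.
  by move=> sh; apply: (shifted_square_variation h0 D0 uc Ph uD G1 G2 sh).
have := @fourier_increment_bound omega g t h B u P eps P0 Ph uP eps0 Bs (2 ^ l) (2 ^ l)
  ltac:(by rewrite expn_gt0).
move=> F.
have hM : h `^ b * h `^ (- M) * h ^+ 2 = h `^ (2 + b - M).
  rewrite -powR_mulrn ?(ltW h0)// -!powRD; try by rewrite (gt_eqF h0) implybT.
  by congr (_ `^ _); ring.
have BM : 2 * B / P%:R <= 2 * (48 * D / T * S `^ (2 + b - M) * (2 ^ l)%N%:R `^ (- (2 +
  b - M))).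
  have -> : (48 * D / T * S `^ (2 + b - M) * (2 ^ l)%N%:R `^ (- (2 + b - M))) =
    48 * D / T * h `^ (2 + b - M).
    rewrite -mulrA; congr (_ * _); rewrite hS powRM ?invr_ge0 ?(ltW S0)//.
    by rewrite -powR_inv1 ?(ltW p0)// -powRrM mulN1r.
  have -> : 2 * B / P%:R = 2 * (D * h `^ b * (12 * h ^+ 2 * (k1%:R + k2%:R)) / T).
    by rewrite /B -Ph; field; rewrite !gt_eqF.
  rewrite ler_pM2l// -hM.
  have -> : 48 * D / T * (h `^ b * h `^ (- M) * h ^+ 2) =
    D * h `^ b * (12 * h ^+ 2 * (4 * h `^ (- M))) / T by ring.
  rewrite ler_pM2r ?invr_gt0//; apply: ler_wpM2l; first by rewrite mulr_ge0// powR_ge0.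
  apply: ler_wpM2l; first by rewrite mulr_ge0// sqr_ge0.
  lra.
have {BM}F := le_trans F BM.
(* The factor 2 of the increment bound cancels against |e^{inh} - 1|^2 >= 2. *)
rewrite -(@ler_pM2l _ 2)//; apply: le_trans F; rewrite mulr_sumr.
apply: ler_sum => i _; rewrite mulrDr.
have ang : 2 <= normc (expi ((2 ^ l + i)%N%:~R * h) - 1) ^+ 2.
  apply: normc_expiB_ge.
  have hp : h = pi / 2 / (2 ^ l)%N%:R by rewrite hS /S -mulr_natr; field;
    rewrite gt_eqF.
  have -> : (2 ^ l + i)%N%:~R * h = (2 ^ l + i)%N%:R * h by [].
  have -> : (2 ^ l + i)%N%:R * h = pi / 2 + i%:R * (pi / 2 / (2 ^ l)%N%:R).
    by rewrite hp (natrD _ (2 ^ l) i) mulrDl [X in X + _]mulrC divfK ?gt_eqF.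
  have pp : 0 < pi / 2 :> R by rewrite divr_gt0// pi_gt0.
  have i1 : 0 <= i%:R * (pi / 2 / (2 ^ l)%N%:R) :> R by rewrite !mulr_ge0//
    ?invr_ge0 ?pi_ge0.
  have i2 : i%:R * (pi / 2 / (2 ^ l)%N%:R) <= pi / 2 :> R.
    rewrite mulrCA ler_piMr ?(ltW pp)// ler_pdivrMr// mul1r ler_nat; exact: ltnW.
  by apply/andP; split; lra.
rewrite !exprMn mulrNz mulNr normc_expiB_opp.
by apply: lerD; rewrite mulrC; apply: ler_wpM2l => //; exact: sqr_ge0.
Qed.

End FourierDecay.

(** * From dyadic decay of the coefficients to Sobolev regularity *)

Section SobolevRegularity.
Context {R : realType}.
Notation T := (pi *+ 2 : R).
Notation mu := (@lebesgue_measure R).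
Implicit Types (g u : R -> R[i]).

(** On the block starting at 2^l the weight is at most (2 * 2^l)^(1+delta/2), because 1 + n^2 <=
    (n+1)^2; against the decay 2^(-l(1+delta)) a geometric ratio 2^(-delta/2) remains. The indices
    below 2^l0 form the finite part [B0]. *)
Lemma dyadic_weighted_sum (w : nat -> R) (C delta : R) (l0 : nat) :
  (forall n, 0 <= w n) -> 0 <= C -> 0 < delta ->
  (forall l, (l0 <= l)%N -> \sum_(i < 2 ^ l) w (2 ^ l + i)%N <=
     C * (2 ^ l)%N%:R `^ (- (1 + delta))) ->
  exists B, forall n, \sum_(i < n) (1 + i%:R ^+ 2) `^ (1 / 2 + delta / 4) * w i <= B.
Proof.
move=> w0 C0 d0 wC; pose s := 1 / 2 + delta / 4.
have s0 : 0 <= s by rewrite /s; lra.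
pose W i := (1 + i%:R ^+ 2) `^ s * w i.
have W0 i : 0 <= W i by rewrite mulr_ge0 ?powR_ge0.
pose q : R := 2 `^ (- (delta / 2)).
have q0 : 0 < q by rewrite powR_gt0.
have q1 : q < 1.
  rewrite /q powRN invf_lt1 ?powR_gt0//.
  have := @gt0_ltr_powR R (delta / 2) _ 1 2; rewrite powR1; apply;
    rewrite ?nnegrE ?divr_gt0//.
  exact: ltr1n.
pose K := 2 `^ (1 + delta / 2) * C.
have K0 : 0 <= K by rewrite mulr_ge0// powR_ge0.
have block l : (l0 <= l)%N -> \sum_(i < 2 ^ l) W (2 ^ l + i)%N <= K * q ^+ l.
  move=> ll; have p0 : 0 < (2 ^ l)%N%:R :> R by rewrite ltr0n expn_gt0.
  pose p : R := (2 ^ l)%N%:R; rewrite -/p in p0.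
  apply: (@le_trans _ _ ((2 * p) `^ (1 + delta / 2) * \sum_(i < 2 ^ l) w (2 ^ l +
    i)%N)).
    rewrite mulr_sumr; apply: ler_sum => i _; apply: ler_wpM2r => //.
    have -> : (2 * p) `^ (1 + delta / 2) = ((2 * p) ^+ 2) `^ s.
      rewrite -powR_mulrn ?mulr_ge0 ?(ltW p0)// -powRrM; congr (_ `^ _).
      by rewrite /s; field.
    apply: ge0_ler_powR; rewrite ?s0 ?nnegrE ?addr_ge0 ?sqr_ge0//.
    apply: (@le_trans _ _ (((2 ^ l + i)%N%:R + 1) ^+ 2)).
      by have := ler0n R (2 ^ l + i); move: ((2 ^ l + i)%N%:R) => x x0; nra.
    rewrite lerXn2r ?nnegrE ?addr_ge0 ?mulr_ge0 ?(ltW p0)//.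
    have ip : i%:R + 1 <= p by rewrite natr1 ler_nat.
    by rewrite natrD -/p; lra.
  apply: le_trans (ler_wpM2l (powR_ge0 _ _) (wC l ll)) _.
  rewrite powRM ?(ltW p0)// -/p /K le_eqVlt; apply/orP; left; apply/eqP.
  have -> : q ^+ l = p `^ (1 + delta / 2) * p `^ (- (1 + delta)).
    rewrite -powRD; last by rewrite (gt_eqF p0) implybT.
    rewrite -powR_mulrn ?(ltW q0)// -powRrM /p natrX -powR_mulrn// -powRrM.
    by congr (_ `^ _); field.
  by ring.
pose B0 := \sum_(i < 2 ^ l0) W i.
have total m : \sum_(i < 2 ^ (l0 + m)) W i <= B0 + K * (1 - q ^+ m) / (1 - q).
  have q1' : 0 < 1 - q by rewrite subr_gt0.
  elim: m => [|m IH]; first by rewrite addn0 expr0 subrr mulr0 mul0r addr0.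
  rewrite addnS expnS mul2n -addnn big_split_ord/=.
  apply: le_trans (lerD IH (block _ (leq_addr _ _))) _.
  rewrite -addrA lerD2l exprD.
  have -> : K * (1 - q ^+ m.+1) / (1 - q) = K * (1 - q ^+ m) / (1 - q) + K * q ^+ m.
    by rewrite exprS; field; rewrite gt_eqF.
  rewrite lerD2l; apply: ler_wpM2l => //; rewrite ler_piMl ?exprn_ge0 ?(ltW q0)//.
  by rewrite exprn_ile1// ltW.
exists (B0 + K / (1 - q)) => n.
apply: (@le_trans _ _ (\sum_(i < 2 ^ (l0 + n)) W i)).
  apply: (@sum_ord_le _ W) => //;
    apply: leq_trans (ltnW (ltn_expl n (isT : 1 < 2)%N)) _.
  by rewrite leq_exp2l// leq_addl.
apply: le_trans (total n) _; rewrite lerD2l -mulrA; apply: ler_wpM2l => //.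
by rewrite ler_piMl ?invr_ge0 ?subr_ge0 ?(ltW q1)// gerBl exprn_ge0// ltW.
Qed.

Lemma esum_nat_le (a : nat -> R) (B : R) : (forall n, 0 <= a n) ->
  (forall n, \sum_(i < n) a i <= B) -> (\esum_(i in [set: nat]) (a i)%:E <= B%:E)%E.
Proof.
move=> a0 aB; rewrite -nneseries_esumT; last by move=> n; rewrite lee_fin.
apply: lime_le; first by apply: is_cvg_nneseries => n _ _; rewrite lee_fin.
by apply: nearW => n; rewrite sumEFin lee_fin big_mkord.
Qed.

(** The two halves are parametrized by [Posz] and [Negz]; the latter stands for -(i+1), so 0 is
    counted once. *)
Lemma esum_int_lty (f : int -> R) (B : R) : (forall n, 0 <= f n) ->
  (forall n, \sum_(i < n) f i%:Z <= B) -> (forall n, \sum_(i < n) f (- i.+1%:Z) <= B) ->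
  (\esum_(n in [set: int]) (f n)%:E < +oo)%E.
Proof.
move=> f0 fP fN; rewrite (esumID [set n : int | 0 <= n]); last by move=> i _;
  rewrite lee_fin.
rewrite !setTI (reindex_esum [set: nat] _ Posz); last first.
  split; first by move=> n _ /=.
    by move=> m n _ _ [].
  by move=> [n|n] //= _; exists n.
rewrite (reindex_esum [set: nat] (~` _) Negz); last first.
  split; first by move=> n _ /=.
    by move=> m n _ _ [].
  move=> [n|n] /= H; first by case: H.
  by exists n.
apply: (@le_lt_trans _ _ (B%:E + B%:E)%E); last by rewrite -EFinD ltry.
apply: leeD; first by apply: esum_nat_le => // n; exact: f0.
apply: (@esum_nat_le (fun n => f (Negz n))) => n; first exact: f0.
by under eq_bigr do rewrite NegzE; exact: fN.
Qed.

(** Translates of [0, 2 pi] cover the line; there are two countable families because the number of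
    periods is an integer of either sign. *)
Lemma periodic_measurable (f : R -> R) : periodic f T -> measurable_fun `[0, T] f ->
  measurable_fun setT f.
Proof.
move=> fT mf; have T0 := @twopi_gt0 R.
have piece (m : int) : measurable_fun `[- (T * m%:~R), T - T * m%:~R] f.
  rewrite (_ : f = f \o (fun x => x + T * m%:~R)); last first.
    by apply/funext => x /=; rewrite periodic_int.
  apply: (measurable_comp _ _ mf) => //.
    move=> _ [x /= + <-]; rewrite !in_itv/= => /andP[? ?]; apply/andP; split; lra.
  by apply: measurable_funTS; exact: measurable_funD.
have -> : [set: R] = (\bigcup_(n : nat) [set` `[- (T * n%:Z%:~R), T -
  T * n%:Z%:~R]]) `|`
                     (\bigcup_(n : nat) [set` `[- (T * (- n%:Z)%:~R), T -
                       T * (- n%:Z)%:~R]]).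
  apply/seteqP; split => // x _; have [m /andP[m1 m2]] := torus_reduce x.
  have H : `[- (T * m%:~R), T - T * m%:~R]%classic x.
    by rewrite /= in_itv/=; apply/andP; split; lra.
  case: m {m1 m2} H => n H; [left; exists n => //|right; exists n.+1 => //].
apply/measurable_funU; [exact: bigcup_measurable|exact: bigcup_measurable|].
by split; apply/measurable_fun_bigcup => // n; exact: piece.
Qed.

(** [sobolev] includes membership in L^2, which bounded variation supplies through boundedness and
    measurability. *)
Lemma BV_L2_torus g : BV_torus g -> L2_torus g.
Proof.
move=> gBV; have [gT _ _] := gBV; have [v [w [Hv Hw]]] := BV_torus_majorant gBV.
have T0 := @twopi_gt0 R.
have mr := majorant_measurable (ltW T0) Hv; have mi := majorant_measurable (ltW T0) Hw.
split => //.
- by apply: periodic_measurable mr => x; rewrite /= gT.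
- by apply: periodic_measurable mi => x; rewrite /= gT.
pose B := (`|complex.Re (g 0)| + (v T - v 0)) ^+ 2 + (`|complex.Im (g 0)| + (w T -
  w 0)) ^+ 2.
have cS : (mu `[0%R, T] = T%:E)%E by rewrite /= lebesgue_measure_itv/= lte_fin T0 -EFinB
  subr0.
apply: (@le_lt_trans _ _ (\int[mu]_(x in `[0%R, T]) (cst B%:E x))%E); last first.
  by rewrite integral_cst//; move: cS => /= ->; rewrite -EFinM ltry.
apply: ge0_le_integral => //.
- by move=> x _; rewrite lee_fin sqr_ge0.
- apply/measurable_EFinP.
  apply: (eq_measurable_fun (fun x => complex.Re (g x) ^+ 2 + complex.Im (g x) ^+ 2)).
    by move=> x _; rewrite -sqr_normcE.
  by apply: measurable_funD; exact: measurable_funX.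
move=> x /=; rewrite in_itv/= => /andP[x0 xT]; rewrite lee_fin sqr_normcE.
apply: lerD; rewrite -[leLHS]real_normK ?num_real//.
  by rewrite lerXn2r ?nnegrE ?(le_trans _ (majorant_bounded Hv x0 xT))//
    (majorant_bounded Hv x0 xT).
by rewrite lerXn2r ?nnegrE ?(le_trans _ (majorant_bounded Hw x0 xT))//
  (majorant_bounded Hw x0 xT).
Qed.

Lemma sobolev_half_plus_decay g (C delta : R) (l0 : nat) : BV_torus g -> 0 <= C ->
  0 < delta ->
  (forall l, (l0 <= l)%N ->
   \sum_(i < 2 ^ l) (normc (fourier_coef g (2 ^ l + i)%N%:Z) ^+ 2 +
                     normc (fourier_coef g (- (2 ^ l + i)%N%:Z)) ^+ 2) <=
   C * (2 ^ l)%N%:R `^ (- (1 + delta))) ->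
  sobolev_half_plus g.
Proof.
move=> gBV C0 d0 gC; exists (1 / 2 + delta / 4); first lra.
split; first exact: BV_L2_torus.
set s := 1 / 2 + delta / 4.
pose w (n : nat) := normc (fourier_coef g n%:Z) ^+ 2 +
  normc (fourier_coef g (- n%:Z)) ^+ 2.
have w0 n : 0 <= w n by rewrite addr_ge0// sqr_ge0.
have [B HB] := @dyadic_weighted_sum w C delta l0 w0 C0 d0 gC.
apply: (@esum_int_lty _ B) => [n|n|n]; first by rewrite mulr_ge0 ?powR_ge0 ?sqr_ge0.
  apply: le_trans (HB n); apply: ler_sum => i _; apply: ler_wpM2l;
    first exact: powR_ge0.
  by rewrite /w lerDl sqr_ge0.
(* Negative frequencies start at -1, so the comparison drops the term of index 0. *)
apply: le_trans (HB n.+1); rewrite big_ord_recl/= ler_wpDl ?mulr_ge0 ?powR_ge0//.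
apply: ler_sum => i _; rewrite /bump/= add1n mulrNz sqrrN.
apply: ler_wpM2l; first exact: powR_ge0.
by rewrite /w lerDr sqr_ge0.
Qed.

End SobolevRegularity.

Theorem theorem1p5 (R : realType) (alpha : R)
    (halpha : 0 < alpha < 2) (halpha1 : alpha != 1)
    (g : R -> R[i]) (hg : BV_torus g) :
  (forall t : R, t != 0 ->
     (exists2 u : R -> R[i],
        is_evolution (frac_omega alpha) g t u &
        hoelder_torus (frac_beta alpha) u)
     /\ (forall d : \bar R, is_evolution_dim (frac_omega alpha) g t d ->
           (d <= (2 - frac_beta alpha)%:E)%E))
  /\
  (~ sobolev_half_plus g ->
   forall t : R, t != 0 ->
     forall d : \bar R, is_evolution_dim (frac_omega alpha) g t d ->
       ((1 + frac_beta alpha)%:E <= d)%E).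
Proof.
have beta01 := frac_beta_lt1 halpha halpha1; have [beta0 beta1] := andP beta01.
split=> [t t0|gs t t0 d [u [uev uc ->]]].
  have [u [D [D0 uS uH]]] := evolution_uniform_limit halpha halpha1 t0 hg.
  split.
    exists u; first exact: limit_is_evolution uS uH.
    by split; [exact: limit_period uS|exists D].
  move=> d [w [wev wc ->]]; rewrite (evolution_unique halpha halpha1 D0 uS uH wev wc).
  exact: graph_dim_le uH.
have [v [D [D0 vS vH]]] := evolution_uniform_limit halpha halpha1 t0 hg.
(* The given representative is replaced by the uniform limit [v], for which the Hoelder bound is
   known. *)
have E := evolution_unique halpha halpha1 D0 vS vH uev uc; rewrite {u uev}E in uc *.
rewrite leNgt; apply/negP => dlt; apply: gs.
(* The exponent in h^(-M) must be a real number while the dimension is an extended one; for the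
   formal value -oo any real below 1 + beta does, here beta. *)
have [M vM Mb] : exists2 M : R, (graph_dim v < M%:E)%E & M < 1 + frac_beta alpha.
  case: (graph_dim v) dlt => [r| |]; rewrite ?lte_fin => rb.
  - exists ((r + (1 + frac_beta alpha)) / 2); rewrite ?lte_fin; lra.
  - by [].
  - by exists (frac_beta alpha); [exact: ltNyr|lra].
have eps0 e : 0 < e -> exists N0, forall N, (N0 <= N)%N ->
  D * N.+1%:R `^ (- frac_beta alpha) <= e.
  exact: powRN_small.
have [C [l0 [C0 HC]]] := fourier_dyadic_decay D0 uc vH vS eps0 vM.
(* The decay exponent 2 + beta - M is 1 + delta with delta = 1 + beta - M, positive by the choice of
   [M]. *)
apply: (@sobolev_half_plus_decay _ g C (1 + frac_beta alpha - M) l0) => //.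
  by rewrite subr_gt0.
move=> l /HC; rewrite (_ : 1 + (1 + frac_beta alpha - M) = 2 + frac_beta alpha - M)//;
  ring.
Qed.
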